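(* Let $\mathcal{B}$ be a Banach space, $U\subset\mathcal{B}$ a non-empty open convex set, $r_0>0$, and $(\Omega,\mathcal{F},\mathbb{P})$ a probability space with an invertible, measure-preserving, ergodic $\tau$. For each $r\in(0,r_0]$ let $E_r$ be a real Banach space with a closed convex cone $\mathcal{C}_r$ ($\mathbb{R}_+\mathcal{C}_r=\mathcal{C}_r$, $\mathcal{C}_r\cap(-\mathcal{C}_r)=\{0\}$), $\ell_r\in E_r'$ of norm one and constants $K_r\ge1$, $\rho_r\in(0,1]$, $\vartheta_r\ge1$ such that $\langle\ell_r,\phi\rangle\ge\|\phi\|/K_r$ for $\phi\in\mathcal{C}_r$ and $\mathcal{C}_r(\rho_r)=\{\phi\in\mathcal{C}_r:B(\phi,\rho_r\|\phi\|)\subset\mathcal{C}_r\}\neq\{0\}$; all constants and norms are uniformly bounded on compact subsets of $(0,r_0]$. For $0<s<r\le r_0$ let $j_{s,r}:E_r\to E_s$ be continuous linear injections with $\sup_{s,r}\|j_{s,r}\|<\infty$, $j_{t,s}j_{s,r}=j_{t,r}$ for $t<s<r$, $j_{s,r}(\mathcal{C}_r)\subset\mathcal{C}_s$ and $\ell_r=\ell_s\circ j_{s,r}$. Let $X_r=L^\infty(\Omega;E_r)$ (bounded Bochner measurable sections, sup norm) and let $\mathbf{j}_{s,r}:X_r\to X_s$ act fiberwise by $j_{s,r}$. For each $r\in(0,r_0]$ and $u\in U$ let $(\mathcal{L}_{r,u,\omega})_{\omega\in\Omega}\subset L(E_r)$ satisfy $\mathcal{L}_{r,u,\omega}(\mathcal{C}_r\setminus\{0\})\subset\mathcal{C}_r(\rho_r)\setminus\{0\}$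 and $\frac1{\vartheta_r}\le\|\mathcal{L}_{r,u,\omega}\|\le\vartheta_r$, such that $\mathbf{L}_{r,u}:X_r\to X_r$, $(\mathbf{L}_{r,u}\boldsymbol\phi)_\omega=\mathcal{L}_{r,u,\tau^{-1}\omega}\phi_{\tau^{-1}\omega}$, preserves Bochner measurability, and $j_{s,r}\mathcal{L}_{r,u,\omega}=\mathcal{L}_{s,u,\omega}j_{s,r}$ for all $0<s<r\le r_0$, $u$, $\omega$. Let $\boldsymbol\pi_{r,u}(\boldsymbol\phi)_\omega=\mathcal{L}_{r,u,\tau^{-1}\omega}\phi_{\tau^{-1}\omega}/\langle\ell_r,\mathcal{L}_{r,u,\tau^{-1}\omega}\phi_{\tau^{-1}\omega}\rangle$, and let $\mathbf{f}_r(u)\in X_r$ be its unique fixed point with values in $\{\phi\in\mathcal{C}_r(\rho_r):\langle\ell_r,\phi\rangle=1\}$ (these satisfy $\mathbf{j}_{s,r}\mathbf{f}_r(u)=\mathbf{f}_s(u)$). Let $\boldsymbol\Lambda_u(\mathbf{f})=\langle\ell_r,\mathbf{L}_{r,u}\mathbf{f}_r(u)\rangle\in L^\infty(\Omega,\mathbb{R}_+)$ (independent of $r$). Suppose that for every $0<s<r\le r_0$ and $t\in[0,r-s)$ the map $u\in U\mapsto\mathbf{L}_{s,u}\mathbf{j}_{s,r}\in L(X_r,X_s)$ is $C^t$. Then for every $0<s<r_0$ and $0<t<r_0-s$, the maps \[u\mapsto\mathbf{f}_s(u)\in X_s,\qquad u\mapsto\boldsymbol\Lambda_u(\mathbf{f})\in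 L^\infty(\Omega,\mathbb{R}_+),\qquad u\mapsto\int_\Omega\log\Lambda_u(\mathbf{f})_\omega\,d\mathbb{P}(\omega)\] are all $C^t$. In particular the last expression (the characteristic exponent) is $C^{r_0-\epsilon}$ for every $\epsilon>0$.
   Context: For $t=k+\alpha$ with $k\in\mathbb{N}_0$ and $\alpha\in(0,1]$, a map $g$ from $U$ into a Banach space is $C^t$ if it is $k$ times Fréchet differentiable with bounded derivatives and its $k$-th derivative is $\alpha$-Hölder; $C^0$ means continuous. Bochner measurable means uniform limit of measurable countably-valued maps. *)

(* Defs.v *)
From HB Require Import structures.
From mathcomp Require Import all_boot all_order all_algebra.
From mathcomp Require Import all_classical all_reals all_analysis.
Set Implicit Arguments. Unset Strict Implicit. Unset Printing Implicit Defensive.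
Import Order.TTheory GRing.Theory Num.Theory.
Import numFieldNormedType.Exports.
Local Open Scope classical_set_scope.
Local Open Scope ring_scope.

Section Defs.
Variable R : realType.

Definition is_linear (V W : lmodType R) (f : V -> W) : Prop :=
  forall (a : R) (x y : V), f (a *: x + y) = a *: f x + f y.

Definition opnorm (V W : normedModType R) (f : V -> W) : \bar R :=
  ereal_sup [set (`|f x|)%:E | x in [set x : V | `|x| <= 1]].

Definition closed_convex_cone (V : normedModType R) (C : set V) : Prop :=
  [/\ closed C, C 0,
      (forall (a : R) x, 0 <= a -> C x -> C (a *: x)),
      (forall x y (t : R), C x -> C y -> 0 <= t <= 1 -> C (t *: x + (1 - t) *: y))
    & (forall x, C x -> C (- x) -> x = 0)].

Definition cone_rho (V : normedModType R) (C : set V) (rho : R) : set V :=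
  [set phi | C phi /\ ball phi (rho * `|phi|) `<=` C].

Definition countably_valued_measurable d (Om : measurableType d) (V : normedModType R)
    (g : Om -> V) : Prop :=
  countable (range g) /\ forall x : V, measurable (g @^-1` [set x]).

Definition bochner_measurable d (Om : measurableType d) (V : normedModType R)
    (f : Om -> V) : Prop :=
  exists g : nat -> Om -> V,
    (forall n, countably_valued_measurable (g n)) /\
    (forall e : R, 0 < e -> exists N : nat, forall n, (N <= n)%N ->
        forall w, `|g n w - f w| <= e).

Definition inLinf d (Om : measurableType d) (V : normedModType R) (f : Om -> V) : Prop :=
  bochner_measurable f /\ exists M : R, forall w, `|f w| <= M.

Definition supnorm d (Om : measurableType d) (V : normedModType R) (f : Om -> V) : \bar R :=
  ereal_sup [set (`|f w|)%:E | w in [set: Om]].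

Definition Linf_opnorm d (Om : measurableType d) (V W : normedModType R)
    (A : (Om -> V) -> (Om -> W)) : \bar R :=
  ereal_sup [set supnorm (A phi) |
     phi in [set phi : Om -> V | inLinf phi /\ (supnorm phi <= 1)%E]].

Section Ct.
Variables (B : normedModType R) (Y : lmodType R) (N : Y -> \bar R).

Definition multilinear (j : nat) (M : ('I_j -> B) -> Y) : Prop :=
  forall (i : 'I_j) (v : 'I_j -> B) (a : R) (x y : B),
    M (fun k => if k == i then a *: x + y else v k)
    = a *: M (fun k => if k == i then x else v k) + M (fun k => if k == i then y else v k).

Definition mlnorm (j : nat) (M : ('I_j -> B) -> Y) : \bar R :=
  ereal_sup [set N (M v) | v in [set v : 'I_j -> B | forall i, `|v i| <= 1]].

Definition cons_arg (j : nat) (h : B) (v : 'I_j -> B) : 'I_j.+1 -> B :=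
  fun k => if unlift ord0 k is Some k' then v k' else h.

(* k times Frechet differentiable on U with bounded derivatives D^0 = g, ..., D^k,
   and D^k alpha-Hoelder; D j u is the j-th derivative at u, a j-linear map *)
Definition Ck_alpha (U : set B) (k : nat) (alpha : R) (g : B -> Y) : Prop :=
  exists D : forall j : nat, B -> ('I_j -> B) -> Y,
  [/\ (forall u v, U u -> D 0%N u v = g u),
      (forall j u, (j <= k)%N -> U u -> multilinear (D j u)),
      (exists Mb : R, forall j u, (j <= k)%N -> U u -> (mlnorm (D j u) <= Mb%:E)%E),
      (forall j u, (j < k)%N -> U u ->
         forall e : R, 0 < e -> exists d : R, 0 < d /\
           forall h : B, `|h| < d -> U (u + h) ->
             (mlnorm (fun v => D j (u + h) v - D j u v - D j.+1 u (cons_arg h v))%R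
                <= (e * `|h|)%:E)%E)
    & (exists C : R, forall u w, U u -> U w ->
         (mlnorm (fun v => D k u v - D k w v)%R <= (C * `|u - w| `^ alpha)%:E)%E)].

Definition continuous_on_N (U : set B) (g : B -> Y) : Prop :=
  forall u, U u -> forall e : R, 0 < e -> exists d : R, 0 < d /\
    forall w, U w -> `|w - u| < d -> (N (g w - g u)%R <= e%:E)%E.

Definition Ct (U : set B) (t : R) (g : B -> Y) : Prop :=
  (t = 0 /\ continuous_on_N U g) \/
  (exists (k : nat) (alpha : R), [/\ t = k%:R + alpha, 0 < alpha <= 1 & Ck_alpha U k alpha g]).

End Ct.

End Defs.

(* Main.v *)
Require Import Defs.
From HB Require Import structures.
From mathcomp Require Import all_boot all_order all_algebra.
From mathcomp Require Import all_classical all_reals all_analysis.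
From mathcomp Require Import ring lra.
Import Order.TTheory GRing.Theory Num.Theory.
Import numFieldNormedType.Exports.
Local Open Scope classical_set_scope.
Local Open Scope ring_scope.

(** Every image of a cone vector dominates a fixed multiple [c] of [f(u)], in the
    order of the cone.  This Doeblin bound makes the oscillation of a section
    with respect to [f(u)] shrink by [1 - c] at each step, so the linearization
    [T x = lam x - L x + <ell, L x> f] of the fixed point equation is invertible
    on every level, uniformly in [u].  The same argument applied to ratios
    compares [f(u)] with any approximate fixed point: it gives the uniqueness
    of [f(u)], hence its compatibility with the [j s r], and its Hoelder
    continuity.

    Families of operators from level [r] to level [s] are graded by the number
    [m] of derivatives already taken: they are Hoelder for every exponent less
    than [r - s - m].  Orders add under composition, because the loss can be
    distributed over an intermediate level, and the inverse of a family of
    order 0 has order 0.  Differentiating the fixed point equation gives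
    [f' = T^-1 (L' f - <ell, L' f> f)], so if [f] is [k] times differentiable
    along the scale then so is [f'].
    Finally [lam = <ell, L f>] and its logarithm act by multiplication
    on the constant scale, where integration is an operator independent of [u]. *)

Set Implicit Arguments.
Unset Strict Implicit.
Unset Printing Implicit Defensive.

(** Regularity in [u] is granted only for [L] followed by a drop of level; at one fixed level [L]
    need not even be continuous in [u]. This rules out an implicit function theorem in a single
    Banach space: [T] is invertible with bounds on each level separately, while increments in [u]
    are controlled only between two levels. The proof therefore uses identities such as
    [T_u (S_u - S_v) = (T_v - T_u) S_v], which put every increment on a factor that may drop levels
    and keep the inverse on its own level. All gaps between levels are strict, so each estimate
    leaves some slack; it pays for the small Hoelder exponent that makes the cross terms [o(|h|)].
    Everything is an operator family, so that one composition lemma serves throughout: [f] is the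
    operator [c |-> c f] on the constant scale. Directions of differentiation are stored in the
    index of a family, so that a derivative is a family of the same kind, with bounds proportional
    to the product of the norms of the directions. *)

(* Linear expressions over a module, normalized to their coefficients: the
   tactic [lmod_over] reduces an identity in a module to [ring] identities. *)
Inductive lexp (R : Type) : Type :=
| LVar of nat
| LZero
| LAdd of lexp R & lexp R
| LOpp of lexp R
| LScale of R & lexp R.

Section LinearExpressions.
Variables (R : comRingType) (V : lmodType R).

Fixpoint lval (env : seq V) (e : lexp R) : V :=
  match e with
  | LVar n => nth 0 env n
  | LZero => 0
  | LAdd a b => lval env a + lval env b
  | LOpp a => - lval env a
  | LScale c a => c *: lval env a
  end.

Fixpoint lcoef (e : lexp R) (i : nat) : R :=
  match e with
  | LVar n => if eqn i n then 1 else 0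
  | LZero => 0
  | LAdd a b => lcoef a i + lcoef b i
  | LOpp a => - lcoef a i
  | LScale c a => c * lcoef a i
  end.

Fixpoint lcoef_eq (n : nat) (e1 e2 : lexp R) : Prop :=
  match n with
  | 0 => True
  | n.+1 => lcoef e1 n = lcoef e2 n /\ lcoef_eq n e1 e2
  end.

Lemma lvalE (env : seq V) (e : lexp R) :
  lval env e = \sum_(i < size env) lcoef e i *: nth 0 env i.
Proof.
elim: e => [n||a IHa b IHb|a IHa|c a IHa] /=.
- case: (ltnP n (size env)) => hn; last first.
    rewrite nth_default // big1 // => i _.
    have -> : eqn i n = false.
      by apply/negbTE/negP => /eqnP ein; move: (ltn_ord i); rewrite ein ltnNge hn.
    by rewrite scale0r.
  rewrite (bigD1 (Ordinal hn)) //= big1 => [|i hi].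
    by have -> : eqn n n by [apply/eqnP]; rewrite scale1r addr0.
  have -> : eqn i n = false.
    by apply/negbTE/negP => /eqnP ein; move: hi => /eqP; apply; apply: val_inj.
  by rewrite scale0r.
- by rewrite big1 // => i _; rewrite scale0r.
- by rewrite IHa IHb -big_split; apply: eq_bigr => i _; rewrite scalerDl.
- by rewrite IHa -sumrN; apply: eq_bigr => i _; rewrite scaleNr.
- by rewrite IHa scaler_sumr; apply: eq_bigr => i _; rewrite scalerA.
Qed.

Lemma lval_eq (env : seq V) (e1 e2 : lexp R) :
  lcoef_eq (size env) e1 e2 -> lval env e1 = lval env e2.
Proof.
move=> h; rewrite !lvalE; apply: eq_bigr => i _; congr (_ *: _).
elim: (size env) (i : nat) (ltn_ord i) h => [//|n IHn] k.
rewrite ltnS leq_eqVlt => /orP[/eqP-> [] //|kn [_ h]].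
exact: IHn.
Qed.

End LinearExpressions.

(** Atoms are compared syntactically by [constr_eq]; being a tactic, it is run inside a dummy
    [match] so that its failure triggers backtracking while a term is being built. *)
Ltac lmod_mem x env :=
  lazymatch env with
  | nil => constr:(false)
  | ?y :: ?t =>
      match constr:(tt) with
      | _ => let _ := match constr:(tt) with _ => constr_eq x y end in
             constr:(true)
      | _ => lmod_mem x t
      end
  end.

Ltac lmod_pos x env :=
  lazymatch env with
  | ?y :: ?t =>
      match constr:(tt) with
      | _ => let _ := match constr:(tt) with _ => constr_eq x y end in
             constr:(0%N)
      | _ => let n := lmod_pos x t in constr:(S n)
      end
  end.

Ltac lmod_env t env :=
  lazymatch t with
  | (?a + ?b)%R => let env := lmod_env a env in lmod_env b env
  | (- ?a)%R => lmod_env a env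
  | (?c *: ?a)%R => lmod_env a env
  | 0%R => env
  | _ => lazymatch lmod_mem t env with
         | true => env
         | false => constr:(t :: env)
         end
  end.

Ltac lmod_reify R t env :=
  lazymatch t with
  | (?a + ?b)%R =>
      let ea := lmod_reify R a env in
      let eb := lmod_reify R b env in constr:(@LAdd R ea eb)
  | (- ?a)%R => let ea := lmod_reify R a env in constr:(@LOpp R ea)
  | (?c *: ?a)%R => let ea := lmod_reify R a env in constr:(@LScale R c ea)
  | 0%R => constr:(@LZero R)
  | _ => let n := lmod_pos t env in constr:(@LVar R n)
  end.

Ltac lmod_over R :=
  lazymatch goal with
  | |- @eq ?V ?x ?y =>
      let env := lmod_env x (@nil V) in
      let env := lmod_env y env in
      let ex := lmod_reify R x env in
      let ey := lmod_reify R y env in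
      refine (@lval_eq _ _ env ex ey _);
      cbn [lcoef_eq lcoef size eqn]; repeat split;
      (* The coefficient equations are restated over [Real.sort R], the form handed to [ring] here
         and to [field] or [lra] on what remains. *)
      try (lazymatch goal with |- @eq _ ?a ?b => change (@eq (Real.sort R) a b) end);
      try ring
  end.

Lemma eq_ler (R : numDomainType) (x y : R) : x = y -> x <= y.
Proof. by move=> ->. Qed.

Lemma ler_mul_small (R : realFieldType) (e z t : R) :
  0 <= e -> 0 <= z -> t <= e / (z + 1) -> t * z <= e.
Proof.
move=> e0 z0 tz; have z1 : 0 < z + 1 by lra.
apply: le_trans (ler_wpM2r z0 tz) _; rewrite mulrAC -mulrA -[leRHS]mulr1 ler_wpM2l //.
by rewrite ler_pdivrMr // mul1r lerDl.
Qed.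

(** * Bochner measurable sections *)

Section BochnerSections.
Variables (R : realType) (d : measure_display) (Om : measurableType d).
Implicit Types (V W X : normedModType R).

(** A bound at every point by a real constant; it replaces the extended-real [supnorm] in all
    estimates. *)
Definition bnd V (phi : Om -> V) (c : R) : Prop := forall w, `|phi w| <= c.

(** [H] is arbitrary: the pairs of values form a countable set, so a fiber of the composite splits
    along the codes [e] of these pairs, and each piece is empty or an intersection of a fiber of
    [g1] with a fiber of [g2]. *)
Lemma cvm_comp2 V W X (H : V -> W -> X) (g1 : Om -> V) (g2 : Om -> W) :
  countably_valued_measurable g1 -> countably_valued_measurable g2 ->
  countably_valued_measurable (fun w => H (g1 w) (g2 w)).
Proof.
move=> [c1 m1] [c2 m2].
have c12 := countableX c1 c2.
split.
  apply: (@sub_countable _ _ _ ((fun p => H p.1 p.2) @` (range g1 `*` range g2))).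
    apply: subset_card_le => _ [w _ <-]; exists (g1 w, g2 w) => //=.
    by split; exists w.
  exact: sub_countable (card_image_le _ _) c12.
move=> x.
have /countable_injP[e einj] := c12.
have -> : (fun w => H (g1 w) (g2 w)) @^-1` [set x] =
    \bigcup_n [set w | e (g1 w, g2 w) = n /\ H (g1 w) (g2 w) = x].
  apply/seteqP; split=> w /=.
    by move=> hw; exists (e (g1 w, g2 w)).
  by move=> [n _ [_ hw]].
apply: bigcupT_measurable => n.
have [[w0 [hn hx]]|hno] := pselect (exists w0, e (g1 w0, g2 w0) = n /\ H (g1 w0) (g2 w0) = x).
  have -> : [set w | e (g1 w, g2 w) = n /\ H (g1 w) (g2 w) = x] =
      g1 @^-1` [set g1 w0] `&` g2 @^-1` [set g2 w0].
    apply/seteqP; split=> w /=.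
      move=> [ew _]; have : (g1 w, g2 w) = (g1 w0, g2 w0).
        apply: einj; rewrite ?inE /=; first by split; exists w.
          by split; exists w0.
        by rewrite ew hn.
      by move=> [-> ->].
    by move=> [-> ->].
  exact: measurableI.
have -> : [set w | e (g1 w, g2 w) = n /\ H (g1 w) (g2 w) = x] = set0; last exact: measurable0.
by apply/seteqP; split=> // w hw; apply: hno; exists w.
Qed.

Lemma bochnerP V (f : Om -> V) :
  bochner_measurable f <->
  forall e : R, 0 < e -> exists2 g, countably_valued_measurable g & forall w, `|g w - f w| <= e.
Proof.
split=> [[g [gm gf]] e e0|h].
  by have [N hN] := gf e e0; exists (g N) => //; apply: hN.
have hn (n : nat) : 0 < (n.+1%:R : R)^-1 by rewrite invr_gt0.
have /choice[g hg] : forall n : nat, exists g : Om -> V,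
    countably_valued_measurable g /\ forall w, `|g w - f w| <= (n.+1%:R : R)^-1.
  by move=> n; have [g g1 g2] := h _ (hn n); exists g.
exists g; split=> [n|e e0]; first by case: (hg n).
have [N hN] : exists N : nat, e^-1 < N.+1%:R.
  exists (Num.trunc e^-1); exact: truncnS_gt.
exists N => n Nn w; have [_ /(_ w)] := hg n; move/le_trans; apply.
rewrite invf_ple ?posrE //; apply: le_trans (ltW hN) _.
by rewrite ler_nat ltnS.
Qed.

(** Uniform continuity of [H] is asked only near the values of [f1] and [f2], with one [dl] for all
    [w]. This covers products of bounded sections, and inverses and logarithms of functions bounded
    away from 0. *)
Lemma bochner_comp2 V W X (H : V -> W -> X) (f1 : Om -> V) (f2 : Om -> W) :
  bochner_measurable f1 -> bochner_measurable f2 ->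
  (forall e : R, 0 < e -> exists2 dl : R, 0 < dl &
     forall w y1 y2, `|y1 - f1 w| <= dl -> `|y2 - f2 w| <= dl ->
       `|H y1 y2 - H (f1 w) (f2 w)| <= e) ->
  bochner_measurable (fun w => H (f1 w) (f2 w)).
Proof.
move=> /bochnerP b1 /bochnerP b2 hH; apply/bochnerP => e e0.
have [dl dl0 hdl] := hH e e0.
have [g1 c1 h1] := b1 dl dl0; have [g2 c2 h2] := b2 dl dl0.
by exists (fun w => H (g1 w) (g2 w)); [exact: cvm_comp2|move=> w; exact: hdl].
Qed.

Lemma bochner_comp V X (H : V -> X) (f : Om -> V) :
  bochner_measurable f ->
  (forall e : R, 0 < e -> exists2 dl : R, 0 < dl &
     forall w y, `|y - f w| <= dl -> `|H y - H (f w)| <= e) ->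
  bochner_measurable (fun w => H (f w)).
Proof.
move=> b h; apply: (@bochner_comp2 _ _ _ (fun y _ => H y) f f) => // e e0.
by have [dl dl0 hdl] := h e e0; exists dl => // w y1 y2 h1 _; exact: hdl.
Qed.

Lemma bochner_uniform_limit V (F : nat -> Om -> V) (f : Om -> V) :
  (forall n, bochner_measurable (F n)) ->
  (forall e : R, 0 < e -> exists n, forall w, `|F n w - f w| <= e) ->
  bochner_measurable f.
Proof.
move=> bF h; apply/bochnerP => e e0.
have e20 : 0 < e / 2 by rewrite divr_gt0.
have [n hn] := h _ e20; have /bochnerP/(_ _ e20)[g gm hg] := bF n.
exists g => // w; rewrite [e]splitr.
have -> : g w - f w = (g w - F n w) + (F n w - f w) by lmod_over R.
by apply: le_trans (ler_normD _ _) _; apply: lerD.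
Qed.

Lemma inLinf_cst V (x : V) : inLinf (fun _ : Om => x).
Proof.
split; last by exists `|x|.
apply/bochnerP => e e0; exists (fun _ => x); last by move=> w; rewrite subrr normr0 ltW.
split=> [|y].
  apply: (@sub_countable _ _ _ [set x]); last exact: countable1.
  by apply: subset_card_le => _ [w _ <-].
have [->|/eqP xy] := eqVneq x y.
  by have -> : (fun _ : Om => y) @^-1` [set y] = setT; [apply/seteqP; split|exact: measurableT].
have -> : (fun _ : Om => x) @^-1` [set y] = set0; last exact: measurable0.
by apply/seteqP; split.
Qed.

Lemma inLinf_lin V W (T : V -> W) (M : R) (f : Om -> V) :
  (forall x y, T (x - y) = T x - T y) -> (forall x, `|T x| <= M * `|x|) ->
  inLinf f -> inLinf (fun w => T (f w)).
Proof.
move=> TB TM [bf [c hc]].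
have M1 : 0 < `|M| + 1 by rewrite ltr_wpDl.
have TM' x : `|T x| <= (`|M| + 1) * `|x|.
  apply: le_trans (TM x) _; rewrite ler_wpM2r //.
  by apply: le_trans (ler_norm M) _; rewrite lerDl.
split; last first.
  exists ((`|M| + 1) * c) => w; apply: le_trans (TM' _) _.
  by rewrite ler_wpM2l // ltW.
apply: bochner_comp => // e e0; exists (e / (`|M| + 1)); first by rewrite divr_gt0.
move=> w y hy; rewrite -TB; apply: le_trans (TM' _) _.
by rewrite mulrC -ler_pdivlMr.
Qed.

Lemma inLinf_lincomb V (a : R) (f g : Om -> V) :
  inLinf f -> inLinf g -> inLinf (fun w => a *: f w + g w).
Proof.
move=> [bf [c hc]] [bg [c' hc']].
have a1 : 0 < `|a| + 1 by rewrite ltr_wpDl.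
split; last first.
  exists (`|a| * c + c') => w; apply: le_trans (ler_normD _ _) _.
  by rewrite normrZ lerD // ler_wpM2l.
apply: (@bochner_comp2 _ _ _ (fun x y => a *: x + y)) => // e e0.
exists (e / (2 * (`|a| + 1))); first by rewrite divr_gt0 // mulr_gt0.
move=> w y1 y2; rewrite !ler_pdivlMr ?mulr_gt0 // => h1 h2.
have -> : a *: y1 + y2 - (a *: f w + g w) = a *: (y1 - f w) + (y2 - g w) by lmod_over R.
apply: le_trans (ler_normD _ _) _; rewrite normrZ.
have := normr_ge0 a; have := normr_ge0 (y1 - f w); have := normr_ge0 (y2 - g w).
move: h1 h2; set n1 := `|y1 - _|; set n2 := `|y2 - _|; set b := `|a|.
by nra.
Qed.

Lemma inLinfD V (f g : Om -> V) : inLinf f -> inLinf g -> inLinf (fun w => f w + g w).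
Proof.
move=> hf hg; have := inLinf_lincomb 1 hf hg.
by congr inLinf; apply/funext => w; rewrite scale1r.
Qed.

Lemma inLinfB V (f g : Om -> V) : inLinf f -> inLinf g -> inLinf (fun w => f w - g w).
Proof.
move=> hf hg; have := inLinf_lincomb (-1) hg hf.
by congr inLinf; apply/funext => w; rewrite scaleN1r addrC.
Qed.

Lemma inLinfZ V (a : R) (f : Om -> V) : inLinf f -> inLinf (fun w => a *: f w).
Proof.
move=> hf; have := inLinf_lincomb a hf (inLinf_cst (0 : V)).
by congr inLinf; apply/funext => w; rewrite addr0.
Qed.

Lemma inLinf_scale V (a : Om -> R^o) (f : Om -> V) :
  inLinf a -> inLinf f -> inLinf (fun w => a w *: f w).
Proof.
move=> [ba [c hc]] [bf [c' hc']]; split; last first.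
  exists (`|c| * `|c'|) => w; rewrite normrZ; apply: ler_pM => //.
    exact: le_trans (hc w) (ler_norm _).
  exact: le_trans (hc' w) (ler_norm _).
apply: (@bochner_comp2 _ _ _ (fun (x : R^o) (y : V) => x *: y)) => // e e0.
(* The tolerance [t = e / (k + e)] satisfies [t <= 1], which turns the product of the two errors
   into a linear term, and [t * (k + e) = e] exactly. *)
pose k := `|c| + `|c'| + 1.
have k0 : 1 <= k by rewrite /k lerDr addr_ge0.
have ke : 0 < e / (k + e) by rewrite divr_gt0 //; lra.
exists (e / (k + e)) => // w y1 y2 h1 h2.
have -> : y1 *: y2 - a w *: f w =
   (y1 - a w) *: (y2 - f w) + (y1 - a w) *: f w + a w *: (y2 - f w) by lmod_over R.
apply: le_trans (ler_normD _ _) _.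
apply: le_trans (lerD (ler_normD _ _) (lexx _)) _; rewrite !normrZ.
have c1 : `|f w| <= `|c'| := le_trans (hc' w) (ler_norm _).
have c2 : `|a w| <= `|c| := le_trans (hc w) (ler_norm _).
have s1 : e / (k + e) <= 1 by rewrite ler_pdivrMr ?mul1r; lra.
have se : e / (k + e) * (k + e) = e by rewrite mulfVK // gt_eqF //; lra.
move: ke h1 h2 s1 se; set t := e / _ => ke h1 h2 s1 se.
have k1 : `|y1 - a w| * `|y2 - f w| <= t * 1.
  by apply: ler_pM => //; exact: le_trans h2 s1.
have k2 : `|y1 - a w| * `|f w| <= t * `|c'| by apply: ler_pM.
have k3 : `|a w| * `|y2 - f w| <= `|c| * t by apply: ler_pM.
apply: le_trans (lerD (lerD k1 k2) k3) _.
have : t * (1 + `|c'| + `|c|) <= t * (k + e) by rewrite ler_wpM2l ?(ltW ke) // /k; lra.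
by rewrite se; lra.
Qed.

Lemma inLinf_inv (a : Om -> R^o) (k : R) :
  0 < k -> (forall w, k <= a w) -> inLinf a -> inLinf (fun w => (a w)^-1 : R^o).
Proof.
move=> k0 ka [ba _]; split; last first.
  exists k^-1 => w; have aw : 0 < a w by exact: lt_le_trans k0 (ka w).
  by rewrite ger0_norm ?invr_ge0 ?(ltW aw) // lef_pV2 ?posrE.
apply: (@bochner_comp _ _ (fun x : R^o => x^-1 : R^o)) => // e e0.
(* The first bound keeps [y] above [k / 2], hence [y * a w] above [k ^+ 2 / 2]; the second then
   divides out to [e]. *)
exists (Num.min (k / 2) (e * k ^+ 2 / 2)).
  by rewrite lt_min !divr_gt0 // mulr_gt0 // exprn_gt0.
move=> w y; rewrite le_min => /andP[h1 h2].
have aw := ka w.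
have yk : k / 2 <= y.
  by move: h1; rewrite ler_norml => /andP[]; lra.
have y0 : 0 < y by lra.
have a0 : 0 < a w by lra.
have -> : (y^-1 - (a w)^-1 : R^o) = (a w - y) / (y * a w).
  by field; rewrite !gt_eqF.
rewrite normrM distrC normfV ler_pdivrMr ?normr_gt0 ?mulf_neq0 ?gt_eqF //.
apply: le_trans h2 _; rewrite ger0_norm ?mulr_ge0 ?(ltW y0) ?(ltW a0) //.
rewrite -mulrA ler_wpM2l ?(ltW e0) //.
by nra.
Qed.

(** Both sides are the inequality [ln (1 + x) <= x], applied to [a / b - 1] and to [b / a - 1]. *)
Lemma ln_diff_bounds (a b : R) : 0 < a -> 0 < b ->
  (a - b) / a <= ln a - ln b <= (a - b) / b.
Proof.
move=> a0 b0.
have key (x y : R) : 0 < x -> 0 < y -> ln x - ln y <= (x - y) / y.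
  move=> x0 y0; rewrite -ln_div ?posrE //.
  have := @le_ln1Dx R (x / y - 1).
  rewrite subrKC => /(_ _)/le_trans; apply.
    by rewrite ltrBDl subrr divr_gt0.
  by rewrite mulrBl divff // gt_eqF.
apply/andP; split; last exact: key.
have := key b a b0 a0; have -> : (b - a) / a = - ((a - b) / a) by rewrite -mulNr opprB.
by lra.
Qed.

Lemma ln_lipschitz (k x y : R) : 0 < k -> k <= x -> k <= y -> `|ln x - ln y| <= `|x - y| / k.
Proof.
move=> k0 kx ky; have x0 : 0 < x by lra.
have y0 : 0 < y by lra.
have /andP[h1 h2] := ln_diff_bounds x0 y0.
have aux z : k <= z -> `|(x - y) / z| <= `|x - y| / k.
  move=> kz; have z0 : 0 < z by lra.
  by rewrite normrM normfV (gtr0_norm z0) ler_wpM2l // lef_pV2 ?posrE.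
rewrite ler_norml; apply/andP; split.
  apply: le_trans h1; rewrite lerNl; apply: le_trans (aux _ kx).
  by rewrite -normrN ler_norm.
exact: le_trans h2 (le_trans (ler_norm _) (aux _ ky)).
Qed.

(** The two bounds of [ln_diff_bounds] differ by exactly [(x - y)^2 / (x y)], and one of them is the
    first-order term. *)
Lemma ln_taylor1 (k x y : R) : 0 < k -> k <= x -> k <= y ->
  `|ln x - ln y - y^-1 * (x - y)| <= (x - y) ^+ 2 / k ^+ 2.
Proof.
move=> k0 kx ky; have x0 : 0 < x by lra.
have y0 : 0 < y by lra.
have /andP[h1 h2] := ln_diff_bounds x0 y0.
have e : (x - y) / x - (x - y) / y = - ((x - y) ^+ 2 / (x * y)).
  by field; rewrite !gt_eqF.
have le : (x - y) ^+ 2 / (x * y) <= (x - y) ^+ 2 / k ^+ 2.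
  rewrite ler_wpM2l ?sqr_ge0 // lef_pV2 ?posrE ?mulr_gt0 ?exprn_gt0 //.
  by rewrite expr2; apply: ler_pM => //; apply: ltW.
rewrite (mulrC y^-1) ler_norml; apply/andP; split; first by lra.
have : 0 <= (x - y) ^+ 2 / k ^+ 2 by rewrite divr_ge0 ?sqr_ge0 ?exprn_ge0 // ltW.
lra.
Qed.

Lemma inLinf_ln (a : Om -> R^o) (k : R) :
  0 < k -> (forall w, k <= a w) -> inLinf a -> inLinf (fun w => ln (a w) : R^o).
Proof.
move=> k0 ka [ba [c hc]]; have lip x y := @ln_lipschitz k x y k0.
split; last first.
  exists (`|ln k| + (`|c| + k) / k) => w.
  have -> : (ln (a w) : R^o) = ln k + (ln (a w) - ln k) by lra.
  apply: le_trans (ler_normD _ _) _; rewrite lerD2l.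
  apply: le_trans (lip _ _ (ka w) (lexx k)) _; rewrite ler_wpM2r ?invr_ge0 ?(ltW k0) //.
  apply: le_trans (ler_normB _ _) _; rewrite (gtr0_norm k0) lerD2r.
  exact: le_trans (hc w) (ler_norm _).
apply: (@bochner_comp _ _ (fun x : R^o => ln x : R^o)) => // e e0.
exists (Num.min (k / 2) (e * k / 2)).
  by rewrite lt_min !divr_gt0 // mulr_gt0.
move=> w y; rewrite le_min => /andP[h1 h2]; have aw := ka w.
have yk : k / 2 <= y.
  by move: h1; rewrite ler_norml => /andP[]; lra.
have k20 : 0 < k / 2 by lra.
have ak : k / 2 <= a w by lra.
apply: le_trans (ln_lipschitz k20 yk ak) _.
by rewrite ler_pdivrMr //; lra.
Qed.

Lemma inLinf_uniform_limit V (F : nat -> Om -> V) (f : Om -> V) :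
  (forall n, inLinf (F n)) ->
  (forall e : R, 0 < e -> exists n, forall w, `|F n w - f w| <= e) -> inLinf f.
Proof.
move=> hF h; split; first by apply: bochner_uniform_limit h => n; case: (hF n).
have [n hn] := h 1 ltr01; have [_ [c hc]] := hF n.
exists (1 + c) => w; have -> : f w = (f w - F n w) + F n w by lmod_over R.
by apply: le_trans (ler_normD _ _) _; rewrite lerD // distrC.
Qed.

(** Each approximant has countably many values, so the preimage of any set is a countable union of
    fibers; measurability passes to the pointwise limit. *)
Lemma inLinf_measurable (a : Om -> R^o) : inLinf a -> measurable_fun setT (a : Om -> R).
Proof.
move=> [[g [gm ga]] _].
apply: (@measurable_realfun.measurable_fun_cvg _ _ _ _ (fun n => g n : Om -> R)).
  move=> n _ Y mY; rewrite setTI.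
  have [/countable_injP[e einj] gx] := gm n.
  have -> : g n @^-1` Y = \bigcup_m [set w | e (g n w) = m /\ Y (g n w)].
    apply/seteqP; split=> w /=; first by move=> hw; exists (e (g n w)).
    by move=> [m _ []].
  apply: bigcupT_measurable => m.
  have [[w0 [hm hY]]|hno] := pselect (exists w0, e (g n w0) = m /\ Y (g n w0)).
    have -> : [set w | e (g n w) = m /\ Y (g n w)] = g n @^-1` [set g n w0].
      apply/seteqP; split=> w /=.
        move=> [ew _]; apply: einj; rewrite ?inE /=; first by exists w.
          by exists w0.
        by rewrite ew hm.
      by move=> ->.
    exact: gx.
  have -> : [set w | e (g n w) = m /\ Y (g n w)] = set0; last exact: measurable0.
  by apply/seteqP; split=> // w hw; apply: hno; exists w.
move=> w _; apply/cvgrPdist_le => e e0.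
by have [N hN] := ga e e0; exists N => // n /= Nn; rewrite distrC; exact: hN.
Qed.

End BochnerSections.

(** * Linear maps and operator norms *)

Section IsLinear.
Variables (R : realType) (V W : lmodType R) (T : V -> W).
Hypothesis hT : is_linear T.

Lemma is_linear0 : T 0 = 0.
Proof. by have := hT (-1) 0 0; rewrite scaler0 addr0 scaleN1r addNr. Qed.

Lemma is_linearD x y : T (x + y) = T x + T y.
Proof. by have := hT 1 x y; rewrite !scale1r. Qed.

Lemma is_linearZ a x : T (a *: x) = a *: T x.
Proof. by have := hT a x 0; rewrite is_linear0 !addr0. Qed.

Lemma is_linearN x : T (- x) = - T x.
Proof. by rewrite -scaleN1r is_linearZ scaleN1r. Qed.

Lemma is_linearB x y : T (x - y) = T x - T y.
Proof. by rewrite is_linearD is_linearN. Qed.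

End IsLinear.

Lemma opnorm_le (R : realType) (V W : normedModType R) (T : V -> W) (M : R) :
  is_linear T -> (opnorm T <= M%:E)%E -> forall x, `|T x| <= M * `|x|.
Proof.
move=> lT TM x.
have [->|x0] := eqVneq x 0; first by rewrite (is_linear0 lT) !normr0 mulr0.
have nx : 0 < `|x| by rewrite normr_gt0.
have h : `|T (`|x|^-1 *: x)| <= M.
  rewrite -lee_fin; apply: le_trans TM; apply: ereal_sup_ubound.
  exists (`|x|^-1 *: x) => //=.
  by rewrite normrZ normfV normr_id mulVf // gt_eqF.
move: h; rewrite (is_linearZ lT) normrZ normfV normr_id mulrC.
by rewrite ler_pdivrMr.
Qed.

(** * Neumann series acting on sections *)

Section Neumann.
Variables (R : realType) (d : measure_display) (Om : measurableType d).
Variables (V : completeNormedModType R) (Q : (Om -> V) -> Om -> V) (c eta : R).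
Hypothesis eta01 : 0 <= eta < 1.
Hypothesis QL : forall phi, inLinf phi -> inLinf (Q phi).
Hypothesis QB : forall phi psi, Q (fun w => phi w - psi w) = (fun w => Q phi w - Q psi w).
Hypothesis Qn : forall n phi b, bnd phi b -> bnd (iter n Q phi) (c * eta ^+ n * b).

Let Q0 : Q (fun _ => 0) = (fun _ => 0).
Proof.
have := QB (fun _ => 0) (fun _ => 0); rewrite subrr => ->.
by apply/funext => w; rewrite subrr.
Qed.

(** The sum of [Q^k g] over [k < n], in Horner form. [Q] itself need not contract: only its iterates
    do, with the prefactor [c], so the increments of [psum] are expressed by [iter n Q g]. *)
Let psum (g : Om -> V) (n : nat) : Om -> V := iter n (fun x w => Q x w + g w) (fun _ => 0).

Let psumS g n w : psum g n.+1 w - psum g n w = iter n Q g w.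
Proof.
suff -> : iter n Q g = (fun w => psum g n.+1 w - psum g n w) by [].
elim: n => [|n IHn].
  by apply/funext => v; rewrite /psum /= Q0 add0r subr0.
rewrite iterS IHn QB; apply/funext => v.
by rewrite [psum g n.+2]/psum [psum g n.+1 in RHS]/psum !iterS /= /psum /=; lmod_over R.
Qed.

Let psum_dist g b n k : 0 <= c -> 0 <= b -> bnd g b ->
  bnd (fun w => psum g (k + n) w - psum g n w) (c * b * eta ^+ n * ((1 - eta ^+ k) / (1 - eta))).
Proof.
move=> c0 b0 gb; have /andP[e0 e1] := eta01.
have e1' : 1 - eta != 0 by rewrite subr_eq0 eq_sym lt_eqF.
elim: k => [|k IHk] w.
  by rewrite add0n subrr normr0 expr0 subrr mul0r mulr0.
have -> : psum g (k.+1 + n) w - psum g n w =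
   (psum g (k + n).+1 w - psum g (k + n) w) + (psum g (k + n) w - psum g n w).
  by rewrite addSn; lmod_over R.
apply: le_trans (ler_normD _ _) _.
rewrite psumS; apply: le_trans (lerD (Qn _ gb w) (IHk w)) _.
apply: eq_ler; rewrite addnC exprD exprS; field.
exact: e1'.
Qed.

Let psum_bound g b n k : 0 <= c -> 0 <= b -> bnd g b ->
  bnd (fun w => psum g (k + n) w - psum g n w) (c * b * eta ^+ n / (1 - eta)).
Proof.
move=> c0 b0 gb w; have /andP[e0 e1] := eta01.
apply: le_trans (psum_dist n k c0 b0 gb w) _.
rewrite ler_wpM2l //; first by rewrite !mulr_ge0 ?exprn_ge0.
rewrite ler_pdivrMr ?subr_gt0 // mulVf ?subr_eq0 1?eq_sym ?lt_eqF //.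
by rewrite gerBl exprn_ge0.
Qed.

Let geom_small (a : R) : forall e : R, 0 < e -> exists n, a * eta ^+ n <= e.
Proof.
move=> e e0; have /andP[h0 h1] := eta01.
have := @cvg_geometric R a eta; rewrite ger0_norm // => /(_ h1).
move=> /cvgrPdist_le /(_ e e0)[N _ /(_ N (leqnn N))] /=.
by rewrite sub0r normrN => hN; exists N; apply: le_trans (ler_norm _) hN.
Qed.

(** With [g = x - Q x] one has [x = psum g n + Q^n x]. The last term tends to 0 because [x] is
    bounded, and the geometric series bounds the sum independently of that bound. *)
Lemma neumann_bound x b : 0 <= c -> 0 <= b -> inLinf x ->
  bnd (fun w => x w - Q x w) b -> bnd x (c / (1 - eta) * b).
Proof.
move=> c0 b0 [_ [m hm]] hb w.
pose g w := x w - Q x w.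
have e n : (fun w => x w - psum g n w) = iter n Q x.
  elim: n => [|n IHn]; first by apply/funext => v; rewrite /psum /= subr0.
  rewrite iterS -IHn QB; apply/funext => v; rewrite /psum iterS /g /=.
  by lmod_over R.
apply/ler_addgt0Pr => eps eps0.
have [n hn] := geom_small (c * m) eps0.
have -> : x w = (x w - psum g n w) + (psum g (n + 0) w - psum g 0 w).
  by rewrite addn0 /psum /=; lmod_over R.
apply: le_trans (ler_normD _ _) _; rewrite [leRHS]addrC; apply: lerD.
  have := Qn n hm w; rewrite -e => /le_trans; apply.
  by rewrite mulrAC.
apply: le_trans (psum_bound 0 n c0 b0 hb w) _.
by rewrite expr0 mulr1 mulrAC.
Qed.

(** The limit is taken fiber by fiber, by completeness of [V]; the estimates do not depend on the
    point, so the convergence is uniform and the limit is again Bochner measurable. *)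
Lemma neumann_solve g : 0 <= c -> inLinf g ->
  exists2 x, inLinf x & forall w, x w - Q x w = g w.
Proof.
move=> c0 gL; have /andP[e0 e1] := eta01.
have [b b0 gb] : exists2 b : R, 0 <= b & bnd g b.
  case: gL => _ [b hb]; exists `|b| => // w.
  exact: le_trans (hb w) (ler_norm b).
have psL n : inLinf (psum g n).
  elim: n => [|n IHn]; first exact: inLinf_cst.
  by rewrite /psum iterS; apply: inLinfD => //; apply: QL.
pose a := c * b / (1 - eta).
have dist n m w : (n <= m)%N -> `|psum g m w - psum g n w| <= a * eta ^+ n.
  move=> nm; rewrite -(subnK nm); apply: le_trans (psum_bound n _ c0 b0 gb w) _.
  by rewrite /a mulrAC.
have cv w : cvgn (fun n => psum g n w).
  apply: cauchy_cvg; apply: cauchy_exP => e e_gt0.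
  have [n hn] := geom_small a (divr_gt0 e_gt0 (ltr0Sn R 1)).
  exists (psum g n w); exists n => // k /= hk.
  rewrite -ball_normE /ball_ /= distrC; apply: le_lt_trans (dist _ _ w hk) _.
  by apply: le_lt_trans hn _; lra.
pose x w := limn (fun n => psum g n w).
have xd n w : `|psum g n w - x w| <= a * eta ^+ n.
  apply/ler_addgt0Pr => e e_gt0.
  have := cv w; rewrite -/(x w) => /cvgrPdist_le/(_ e e_gt0)[N _ hN].
  have := hN (maxn N n) (leq_maxl _ _); rewrite /= -/(x w) => h1.
  have h2 := dist _ _ w (leq_maxr N n).
  have -> : psum g n w - x w =
     - (psum g (maxn N n) w - psum g n w) - (x w - psum g (maxn N n) w) by lmod_over R.
  apply: le_trans (ler_normB _ _) _; rewrite normrN.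
  exact: lerD.
have xL : inLinf x.
  apply: inLinf_uniform_limit psL _ => e e_gt0.
  by have [n hn] := geom_small a e_gt0; exists n => w; apply: le_trans (xd n w) hn.
exists x => // w; apply/eqP; rewrite -subr_eq0 -normr_eq0; apply/eqP/le_anti.
rewrite normr_ge0 andbT; apply/ler_addgt0Pr => e e_gt0; rewrite add0r.
have [n hn] := geom_small (a * eta + c * eta * a) e_gt0.
have -> : x w - Q x w - g w = - (psum g n.+1 w - x w) + (Q (psum g n) w - Q x w).
  by rewrite /psum iterS -/(psum g n); lmod_over R.
apply: le_trans (ler_normD _ _) _; rewrite normrN.
apply: le_trans hn; rewrite mulrDl; apply: lerD.
  by apply: le_trans (xd n.+1 w) _; rewrite exprS mulrA.
have -> : Q (psum g n) w - Q x w = iter 1 Q (fun w => psum g n w - x w) w by rewrite /= QB.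
by have := Qn 1 (xd n) w; rewrite expr1 !mulrA.
Qed.

End Neumann.

(** * Cone contraction *)

Section Cone.
Variables (R : realType) (V : completeNormedModType R) (C : set V) (ell : V -> R).
Variables (K rho : R).
Hypothesis hC : closed_convex_cone C.
Hypothesis ellL : is_linear (ell : V -> R^o).
Hypothesis ell1 : forall x, `|ell x| <= `|x|.
Hypothesis K1 : 1 <= K.
Hypothesis rho01 : 0 < rho <= 1.
Hypothesis ellC : forall x, C x -> `|x| / K <= ell x.

Lemma coneZ a x : 0 <= a -> C x -> C (a *: x).
Proof. by case: hC => _ _ h _ _; apply: h. Qed.

Lemma cone0 : C 0.
Proof. by case: hC. Qed.

Lemma coneD x y : C x -> C y -> C (x + y).
Proof.
move=> Cx Cy; case: hC => _ _ _ h _.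
have h2 : 0 <= (2^-1 : R) <= 1 by apply/andP; split; lra.
have := coneZ (ler0n R 2) (h x y 2^-1 Cx Cy h2).
by congr C; lmod_over R; lra.
Qed.

Lemma ellD x y : ell (x + y) = ell x + ell y.
Proof. exact: (is_linearD ellL). Qed.

Lemma ellB x y : ell (x - y) = ell x - ell y.
Proof. exact: (is_linearB ellL). Qed.

Lemma ellZ a x : ell (a *: x) = a * ell x.
Proof. exact: (is_linearZ ellL). Qed.

Lemma ell0 : ell 0 = 0.
Proof. exact: (is_linear0 ellL). Qed.

Lemma cone_norm x : C x -> `|x| <= K * ell x.
Proof.
move=> Cx; have := ellC Cx; have K0 : 0 < K by move: K1; lra.
by rewrite ler_pdivrMr // mulrC.
Qed.

Lemma cone_ell_ge0 x : C x -> 0 <= ell x.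
Proof.
move=> Cx; apply: le_trans (ellC Cx); rewrite divr_ge0 //.
by have := K1; lra.
Qed.

Lemma cone_rho_perturb x e : cone_rho C rho x -> `|e| < rho * `|x| -> C (x + e).
Proof.
move=> [_ h] he; apply: h; rewrite -ball_normE /ball_ /=.
have -> : x - (x + e) = - e by lmod_over R.
by rewrite normrN.
Qed.

Definition normalized_rho (x : V) : Prop := cone_rho C rho x /\ ell x = 1.

Lemma normalized_norm x : normalized_rho x -> 1 <= `|x| <= K.
Proof.
move=> [[Cx _] ex]; apply/andP; split.
  by have := ell1 x; rewrite ex normr1.
by have := cone_norm Cx; rewrite ex mulr1.
Qed.

(** As [|ell x| <= |x|], the normalization forces [|x| >= 1], and the ball granted by [cone_rho] has
    radius at least [rho]. This ball is open, hence the margin [rho / 2]. *)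
Lemma normalized_perturb x e : normalized_rho x -> `|e| <= rho / 2 -> C (x + e).
Proof.
move=> hx he; apply: cone_rho_perturb; first by case: hx.
have /andP[x1 _] := normalized_norm hx; apply: le_lt_trans he _.
have /andP[r0 _] := rho01.
have : rho * 1 <= rho * `|x| by rewrite ler_wpM2l // ltW.
lra.
Qed.

Lemma cone_le_scale p q (b b' : R) : C p -> C (b *: p - q) -> b <= b' -> C (b' *: p - q).
Proof.
move=> Cp h bb'; have -> : b' *: p - q = (b' - b) *: p + (b *: p - q) by lmod_over R.
by apply: coneD => //; apply: coneZ => //; lra.
Qed.

Definition doeblin_const : R := rho / (2 * K).

Lemma doeblin_const_bounds : 0 < doeblin_const <= 1 / 2.
Proof.
have /andP[r0 r1] := rho01; have k0 : 0 < 2 * K by have := K1; lra.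
rewrite divr_gt0 //= /doeblin_const ler_pdivrMr //; have := K1; lra.
Qed.

(** Since [|ell y| <= |y|] and [|p| <= K], the subtracted vector has norm at most [rho / 2 * |y|],
    and the ball around [y] inside the cone absorbs it. The 2 in [doeblin_const] provides the strict
    inequality that an open ball requires; [y = 0] is treated apart because its ball is empty. *)
Lemma doeblin y p : cone_rho C rho y -> `|p| <= K ->
  C (y - (doeblin_const * ell y) *: p).
Proof.
move=> hy hp.
have [->|y0] := eqVneq y 0.
  by rewrite ell0 mulr0 scale0r subr0; exact: cone0.
apply: cone_rho_perturb => //; rewrite normrN normrZ normrM.
have ny : 0 < `|y| by rewrite normr_gt0.
have /andP[c0 _] := doeblin_const_bounds; rewrite (gtr0_norm c0).
have k0 : 0 < K by have := K1; lra.
have : doeblin_const * `|ell y| * `|p| <= doeblin_const * `|y| * K.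
  by apply: ler_pM => //; [rewrite mulr_ge0 // ltW|rewrite ler_wpM2l // ltW].
have -> : doeblin_const * `|y| * K = rho / 2 * `|y|.
  by rewrite /doeblin_const; field; rewrite gt_eqF.
have : 0 < rho * `|y| by have /andP[r0 _] := rho01; rewrite mulr_gt0.
lra.
Qed.

End Cone.

(** * Contraction on one level, for one parameter *)

Section Level.
Variables (R : realType) (d : measure_display) (Om : measurableType d).
Variables (V : completeNormedModType R) (C : set V) (ell : V -> R) (K rho vth : R).
Variables (tauinv : Om -> Om) (L : Om -> V -> V) (p : Om -> V).
Hypothesis hC : closed_convex_cone C.
Hypothesis ellL : is_linear (ell : V -> R^o).
Hypothesis ell1 : forall x, `|ell x| <= `|x|.
Hypothesis K1 : 1 <= K.
Hypothesis rho01 : 0 < rho <= 1.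
Hypothesis vth1 : 1 <= vth.
Hypothesis ellC : forall x, C x -> `|x| / K <= ell x.
Hypothesis LL : forall w, is_linear (L w).
Hypothesis Lcone : forall w x, C x -> x <> 0 -> cone_rho C rho (L w x).
Hypothesis Lup : forall w x, `|L w x| <= vth * `|x|.
Hypothesis Llow : forall w, ((vth^-1)%:E <= opnorm (L w))%E.
Hypothesis Lmeas : forall phi, inLinf phi ->
  bochner_measurable (fun w => L (tauinv w) (phi (tauinv w))).
Hypothesis pL : inLinf p.
Hypothesis pC : forall w, cone_rho C rho (p w) /\ ell (p w) = 1.
Hypothesis pfix : forall w, p w =
  (ell (L (tauinv w) (p (tauinv w))))^-1 *: L (tauinv w) (p (tauinv w)).

Definition transfer (phi : Om -> V) : Om -> V := fun w => L (tauinv w) (phi (tauinv w)).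

Let lam w : R := ell (transfer p w).
Let c0 := doeblin_const K rho.
Let pN w := normalized_norm ell1 K1 ellC (pC w).
Let c0_bounds := doeblin_const_bounds K1 rho01.
Let Cp w : C (p w) := (pC w).1.1.

Let L0 w : L w 0 = 0.
Proof. exact: (is_linear0 (LL w)). Qed.

Let Lrho w x : C x -> cone_rho C rho (L w x).
Proof.
move=> Cx; have [->|/eqP x0] := eqVneq x 0; last exact: Lcone.
rewrite L0; split; first exact: (cone0 hC).
by rewrite normr0 mulr0 => y; rewrite -ball_normE /ball_ /=; rewrite normr_lt0.
Qed.

Let LC w x : C x -> C (L w x).
Proof. by move=> /(Lrho w)[]. Qed.

Definition lam_min : R := rho / (4 * K * vth).

Lemma lam_min_gt0 : 0 < lam_min.
Proof.
have /andP[r0 _] := rho01.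
by rewrite divr_gt0 // !mulr_gt0 //; have := K1; have := vth1; lra.
Qed.

(** Some [x] of the unit ball has [|L x| > 1 / (2 vth)]. Both [p + (rho / 2) x] and
    [p - (rho / 2) x] lie in the cone; their images differ by [rho L x] and add up to [2 L p]. As
    the norm is at most [K ell] on the cone, [rho |L x| <= 2 K lam], which gives the constant
    [rho / (4 K vth)]. *)
Lemma lam_ge w : lam_min <= lam w.
Proof.
have /andP[r0 r1] := rho01.
have v0 : 0 < vth by have := vth1; lra.
have k0 : 0 < K by have := K1; lra.
pose w' := tauinv w.
have [x x1 hx] : exists2 x : V, `|x| <= 1 & vth^-1 / 2 < `|L w' x|.
  have : ((vth^-1 / 2)%:E < opnorm (L w'))%E.
    apply: lt_le_trans (Llow w'); rewrite lte_fin ltr_pdivrMr //.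
    by rewrite ltr_pMr ?invr_gt0 //; lra.
  by rewrite /opnorm => /ereal_sup_gt[_ [x hx <-]]; rewrite lte_fin => h; exists x.
have h a : `|a| = rho / 2 -> C (p w' + a *: x).
  move=> ha; apply: (normalized_perturb ell1 K1 rho01 ellC (pC w')).
  by rewrite normrZ ha ler_piMr // divr_ge0 // ltW.
have h1 := LC w' (h (rho / 2) (ger0_norm (divr_ge0 (ltW r0) (ler0n R 2)))).
have h2 : C (L w' (p w' + (- (rho / 2)) *: x)).
  by apply/LC/h; rewrite normrN ger0_norm // divr_ge0 // ltW.
have n1 := cone_norm K1 ellC h1; have n2 := cone_norm K1 ellC h2.
have e : rho *: L w' x = L w' (p w' + (rho / 2) *: x) - L w' (p w' + (- (rho / 2)) *: x).
  by rewrite !(is_linearD (LL w')) !(is_linearZ (LL w')); lmod_over R; lra.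
have e2 : ell (L w' (p w' + (rho / 2) *: x)) + ell (L w' (p w' + (- (rho / 2)) *: x)) = 2 * lam w.
  rewrite -(ellD ellL) /lam /transfer -/w' -(ellZ ellL); congr ell.
  by rewrite !(is_linearD (LL w')) !(is_linearZ (LL w')); lmod_over R; lra.
have : rho * `|L w' x| <= K * (2 * lam w).
  rewrite -e2 mulrDr -{1}(gtr0_norm r0) -normrZ e.
  by apply: le_trans (ler_normB _ _) _; apply: lerD.
have : rho * (vth^-1 / 2) < rho * `|L w' x| by rewrite ltr_pM2l.
move=> a1 a2; have a3 := lt_le_trans a1 a2.
rewrite /lam_min ler_pdivrMr; last by rewrite !mulr_gt0.
have vv : vth^-1 * vth = 1 by rewrite mulVf // gt_eqF.
move: a3; rewrite -(ltr_pM2r v0) => a3.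
have -> : rho = rho * (vth^-1 / 2) * vth * 2.
  by rewrite mulrA (mulrAC _ _ vth) -(mulrA rho) vv; lra.
apply: ltW; move: a3; set z := rho * _ * vth; lra.
Qed.

Let lam_gt0 w : 0 < lam w := lt_le_trans lam_min_gt0 (lam_ge w).
Let lam_neq0 w : lam w != 0. Proof. by rewrite gt_eqF. Qed.

Lemma transfer_fix w : transfer p w = lam w *: p w.
Proof. by rewrite [p w]pfix -/(transfer p w) -/(lam w) scalerA divff // scale1r. Qed.

Lemma transfer_Linf phi : inLinf phi -> inLinf (transfer phi).
Proof.
move=> h; split; first exact: Lmeas.
case: h => _ [m hm]; exists (vth * m) => w; apply: le_trans (Lup _ _) _.
by rewrite ler_wpM2l //; have := vth1; lra.
Qed.

Lemma lam_Linf : inLinf (lam : Om -> R^o).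
Proof.
apply: (@inLinf_lin _ _ _ V R^o (ell : V -> R^o) 1) (transfer_Linf pL).
  exact: (is_linearB ellL).
by move=> x; rewrite mul1r; exact: ell1.
Qed.

(** [N] fixes [p], and [Q] is [N] followed by the projection onto the kernel of [ell] along [p]. The
    linearized operator is [lam (id - Q)], so a Neumann series in [Q] inverts it. *)
Let N (phi : Om -> V) : Om -> V := fun w => (lam w)^-1 *: transfer phi w.
Let Q (phi : Om -> V) : Om -> V := fun w => N phi w - ell (N phi w) *: p w.

(** In the order of the cone, [a p <= phi <= (a + g) p]. The origin [a] is free and varies with the
    point, so subtracting a multiple of [p] costs nothing. *)
Let osc (phi : Om -> V) (g : R) : Prop := forall w, exists a : R,
  C (phi w - a *: p w) /\ C ((a + g) *: p w - phi w).

(** The Doeblin bound is applied to the images of both [x - a p] and [b p - x]. Divided by [lam],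
    these have masses [al] and [be] under [ell] which add up to [b - a], because [ell p = 1]; the
    two gains together shorten the interval by exactly [c0 (b - a)]. *)
Let osc_step x y w a b : C (x - a *: p (tauinv w)) -> C (b *: p (tauinv w) - x) ->
  y = (lam w)^-1 *: L (tauinv w) x ->
  exists al be : R, [/\ 0 <= al, 0 <= be, al + be = b - a,
    C (y - (a + c0 * al) *: p w) & C ((b - c0 * be) *: p w - y)].
Proof.
move=> h1 h2 ->; set w' := tauinv w in h1 h2 *.
have l0 : 0 <= (lam w)^-1 by rewrite invr_ge0 ltW.
have unscale z : C (lam w *: z) -> C z.
  by move=> /(coneZ hC l0); rewrite scalerA mulVf // scale1r.
have Ly : L w' x = lam w *: ((lam w)^-1 *: L w' x) by rewrite scalerA divff // scale1r.
set y' := _ *: L w' x in Ly *.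
have pe := transfer_fix w; rewrite /transfer -/w' in pe.
have /andP[_ pK] := pN w.
have ex : L w' (x - a *: p w') = lam w *: (y' - a *: p w).
  by rewrite (is_linearB (LL w')) (is_linearZ (LL w')) pe Ly; lmod_over R.
have ey : L w' (b *: p w' - x) = lam w *: (b *: p w - y').
  by rewrite (is_linearB (LL w')) (is_linearZ (LL w')) pe Ly; lmod_over R.
have ge z : C z -> 0 <= ell z by move=> Cz; apply: (cone_ell_ge0 K1 ellC).
exists (ell (y' - a *: p w)), (ell (b *: p w - y')); split.
- by apply/ge/unscale; rewrite -ex; apply: LC.
- by apply/ge/unscale; rewrite -ey; apply: LC.
- by rewrite !(ellB ellL) !(ellZ ellL) (pC w).2; lra.
- have := doeblin hC ellL ell1 K1 rho01 (Lrho w' h1) pK.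
  rewrite ex (ellZ ellL) -/c0 => h; apply: unscale; move: h; congr C; lmod_over R.
- have := doeblin hC ellL ell1 K1 rho01 (Lrho w' h2) pK.
  rewrite ey (ellZ ellL) -/c0 => h; apply: unscale; move: h; congr C; lmod_over R.
Qed.

Let osc_Q phi g : osc phi g -> osc (Q phi) ((1 - c0) * g).
Proof.
move=> h w; have [a [h1 h2]] := h (tauinv w).
have [al [be [_ _ e k1 k2]]] := osc_step h1 h2 (erefl (N phi w)).
exists (a + c0 * al - ell (N phi w)); split.
  by move: k1; congr C; rewrite /Q; lmod_over R.
move: k2; congr C; rewrite /Q; lmod_over R.
have -> : be = g - al by lra.
by ring.
Qed.

(** [p] absorbs any vector of norm at most [rho / 2], so [(2 b / rho) p] absorbs any vector of norm
    at most [b]; using this for [phi] and [- phi] gives an interval of twice that length. *)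
Let osc_init phi b : 0 <= b -> bnd phi b -> osc phi (4 * b / rho).
Proof.
move=> b0 hb w; have /andP[r0 r1] := rho01; exists (- (2 * b / rho)).
have aux x : `|x| <= b -> C ((2 * b / rho) *: p w + x).
  move=> hx; have [bz|bz] := eqVneq b 0.
    have -> : x = 0 by apply/eqP; rewrite -normr_le0 -bz.
    by rewrite bz mulr0 mul0r scale0r add0r; exact: (cone0 hC).
  have bp : 0 < b by rewrite lt_neqAle eq_sym bz.
  have -> : (2 * b / rho) *: p w + x = (2 * b / rho) *: (p w + (rho / (2 * b)) *: x).
    lmod_over R; field; rewrite !gt_eqF //.
  apply: (coneZ hC); first by rewrite divr_ge0 ?mulr_ge0 // ltW.
  apply: (normalized_perturb ell1 K1 rho01 ellC (pC w)).
  have q0 : 0 <= rho / (2 * b) by rewrite divr_ge0 ?mulr_ge0 // ltW.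
  rewrite normrZ (ger0_norm q0); apply: le_trans (ler_wpM2l q0 hx) _.
  by apply: eq_ler; field; rewrite gt_eqF.
split.
  by have := aux _ (hb w); congr C; lmod_over R.
have := aux (- phi w); rewrite normrN => /(_ (hb w)); congr C; lmod_over R.
Qed.

(** Applying [ell] to both inequalities gives [a <= 0 <= a + g]. Then
    [|phi - a p| <= K (- a) <= K g] and [|a p| <= g K]. *)
Let osc_bound phi g : osc phi g -> (forall w, ell (phi w) = 0) -> bnd phi (2 * K * g).
Proof.
move=> h e w; have [a [h1 h2]] := h w; have /andP[_ pK] := pN w.
have a1 := cone_ell_ge0 K1 ellC h1; have a2 := cone_ell_ge0 K1 ellC h2.
have n1 := cone_norm K1 ellC h1.
move: a1 a2 n1; rewrite !(ellB ellL) !(ellZ ellL) (pC w).2 e => a1 a2 n1.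
have -> : phi w = (phi w - a *: p w) + a *: p w by lmod_over R.
apply: le_trans (ler_normD _ _) _.
have n2 : `|a *: p w| <= g * K.
  rewrite normrZ ; apply: ler_pM => //; rewrite ler_norml; lra.
have : K * (0 - a * 1) <= K * g by rewrite ler_wpM2l //; move: K1; lra.
lra.
Qed.

Let Q_bound n phi b : bnd phi b -> bnd (iter n Q phi) (8 * K / rho * (1 - c0) ^+ n * b).
Proof.
move=> hb w; have /andP[r0 r1] := rho01.
have b0 : 0 <= b := le_trans (normr_ge0 _) (hb w).
have c1 : 0 <= 1 - c0 by have := c0_bounds; rewrite -/c0; lra.
have o : osc (iter n Q phi) ((1 - c0) ^+ n * (4 * b / rho)).
  elim: n => [|n IHn]; first by rewrite expr0 mul1r; exact: osc_init.
  by rewrite iterS exprS -mulrA; exact: osc_Q.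
(* [osc_bound] requires [ell] to vanish, which holds from the first application of [Q] on; for
   [n = 0] it suffices that [8 K / rho >= 1]. *)
case: n o => [_|n o].
  rewrite /= expr0 mulr1; apply: le_trans (hb w) _.
  rewrite ler_peMl // ler_pdivlMr //; move: K1; lra.
have e v : ell (iter n.+1 Q phi v) = 0.
  rewrite iterS; move: (iter n Q phi) => y.
  by rewrite /Q (ellB ellL) [ell (_ *: p v)](ellZ ellL) (pC v).2; lra.
apply: le_trans (osc_bound o e w) _.
by apply: eq_ler; field; rewrite gt_eqF.
Qed.

Definition linearized (x : Om -> V) : Om -> V :=
  fun w => lam w *: x w - transfer x w + ell (transfer x w) *: p w.

(** The prefactor of [Q_bound], times the sum of the geometric series of ratio [1 - c0], times the
    bound on [1 / lam]. *)
Definition inv_bound : R := 8 * K / rho / doeblin_const K rho * lam_min^-1.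

Let linearizedE x w : linearized x w = lam w *: (x w - Q x w).
Proof.
have e : transfer x w = lam w *: N x w by rewrite /N scalerA divff // scale1r.
rewrite /linearized /Q; move: e; move: (N x w) => y ->.
by rewrite (ellZ ellL); lmod_over R.
Qed.

Let transferB x y : transfer (fun w => x w - y w) = (fun w => transfer x w - transfer y w).
Proof. by apply/funext => w; rewrite /transfer (is_linearB (LL _)). Qed.

Let QB x y : Q (fun w => x w - y w) = (fun w => Q x w - Q y w).
Proof.
apply/funext => w; rewrite /Q /N transferB !(ellZ ellL) (ellB ellL).
by lmod_over R.
Qed.

Let QLinf x : inLinf x -> inLinf (Q x).
Proof.
move=> xL.
have NL : inLinf (N x).
  apply: (@inLinf_scale _ _ _ V (fun w => (lam w)^-1)); last exact: transfer_Linf.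
  exact: inLinf_inv lam_min_gt0 lam_ge lam_Linf.
apply: inLinfB => //; apply: (@inLinf_scale _ _ _ V (fun w => ell (N x w))) => //.
apply: (@inLinf_lin _ _ _ V R^o (ell : V -> R^o) 1) NL; first exact: (is_linearB ellL).
by move=> y; rewrite mul1r; exact: ell1.
Qed.

Let eta01 : 0 <= 1 - c0 < 1.
Proof. by have := c0_bounds; rewrite -/c0; lra. Qed.

Let cQ : 0 <= 8 * K / rho.
Proof. by have /andP[r0 r1] := rho01; rewrite divr_ge0 ?mulr_ge0 // ?ltW //; move: K1; lra. Qed.

Lemma linearized_solve g : inLinf g -> exists2 x, inLinf x & forall w, linearized x w = g w.
Proof.
move=> gL; have g'L : inLinf (fun w => (lam w)^-1 *: g w).
  apply: (@inLinf_scale _ _ _ V (fun w => (lam w)^-1)) => //.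
  exact: inLinf_inv lam_min_gt0 lam_ge lam_Linf.
have [x xL hx] := neumann_solve eta01 QLinf QB Q_bound cQ g'L.
by exists x => // w; rewrite linearizedE hx scalerA divff // scale1r.
Qed.

Lemma linearized_bound x b : inLinf x -> bnd (linearized x) b -> bnd x (inv_bound * b).
Proof.
move=> xL hb w.
have b0 : 0 <= b := le_trans (normr_ge0 _) (hb w).
have l0 := lam_min_gt0.
have h : bnd (fun w => x w - Q x w) (lam_min^-1 * b).
  move=> v; have := hb v; rewrite linearizedE normrZ (gtr0_norm (lam_gt0 v)) => h.
  rewrite mulrC ler_pdivlMr // mulrC; apply: le_trans h.
  by rewrite ler_wpM2r // lam_ge.
have b1 : 0 <= lam_min^-1 * b by rewrite mulr_ge0 // invr_ge0 ltW.
have := neumann_bound eta01 QB Q_bound cQ b1 xL h w.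
by rewrite (_ : 1 - (1 - c0) = c0) ?mulrA //; lra.
Qed.

(* [ratio_le q r]: the fibers of [q] and [p] differ by a factor in [[a, a(1+r)]]
   for the order of the cone; one application of the transfer operator
   contracts [r] by [1 - c0], so [r] is bounded by the defect of [q]. *)
Let ratio_le (q : Om -> V) (r : R) : Prop := forall w, exists a : R,
  [/\ 0 < a, C (q w - a *: p w) & C ((a * (1 + r)) *: p w - q w)].

(** Applying [ell] gives [a <= 1 <= a (1 + r)], hence [0 <= 1 - a <= r]; the part [q - a p] lies in
    the cone and is controlled by its mass [1 - a]. *)
Let ratio_dist q r : 0 <= r -> (forall w, normalized_rho C ell rho (q w)) ->
  ratio_le q r -> bnd (fun w => p w - q w) (2 * K * r).
Proof.
move=> r0 hq h w; have [a [a0 h1 h2]] := h w; have /andP[_ pK] := pN w.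
have a1 := cone_ell_ge0 K1 ellC h1; have a2 := cone_ell_ge0 K1 ellC h2.
have n1 := cone_norm K1 ellC h1.
move: a1 a2 n1; rewrite !(ellB ellL) !(ellZ ellL) (pC w).2 (hq w).2 => a1 a2 n1.
have ar : 1 - a <= r by nra.
have -> : p w - q w = (1 - a) *: p w - (q w - a *: p w) by lmod_over R.
apply: le_trans (ler_normB _ _) _; rewrite normrZ ger0_norm; last lra.
have : (1 - a) * `|p w| <= r * K by apply: ler_pM => //; lra.
have : K * (1 - a * 1) <= K * r by rewrite ler_wpM2l; move: K1; lra.
lra.
Qed.

(** [ratio_step] iterates [r |-> 4 s + (1 - c0^2) r], whose fixed point is [4 s / c0^2]; here
    [s = 2 e / (k0 rho)], and [ratio_dist] multiplies by [2 K]. *)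
Definition compare_const (k0 : R) : R := 16 * K / (k0 * rho * doeblin_const K rho ^+ 2).

(** The defect of [q], divided by [kap], is absorbed by [s q], so that
    [(1 - s) q <= t N q <= (1 + s) q] in the order of the cone, with [t = lam / kap]. Under [N] the
    ratio contracts by [1 - c0]; weakening this to [1 - c0^2] and adding [4 s] pays for the factor
    [(1 + s) / (1 - s)] as soon as [4 s <= c0]. *)
Let ratio_step (q : Om -> V) (kap : Om -> R) (k0 e s r : R) :
  (forall w, normalized_rho C ell rho (q w)) -> 0 < k0 -> (forall w, k0 <= kap w) ->
  s = 2 * e / (k0 * rho) -> 0 < s -> 4 * s <= c0 -> 0 <= r ->
  bnd (fun w => transfer q w - kap w *: q w) e ->
  ratio_le q r -> ratio_le q (4 * s + (1 - c0 ^+ 2) * r).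
Proof.
move=> hq k00 hk se s0 sc r0 hb h w.
have [cp c12] := andP c0_bounds; rewrite -/c0 in cp c12.
have /andP[rp _] := rho01.
have [a [a0 h1 h2]] := h (tauinv w).
have [al [be [al0 be0 e1 k1 k2]]] := osc_step h1 h2 (erefl (N q w)).
pose a1 := a + c0 * al.
have a1a : a <= a1 by rewrite lerDl mulr_ge0 // ltW.
have k3 : C ((a1 * (1 + (1 - c0) * r)) *: p w - N q w).
  apply: (cone_le_scale hC (Cp w) k2); rewrite /a1.
  have -> : be = a * (1 + r) - a - al by lra.
  have c1 : 0 <= 1 - c0 by lra.
  have := mulr_ge0 (mulr_ge0 (ltW cp) al0) (mulr_ge0 c1 r0).
  nra.
have kw : 0 < kap w := lt_le_trans k00 (hk w).
pose t := (kap w)^-1 * lam w.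
have t0 : 0 < t by rewrite mulr_gt0 // invr_gt0.
pose er := (kap w)^-1 *: (transfer q w - kap w *: q w).
have ere : er = t *: N q w - q w.
  rewrite /er /N /t scalerBr !scalerA mulVf ?gt_eqF // scale1r.
  by congr (_ *: _ - _); rewrite -mulrA divff // mulr1.
have small x : `|x| = `|er| -> C (s *: q w + x).
  move=> hx; have -> : s *: q w + x = s *: (q w + s^-1 *: x).
    by rewrite scalerDr scalerA divff ?gt_eqF // scale1r.
  apply: (coneZ hC (ltW s0)); apply: (normalized_perturb ell1 K1 rho01 ellC (hq w)).
  rewrite normrZ hx ger0_norm ?invr_ge0 ?(ltW s0) // /er normrZ.
  rewrite ger0_norm ?invr_ge0 ?(ltW kw) //.
  rewrite ler_pdivrMl // ler_pdivrMl //; apply: le_trans (hb w) _.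
  have -> : e = k0 * (s * (rho / 2)) by rewrite se; field; rewrite !gt_eqF.
  by rewrite ler_wpM2r // mulr_ge0 // ?(ltW s0) // divr_ge0 // ltW.
have s1 : 0 < 1 - s by lra.
have s2 : 0 < 1 + s by lra.
have g1 : C ((1 + s) *: q w - (t * a1) *: p w).
  have := coneD hC (small (- er) (normrN _)) (coneZ hC (ltW t0) k1).
  by congr C; rewrite -/a1 ere; lmod_over R.
have g2 : C ((t * (a1 * (1 + (1 - c0) * r))) *: p w - (1 - s) *: q w).
  have := coneD hC (small er (erefl _)) (coneZ hC (ltW t0) k3).
  by congr C; rewrite ere; lmod_over R.
exists (t * a1 / (1 + s)); split.
- by rewrite divr_gt0 // mulr_gt0 // (lt_le_trans a0).
- have i0 : 0 <= (1 + s)^-1 by rewrite invr_ge0 ltW.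
  have := coneZ hC i0 g1; congr C; lmod_over R.
  by field; rewrite gt_eqF.
- have i0 : 0 <= (1 - s)^-1 by rewrite invr_ge0 ltW.
  have := coneZ hC i0 g2.
  rewrite scalerBr !scalerA mulVf ?gt_eqF // scale1r => g3.
  apply: (cone_le_scale hC (Cp w) g3).
  set y := t * a1; have y0 : 0 < y by rewrite mulr_gt0 // (lt_le_trans a0).
  have key : (1 + (1 - c0) * r) * (1 + s) <= (1 - s) * (1 + (4 * s + (1 - c0 ^+ 2) * r)).
    have cr : 0 <= c0 * r by rewrite mulr_ge0 // ltW.
    have sr : 0 <= s * r by rewrite mulr_ge0 // ltW.
    have := mulr_ge0 (ltW s0) cr.
    have := mulr_ge0 (ltW cp) cr.
    have d0 : 0 <= c0 - 4 * s by lra.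
    have := mulr_ge0 d0 r0; have := mulr_ge0 d0 cr.
    have : 0 <= s * (1 - 2 * s) by rewrite mulr_ge0 // ?(ltW s0) //; lra.
    by nra.
  have -> : (1 - s)^-1 * (t * (a1 * (1 + (1 - c0) * r))) =
      y / ((1 - s) * (1 + s)) * ((1 + (1 - c0) * r) * (1 + s)).
    by rewrite /y; field; rewrite !gt_eqF.
  have -> : y / (1 + s) * (1 + (4 * s + (1 - c0 ^+ 2) * r)) =
      y / ((1 - s) * (1 + s)) * ((1 - s) * (1 + (4 * s + (1 - c0 ^+ 2) * r))).
    by field; rewrite !gt_eqF.
  by apply: ler_wpM2l key; rewrite divr_ge0 ?(ltW y0) // ltW // mulr_gt0.
Qed.

Lemma compare_fixed (q : Om -> V) (kap : Om -> R) (k0 e : R) :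
  (forall w, normalized_rho C ell rho (q w)) -> 0 < k0 -> (forall w, k0 <= kap w) ->
  0 < e -> bnd (fun w => transfer q w - kap w *: q w) e ->
  bnd (fun w => p w - q w) (compare_const k0 * e).
Proof.
move=> hq k00 hk e0 hb.
have [cp c12] := andP c0_bounds; rewrite -/c0 in cp c12.
have /andP[rp r1] := rho01.
have K0 : 0 < K by move: K1; lra.
pose s := 2 * e / (k0 * rho).
have s0 : 0 < s by rewrite divr_gt0 ?mulr_gt0.
have -> : compare_const k0 * e = 2 * K * (4 * s / c0 ^+ 2).
  rewrite /compare_const -/c0 /s; field.
  by rewrite !gt_eqF.
have c2 : 0 < c0 ^+ 2 by rewrite exprn_gt0.
(* For a large defect the claimed bound is at least [2 K], which bounds the distance of two
   normalized sections anyway. *)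
have [sc|sc] := leP (4 * s) c0; last first.
  move=> w; have /andP[_ pK] := pN w.
  have /andP[_ qK] := normalized_norm ell1 K1 ellC (hq w).
  have h1 : 1 <= 4 * s / c0 ^+ 2 by rewrite ler_pdivlMr // mul1r; nra.
  have : 2 * K * 1 <= 2 * K * (4 * s / c0 ^+ 2) by rewrite ler_wpM2l //; lra.
  have := ler_normB (p w) (q w); lra.
(* Both sections being normalized, [(rho / (2 K)) p <= q <= (2 K / rho) p]; [r0] is the quotient of
   the two factors. *)
pose r0 := 4 * K ^+ 2 / rho ^+ 2.
have r00 : 0 <= r0 by rewrite divr_ge0 ?mulr_ge0 ?exprn_ge0 // ltW.
pose rr n := 4 * s / c0 ^+ 2 + (1 - c0 ^+ 2) ^+ n * r0.
have c3 : 0 <= 1 - c0 ^+ 2 by nra.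
have rr0 n : 0 <= rr n.
  by rewrite addr_ge0 // ?mulr_ge0 ?exprn_ge0 ?invr_ge0 // ltW // mulr_gt0.
have rat n : ratio_le q (rr n).
  elim: n => [|n IHn].
    move=> w; exists (rho / (2 * K)).
    have /andP[p1 pK] := pN w; have /andP[q1 qK] := normalized_norm ell1 K1 ellC (hq w).
    have half x : x <= K -> rho / (2 * K) * x <= rho / 2.
      have rK : 0 <= rho / (2 * K) by rewrite divr_ge0 ?mulr_ge0 ?(ltW rp) ?(ltW K0).
      by move=> /(ler_wpM2l rK) /le_trans; apply; apply: eq_ler; field; rewrite gt_eqF.
    split; first by rewrite divr_gt0 // mulr_gt0.
      apply: (normalized_perturb ell1 K1 rho01 ellC (hq w)).
      rewrite normrN normrZ gtr0_norm ?divr_gt0 ?mulr_gt0 //.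
      exact: half.
    have b0 : 0 < 2 * K / rho by rewrite divr_gt0 // mulr_gt0.
    have : C ((2 * K / rho) *: p w - q w).
      have -> : (2 * K / rho) *: p w - q w = (2 * K / rho) *: (p w + (- (rho / (2 * K))) *: q w).
        by lmod_over R; field; rewrite !gt_eqF.
      apply: (coneZ hC (ltW b0)); apply: (normalized_perturb ell1 K1 rho01 ellC (pC w)).
      rewrite normrZ normrN gtr0_norm ?divr_gt0 ?mulr_gt0 //.
      exact: half.
    move=> /(cone_le_scale hC (Cp w)); apply.
    have -> : 2 * K / rho = rho / (2 * K) * r0.
      by rewrite /r0; field; rewrite !gt_eqF.
    rewrite ler_wpM2l ?divr_ge0 ?mulr_ge0 // ?(ltW rp) ?(ltW K0) //.
    rewrite /rr expr0 mul1r; have : 0 < 4 * s / c0 ^+ 2 by rewrite divr_gt0 // mulr_gt0.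
    lra.
  have := ratio_step hq k00 hk (erefl s) s0 sc (rr0 n) hb IHn.
  have alg (s' c z r : R) : c != 0 ->
      4 * s' + (1 - c ^+ 2) * (4 * s' / c ^+ 2 + z * r) = 4 * s' / c ^+ 2 + (1 - c ^+ 2) * z * r.
    by move=> cn0; field.
  by rewrite /rr [_ ^+ n.+1]exprS alg ?gt_eqF.
move=> w; apply/ler_addgt0Pr => eps eps0.
have c4 : `|1 - c0 ^+ 2| < 1 by rewrite ger0_norm //; lra.
have := cvg_geometric (2 * K * r0) c4.
move=> /cvgrPdist_le /(_ eps eps0)[n _ /(_ n (leqnn n))] /=.
rewrite sub0r normrN => hn.
apply: le_trans (ratio_dist (rr0 n) hq (rat n) w) _.
rewrite /rr mulrDr lerD2l mulrA mulrAC; exact: le_trans (ler_norm _) hn.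
Qed.

End Level.

(** * Graded families of operators *)

Section Graded.
Variables (R : realType) (B : normedModType R) (U : set B).
Variables (d : measure_display) (Om : measurableType d) (r0 : R).

Record scale := Scale { sp : R -> normedModType R; sj : forall s r, sp r -> sp s }.
Arguments sj : clear implicits.

Definition scale_ok (F : scale) : Prop :=
  (forall s r : R, 0 < s < r -> r <= r0 ->
     is_linear (sj F s r) /\ exists M : R, forall x, `|sj F s r x| <= M * `|x|) /\
  (forall t s r : R, 0 < t < s -> s < r -> r <= r0 ->
     forall x, sj F t s (sj F s r x) = sj F t r x).

Definition opfam (F G : scale) (I : Type) :=
  forall s r : R, I -> B -> (Om -> sp F r) -> (Om -> sp G s).

(** The gap is strict: an admissible pair of levels always leaves slack, to be split among the
    factors of a composition or spent on a small Hoelder exponent. *)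
Definition rng (m s r : R) : Prop := [/\ 0 < s, s + m < r & r <= r0].

(* [base nu m A]: the operators [A s r i u], from sections of level [r] to
   sections of level [s], lose [m] orders: as functions of [u] they are
   Hoelder of every exponent smaller than [r - s - m], with constants
   proportional to the weight [nu i] of the index. *)
Record base (F G : scale) (I : Type) (nu : I -> R) (m : R) (A : opfam F G I) : Prop := Base {
  b_m : 0 <= m;
  b_nu : forall i, 0 <= nu i;
  b_linf : forall s r i u phi, rng m s r -> U u -> inLinf phi -> inLinf (A s r i u phi);
  b_lin : forall s r i u (a : R) phi psi, rng m s r -> U u -> inLinf phi -> inLinf psi ->
    A s r i u (fun w => a *: phi w + psi w) =
    (fun w => a *: A s r i u phi w + A s r i u psi w);
  b_left : forall s' s r i u phi, 0 < s' < s -> rng m s r -> U u -> inLinf phi ->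
    (fun w => sj G s' s (A s r i u phi w)) = A s' r i u phi;
  b_right : forall s q r i u phi, rng m s q -> q < r -> r <= r0 -> U u -> inLinf phi ->
    A s q i u (fun w => sj F q r (phi w)) = A s r i u phi;
  b_bound : forall s r, rng m s r -> exists C : R, 0 <= C /\
    forall i u phi c, U u -> inLinf phi -> bnd phi c -> bnd (A s r i u phi) (C * nu i * c);
  b_hold : forall s r al, rng (m + al) s r -> 0 < al <= 1 -> exists C : R, 0 <= C /\
    forall i u v phi c, U u -> U v -> inLinf phi -> bnd phi c ->
      bnd (fun w => A s r i u phi w - A s r i v phi w) (C * `|u - v| `^ al * nu i * c) }.

(** The new direction [h] joins the index, so a derivative is again an operator family. The
    remainder is uniform in [i] relative to [nu i], and in the section relative to its bound; this
    uniformity is what lets derivatives be composed. *)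
Definition isder (F G : scale) (I : Type) (nu : I -> R) (m : R)
    (A : opfam F G I) (A' : opfam F G (I * B)) : Prop :=
  forall s r, rng (m + 1) s r -> forall u, U u -> forall e : R, 0 < e ->
  exists dl : R, 0 < dl /\ forall h, `|h| < dl -> U (u + h) ->
    forall i phi c, inLinf phi -> bnd phi c ->
      bnd (fun w => A s r i (u + h) phi w - A s r i u phi w - A' s r (i, h) u phi w)
          (e * `|h| * nu i * c).

Definition linh (F G : scale) (I : Type) (m : R) (A' : opfam F G (I * B)) : Prop :=
  forall s r i u (a : R) h h' phi, rng m s r -> U u -> inLinf phi ->
    A' s r (i, a *: h + h') u phi =
    (fun w => a *: A' s r (i, h) u phi w + A' s r (i, h') u phi w).

Definition dweight (I : Type) (nu : I -> R) : I * B -> R := fun ih => nu ih.1 * `|ih.2|.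

(** [k] is not limited by the levels: once the order reaches [r0], [rng] is empty and the remaining
    conditions are void. Regularity can thus be asserted for every [k]. *)
Fixpoint GR (k : nat) (F G : scale) (I : Type) (nu : I -> R) (m : R) (A : opfam F G I) : Prop :=
  base nu m A /\
  match k with
  | 0 => True
  | k'.+1 => exists A' : opfam F G (I * B)%type,
      [/\ isder nu m A A', linh (m + 1) A' & GR k' (dweight nu) (m + 1) A']
  end.

Lemma GR_base k F G I (nu : I -> R) m (A : opfam F G I) : GR k nu m A -> base nu m A.
Proof. by case: k => [|k] []. Qed.

Lemma GR_der k F G I (nu : I -> R) m (A : opfam F G I) : GR k.+1 nu m A ->
  exists A' : opfam F G (I * B)%type,
    [/\ isder nu m A A', linh (m + 1) A' & GR k (dweight nu) (m + 1) A'].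
Proof. by case. Qed.

Lemma GR_pred k F G I (nu : I -> R) m (A : opfam F G I) : GR k.+1 nu m A -> GR k nu m A.
Proof.
elim: k I nu m A => [|k IHk] I nu m A [b [A' [h1 h2 h3]]]; first by split.
split=> //; exists A'; split=> //; exact: IHk.
Qed.

Lemma rng_le m m' s r : m' <= m -> rng m s r -> rng m' s r.
Proof. by move=> h [a b c]; split=> //; lra. Qed.

Lemma bnd_ge0 (V : normedModType R) (f : Om -> V) (a : R) : Om -> bnd f a -> 0 <= a.
Proof. by move=> w /(_ w); apply: le_trans. Qed.

Section ScaleLemmas.
Variable F : scale.
Hypothesis Fok : scale_ok F.

Lemma sj_lin s r : 0 < s < r -> r <= r0 -> is_linear (sj F s r).
Proof. by move=> h1 h2; have [] := Fok.1 s r h1 h2. Qed.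

Lemma sj_comp t s r : 0 < t < s -> s < r -> r <= r0 ->
  forall x, sj F t s (sj F s r x) = sj F t r x.
Proof. exact: Fok.2. Qed.

Lemma sj_Linf s r (phi : Om -> sp F r) : 0 < s < r -> r <= r0 -> inLinf phi ->
  inLinf (fun w => sj F s r (phi w)).
Proof.
move=> h1 h2; have [lj [M hM]] := Fok.1 s r h1 h2.
by apply: inLinf_lin hM; exact: is_linearB.
Qed.

Lemma sj_bound s r : 0 < s < r -> r <= r0 -> exists M : R, 0 <= M /\
  forall (phi : Om -> sp F r) c, bnd phi c -> bnd (fun w => sj F s r (phi w)) (M * c).
Proof.
move=> h1 h2; have [lj [M hM]] := Fok.1 s r h1 h2; exists `|M|; split=> // phi c hb w.
apply: le_trans (hM _) _; apply: le_trans (ler_wpM2r (normr_ge0 _) (ler_norm M)) _.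
exact: ler_wpM2l.
Qed.

End ScaleLemmas.

Lemma b_linB F G I (nu : I -> R) m (A : opfam F G I) s r i u phi psi :
  base nu m A -> rng m s r -> U u -> inLinf phi -> inLinf psi ->
  A s r i u (fun w => phi w - psi w) = (fun w => A s r i u phi w - A s r i u psi w).
Proof.
move=> b hr hu h1 h2; have := b_lin b i (-1) hr hu h2 h1.
have -> : (fun w => -1 *: psi w + phi w) = (fun w => phi w - psi w).
  by apply/funext => w; rewrite scaleN1r addrC.
by move=> ->; apply/funext => w; rewrite scaleN1r addrC.
Qed.

Lemma base_ext F G I (nu : I -> R) m (A A2 : opfam F G I) : scale_ok F ->
  (forall s r i u phi, rng m s r -> U u -> inLinf phi -> A s r i u phi = A2 s r i u phi) ->
  base nu m A -> base nu m A2.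
Proof.
move=> Fok e b; split.
- exact: b_m b.
- exact: b_nu b.
- by move=> s r i u phi h1 h2 h3; rewrite -e //; exact: (b_linf b).
- move=> s r i u a phi psi h1 h2 h3 h4; rewrite -!e //; last exact: inLinf_lincomb.
  exact: (b_lin b).
- move=> s' s r i u phi h1 h2 h3 h4; rewrite -!e //; first exact: (b_left b).
  by case: h2 => [? ? ?]; split=> //; lra.
- move=> s q r i u phi h1 h2 h3 h4 h5; have h6 : 0 < q < r.
    by case: h1 => [? ? ?]; have := b_m b; lra.
  rewrite -!e //; first exact: (b_right b).
    by case: h1 => [? ? ?]; split=> //; lra.
  exact: sj_Linf.
- move=> s r h1; have [C [C0 hC]] := b_bound b h1; exists C; split=> // i u phi c h2 h3 h4.
  by rewrite -e //; exact: hC.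
- move=> s r al h1 h2; have [C [C0 hC]] := b_hold b h1 h2; exists C.
  split=> // i u v phi c h3 h4 h5 h6.
  have h7 : rng m s r by apply: rng_le h1; lra.
  by rewrite -!e //; exact: hC.
Qed.

(** Only the family itself is replaced; the old derivatives still serve, because [isder] sees the
    family on admissible levels alone. *)
Lemma GR_ext k F G I (nu : I -> R) m (A A2 : opfam F G I) : scale_ok F ->
  (forall s r i u phi, rng m s r -> U u -> inLinf phi -> A s r i u phi = A2 s r i u phi) ->
  GR k nu m A -> GR k nu m A2.
Proof.
move=> Fok e; case: k => [|k] [b h]; (split; first exact: base_ext e b) => //.
case: h => A' [h1 h2 h3]; exists A'; split=> //.
move=> s r hr u hu eps e0; have [dl [dl0 hd]] := h1 s r hr u hu eps e0.
have hr' : rng m s r by apply: rng_le hr; lra.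
exists dl; split=> // h hh huh i phi c hphi hb; rewrite -!e //; exact: hd.
Qed.

Lemma base_reindex F G I J (nu : I -> R) (nuJ : J -> R) (sg : J -> I) m (A : opfam F G I) :
  (forall j, nu (sg j) <= nuJ j) -> base nu m A ->
  base nuJ m (fun s r j => A s r (sg j)).
Proof.
move=> hn b.
have aux (C c : R) j : 0 <= C -> 0 <= c -> C * nu (sg j) * c <= C * nuJ j * c.
  by move=> C0 c0; rewrite ler_wpM2r // ler_wpM2l.
split.
- exact: b_m b.
- by move=> j; apply: le_trans (hn j); exact: (b_nu b).
- by move=> *; exact: (b_linf b).
- by move=> *; exact: (b_lin b).
- by move=> *; exact: (b_left b).
- by move=> *; exact: (b_right b).
- move=> s r h1; have [C [C0 hC]] := b_bound b h1; exists C; split=> // j u phi c h2 h3 h4 w.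
  by apply: le_trans (hC (sg j) u phi c h2 h3 h4 w) _; apply: aux => //; exact: bnd_ge0 h4.
- move=> s r al h1 h2; have [C [C0 hC]] := b_hold b h1 h2; exists C.
  split=> // j u v phi c h3 h4 h5 h6 w.
  apply: le_trans (hC (sg j) u v phi c h3 h4 h5 h6 w) _; apply: aux; last exact: bnd_ge0 h6.
  by rewrite mulr_ge0 // powR_ge0.
Qed.

Lemma GR_reindex k F G I J (nu : I -> R) (nuJ : J -> R) (sg : J -> I) m (A : opfam F G I) :
  (forall j, nu (sg j) <= nuJ j) -> GR k nu m A ->
  GR k nuJ m (fun s r j => A s r (sg j)).
Proof.
elim: k I J nu nuJ sg m A => [|k IHk] I J nu nuJ sg m A hn [b h];
  (split; first exact: base_reindex hn b) => //.
case: h => A' [h1 h2 h3]; exists (fun s r jh => A' s r (sg jh.1, jh.2)); split.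
- move=> s r hr u hu eps e0; have [dl [dl0 hd]] := h1 s r hr u hu eps e0.
  exists dl; split=> // h hh huh i phi c hphi hb w.
  apply: le_trans (hd h hh huh (sg i) phi c hphi hb w) _.
  rewrite ler_wpM2r //; first exact: bnd_ge0 hb.
  by rewrite ler_wpM2l // mulr_ge0 // ltW.
- by move=> s r i u a h h' phi hr hu hphi; rewrite h2.
- apply: (IHk _ _ _ _ (fun jh : J * B => (sg jh.1, jh.2))) h3 => -[j h] /=.
  by rewrite /dweight /= ler_wpM2r.
Qed.

Lemma base_lin F G I (nu : I -> R) m (a : R) (A A2 : opfam F G I) : scale_ok G ->
  base nu m A -> base nu m A2 ->
  base nu m (fun s r i u phi w => a *: A s r i u phi w + A2 s r i u phi w).
Proof.
move=> Gok b b2; split.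
- exact: b_m b.
- exact: b_nu b.
- by move=> s r i u phi h1 h2 h3; apply: inLinf_lincomb; [exact: (b_linf b)|exact: (b_linf b2)].
- move=> s r i u a' phi psi h1 h2 h3 h4; rewrite (b_lin b) // (b_lin b2) //.
  by apply/funext => w; lmod_over R.
- move=> s' s r i u phi h1 h2 h3 h4; apply/funext => w.
  have lj : is_linear (sj G s' s).
    by apply: sj_lin => //; case: h2 => [? ? ?]; have := b_m b; lra.
  by rewrite lj -(b_left b i h1 h2 h3 h4) -(b_left b2 i h1 h2 h3 h4).
- by move=> s q r i u phi h1 h2 h3 h4 h5; rewrite (b_right b) // (b_right b2).
- move=> s r h1; have [C [C0 hC]] := b_bound b h1; have [C2 [C20 hC2]] := b_bound b2 h1.
  exists (`|a| * C + C2); split=> [|i u phi c h2 h3 h4 w]; first by rewrite addr_ge0 // mulr_ge0.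
  apply: le_trans (ler_normD _ _) _; rewrite normrZ.
  apply: le_trans (lerD (ler_wpM2l (normr_ge0 a) (hC i u phi c h2 h3 h4 w))
    (hC2 i u phi c h2 h3 h4 w)) _.
  by rewrite !mulrDl !mulrA.
- move=> s r al h1 h2; have [C [C0 hC]] := b_hold b h1 h2.
  have [C2 [C20 hC2]] := b_hold b2 h1 h2.
  exists (`|a| * C + C2); split=> [|i u v phi c h3 h4 h5 h6 w].
    by rewrite addr_ge0 // mulr_ge0.
  have -> : a *: A s r i u phi w + A2 s r i u phi w - (a *: A s r i v phi w + A2 s r i v phi w)
    = a *: (A s r i u phi w - A s r i v phi w) + (A2 s r i u phi w - A2 s r i v phi w).
    by lmod_over R.
  apply: le_trans (ler_normD _ _) _; rewrite normrZ.
  apply: le_trans (lerD (ler_wpM2l (normr_ge0 a) (hC i u v phi c h3 h4 h5 h6 w))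
    (hC2 i u v phi c h3 h4 h5 h6 w)) _.
  by rewrite !mulrDl !mulrA.
Qed.

Lemma GR_lin k F G I (nu : I -> R) m (a : R) (A A2 : opfam F G I) : scale_ok G ->
  GR k nu m A -> GR k nu m A2 ->
  GR k nu m (fun s r i u phi w => a *: A s r i u phi w + A2 s r i u phi w).
Proof.
move=> Gok; elim: k I nu m A A2 => [|k IHk] I nu m A A2 [b h] [b2 h2];
  (split; first exact: base_lin) => //.
case: h => A' [d1 l1 g1]; case: h2 => A2' [d2 l2 g2].
exists (fun s r i u phi w => a *: A' s r i u phi w + A2' s r i u phi w); split; last exact: IHk.
- move=> s r hr u hu e e0.
  have a1 : 0 < `|a| + 1 by rewrite ltr_wpDl.
  have e1 : 0 < e / 2 / (`|a| + 1) by rewrite !divr_gt0.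
  have e2 : 0 < e / 2 by rewrite divr_gt0.
  have [dl1 [dl10 hd1]] := d1 s r hr u hu _ e1.
  have [dl2 [dl20 hd2]] := d2 s r hr u hu _ e2.
  exists (Num.min dl1 dl2); split; first by rewrite lt_min dl10.
  move=> h; rewrite lt_min => /andP[hh1 hh2] huh i phi c hphi hb w.
  have -> : a *: A s r i (u + h) phi w + A2 s r i (u + h) phi w -
      (a *: A s r i u phi w + A2 s r i u phi w) -
      (a *: A' s r (i, h) u phi w + A2' s r (i, h) u phi w) =
    a *: (A s r i (u + h) phi w - A s r i u phi w - A' s r (i, h) u phi w) +
    (A2 s r i (u + h) phi w - A2 s r i u phi w - A2' s r (i, h) u phi w) by lmod_over R.
  apply: le_trans (ler_normD _ _) _; rewrite normrZ.
  have n1 := hd1 h hh1 huh i phi c hphi hb w; have n2 := hd2 h hh2 huh i phi c hphi hb w.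
  apply: le_trans (lerD (ler_wpM2l (normr_ge0 a) n1) n2) _.
  pose X := `|h| * nu i * c.
  have X0 : 0 <= X by rewrite !mulr_ge0 // ?(b_nu b) //; exact: bnd_ge0 hb.
  have key : `|a| * (e / 2 / (`|a| + 1)) <= e / 2.
    by rewrite mulrC; apply: ler_mul_small => //; exact: ltW.
  have -> : e * `|h| * nu i * c = e / 2 * X + e / 2 * X by rewrite /X; field.
  have -> : `|a| * (e / 2 / (`|a| + 1) * `|h| * nu i * c) = `|a| * (e / 2 / (`|a| + 1)) * X.
    by rewrite /X !mulrA.
  have -> : e / 2 * `|h| * nu i * c = e / 2 * X by rewrite /X !mulrA.
  by rewrite lerD2r ler_wpM2r.
- move=> s r i u a' h h' phi hr hu hphi; rewrite l1 // l2 //.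
  by apply/funext => w; lmod_over R.
Qed.

Lemma powR_small (e al : R) : 0 < e -> 0 < al ->
  exists dl : R, 0 < dl /\ forall x, 0 <= x -> x < dl -> x `^ al <= e.
Proof.
move=> e0 al0; exists (e `^ al^-1); split; first exact: powR_gt0.
move=> x x0 xe; have : x `^ al <= (e `^ al^-1) `^ al.
  by apply: ge0_ler_powR; rewrite ?nnegrE ?powR_ge0 // ltW.
by rewrite -powRrM mulVf ?gt_eqF // powRr1 // ltW.
Qed.

End Graded.
Arguments sj {R} F s r _ : rename.

(** * Composition of graded families and the product rule *)

Section GradedComposition.
Variables (R : realType) (B : normedModType R) (U : set B).
Variables (d : measure_display) (Om : measurableType d) (r0 : R).
Local Notation opfam := (opfam B Om).
Local Notation rng := (rng r0).
Local Notation scale_ok := (scale_ok r0).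
Local Notation base := (base U r0).
Local Notation GR := (GR U r0).
Local Notation isder := (isder U r0).

(** The intermediate level is the midpoint between [s + m], the infimum of the sources allowed to
    [A], and [r - n], the supremum of the targets allowed to [A1]; by [comp_levels] every admissible
    choice gives the same operator. [f1] and [f2] extract from the joint index what each factor
    uses. *)
Definition opcomp (F G H : scale R) (I J K : Type) (m n : R) (f1 : K -> I) (f2 : K -> J)
    (A : opfam G H I) (A1 : opfam F G J) : opfam F H K :=
  fun s r k u phi => let q := (s + m + (r - n)) / 2 in
    A s q (f1 k) u (A1 q r (f2 k) u phi).
Arguments opcomp {F G H I J K} m n f1 f2 A A1 s r k u phi _.

Section Comp.
Variables (F G H : scale R).
Hypothesis Hok : scale_ok H.

(** For [q < q'], the inner operator into [q] is [sj] after the one into [q'], and [A] absorbs this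
    [sj]. Two parameters appear because the increment of a composition mixes them. *)
Lemma comp_levels I J (nu : I -> R) (nu1 : J -> R) m n (A : opfam G H I) (A1 : opfam F G J) :
  base nu m A -> base nu1 n A1 -> forall s r q q' i j u v phi,
  rng m s q -> rng n q r -> rng m s q' -> rng n q' r -> U u -> U v -> inLinf phi ->
  A s q i v (A1 q r j u phi) = A s q' i v (A1 q' r j u phi).
Proof.
move=> b b1 s r q q' i j u v phi.
wlog qq : q q' / q < q' => [hw|].
  move=> h1 h2 h3 h4 hu hv hp; have [h|h|->] := ltgtP q q' => //; first exact: hw.
  by symmetry; exact: hw.
move=> h1 h2 h3 h4 hu hv hp.
have q0 : 0 < q < q' by case: h2 => ? ? ?; lra.
rewrite -(b_left b1 j q0 h4 hu hp) (b_right b i h1 qq _ hv (b_linf b1 j h4 hu hp)) //.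
by case: h3 h4 => ? ? ? [? ? ?]; have := b_m b1; lra.
Qed.

Lemma mid_rng m n s r : 0 <= m -> 0 <= n -> rng (m + n) s r ->
  rng m s ((s + m + (r - n)) / 2) /\ rng n ((s + m + (r - n)) / 2) r.
Proof. by move=> m0 n0 [a b c]; split; split; lra. Qed.

Lemma opcompE I J K (nu : I -> R) (nu1 : J -> R) m n (f1 : K -> I) (f2 : K -> J)
    (A : opfam G H I) (A1 : opfam F G J) :
  base nu m A -> base nu1 n A1 -> forall q s r k u phi,
  rng m s q -> rng n q r -> U u -> inLinf phi ->
  opcomp m n f1 f2 A A1 s r k u phi = A s q (f1 k) u (A1 q r (f2 k) u phi).
Proof.
move=> b b1 q s r k u phi h1 h2 hu hp.
have [g1 g2] : rng m s ((s + m + (r - n)) / 2) /\ rng n ((s + m + (r - n)) / 2) r.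
  apply: mid_rng; [exact: b_m b|exact: b_m b1|].
  by case: h1 h2 => ? ? ? [? ? ?]; split=> //; lra.
exact: (comp_levels b b1).
Qed.

Lemma base_comp I J K (nu : I -> R) (nu1 : J -> R) (nuK : K -> R) m n
    (f1 : K -> I) (f2 : K -> J) (A : opfam G H I) (A1 : opfam F G J) :
  (forall k, nu (f1 k) * nu1 (f2 k) <= nuK k) ->
  base nu m A -> base nu1 n A1 -> base nuK (m + n) (opcomp m n f1 f2 A A1).
Proof.
move=> hn b b1; have m0 := b_m b; have n0 := b_m b1.
have nuK0 k : 0 <= nuK k.
  by apply: le_trans (hn k); rewrite mulr_ge0 // ?(b_nu b) ?(b_nu b1).
have mid := mid_rng m0 n0.
split.
- exact: addr_ge0.
- exact: nuK0.
- move=> s r k u phi /mid[h1 h2] hu hp.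
  by apply: (b_linf b) => //; apply: (b_linf b1).
- move=> s r k u a phi psi /mid[h1 h2] hu h3 h4; rewrite /opcomp (b_lin b1) // (b_lin b) //.
    exact: (b_linf b1).
  exact: (b_linf b1).
- move=> s' s r k u phi hs /mid[h1 h2] hu hp; set q := (_ / 2) in h1 h2.
  have h3 : rng m s' q by case: h1 => *; split=> //; lra.
  rewrite (opcompE f1 f2 b b1 _ h3 h2 hu hp) /opcomp.
  by rewrite (b_left b) //; exact: (b_linf b1).
- move=> s q' r k u phi /mid[h1 h2] hq hr hu hp; set q := (_ / 2) in h1 h2.
  have h3 : rng n q r by case: h2 => *; split=> //; lra.
  by rewrite (opcompE f1 f2 b b1 _ h1 h3 hu hp) /opcomp (b_right b1).
- move=> s r /mid[h1 h2].
  have [C [C0 hC]] := b_bound b h1; have [C1 [C10 hC1]] := b_bound b1 h2.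
  exists (C * C1); split=> [|k u phi c hu hp hb w]; first exact: mulr_ge0.
  have := hC (f1 k) u _ _ hu (b_linf b1 (f2 k) h2 hu hp) (hC1 (f2 k) u phi c hu hp hb) w.
  move=> /le_trans; apply.
  have -> : C * nu (f1 k) * (C1 * nu1 (f2 k) * c) = C * C1 * (nu (f1 k) * nu1 (f2 k)) * c by ring.
  by rewrite ler_wpM2r // ?(bnd_ge0 w hb) // ler_wpM2l // mulr_ge0.
- move=> s r al hr hal; have /andP[al0 al1] := hal.
  (* The slack left after the orders and the exponent. Through [q1] the outer operator has room for
     the exponent [al], through [q2] the inner one has it; each increment is estimated at its own
     level. *)
  pose g := r - s - m - n - al.
  have g0 : 0 < g by case: hr => *; rewrite /g; lra.
  pose q1 := s + m + al + g / 2; pose q2 := s + m + g / 2.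
  have [s0 _ rr] := hr.
  have a1 : rng (m + al) s q1 by split; move: g0; rewrite /q1 /g; lra.
  have a2 : rng n q1 r by split; move: g0; rewrite /q1 /g; lra.
  have a3 : rng m s q2 by split; move: g0; rewrite /q2 /g; lra.
  have a4 : rng (n + al) q2 r by split; move: g0; rewrite /q2 /g; lra.
  have a1' : rng m s q1 by apply: rng_le a1; lra.
  have a4' : rng n q2 r by apply: rng_le a4; lra.
  have [C [C0 hC]] := b_hold b a1 hal; have [C1 [C10 hC1]] := b_bound b1 a2.
  have [D [D0 hD]] := b_bound b a3; have [D1 [D10 hD1]] := b_hold b1 a4 hal.
  exists (C * C1 + D * D1); split=> [|k u v phi c hu hv hp hb w].
    by rewrite addr_ge0 // mulr_ge0.
  rewrite (opcompE f1 f2 b b1 _ a1' a2 hu hp) (opcompE f1 f2 b b1 _ a3 a4' hv hp).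
  have Lu q : rng n q r -> inLinf (A1 q r (f2 k) u phi) by move=> ?; exact: (b_linf b1).
  have Lv q : rng n q r -> inLinf (A1 q r (f2 k) v phi) by move=> ?; exact: (b_linf b1).
  have e := comp_levels b b1 (f1 k) (f2 k) a1' a2 a3 a4' hu hv hp.
  have e' := b_linB (f1 k) b a3 hv (Lu _ a4') (Lv _ a4').
  have -> : A s q1 (f1 k) u (A1 q1 r (f2 k) u phi) w - A s q2 (f1 k) v (A1 q2 r (f2 k) v phi) w =
     (A s q1 (f1 k) u (A1 q1 r (f2 k) u phi) w - A s q1 (f1 k) v (A1 q1 r (f2 k) u phi) w) +
     A s q2 (f1 k) v (fun w => A1 q2 r (f2 k) u phi w - A1 q2 r (f2 k) v phi w) w.
    by rewrite e' e; lmod_over R.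
  apply: le_trans (ler_normD _ _) _.
  have n1 := hC (f1 k) u v _ _ hu hv (Lu _ a2) (hC1 (f2 k) u phi c hu hp hb) w.
  have n2 := hD (f1 k) v _ _ hv (inLinfB (Lu _ a4') (Lv _ a4')) (hD1 (f2 k) u v phi c hu hv hp hb) w.
  apply: le_trans (lerD n1 n2) _.
  set P := `|u - v| `^ al; have P0 : 0 <= P by exact: powR_ge0.
  have -> : C * P * nu (f1 k) * (C1 * nu1 (f2 k) * c) + D * nu (f1 k) * (D1 * P * nu1 (f2 k) * c)
    = (C * C1 + D * D1) * P * (nu (f1 k) * nu1 (f2 k)) * c by ring.
  rewrite ler_wpM2r // ?(bnd_ge0 w hb) // ler_wpM2l // mulr_ge0 //.
  by rewrite addr_ge0 // mulr_ge0.
Qed.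

(** The remainder has three parts: that of [A], at level [q1]; that of [A1], at level [q2]; and the
    product of the two increments, also at [q2], where [A1] is Lipschitz and [A] still has a small
    exponent [be], so that it is [o(|h|)]. *)
Lemma isder_comp I J K (nu : I -> R) (nu1 : J -> R) (nuK : K -> R) m n
    (f1 : K -> I) (f2 : K -> J) (A : opfam G H I) (A1 : opfam F G J)
    (A' : opfam G H (I * B)) (A1' : opfam F G (J * B)) :
  (forall k, nu (f1 k) * nu1 (f2 k) <= nuK k) ->
  base nu m A -> base nu1 n A1 -> base (dweight nu) (m + 1) A' ->
  base (dweight nu1) (n + 1) A1' -> isder nu m A A' -> isder nu1 n A1 A1' ->
  isder nuK (m + n) (opcomp m n f1 f2 A A1)
    (fun s r (kh : K * B) u phi w =>
       1 *: opcomp (m + 1) n (fun kh : K * B => (f1 kh.1, kh.2)) (fun kh => f2 kh.1) A' A1 s r kh u phi w +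
       opcomp m (n + 1) (fun kh : K * B => f1 kh.1) (fun kh => (f2 kh.1, kh.2)) A A1' s r kh u phi w).
Proof.
move=> hn b b1 b' b1' dA dA1 s r hr u hu e e0.
have m0 := b_m b; have n0 := b_m b1.
pose g := r - s - m - n - 1.
have g0 : 0 < g by case: hr => *; rewrite /g; lra.
pose q1 := s + m + 1 + g / 2; pose q2 := s + m + g / 2.
(* At [q2] the outer operator has slack [g / 2], and [g / 4] fits strictly inside. *)
pose be := Num.min 1 (g / 4).
have be0 : 0 < be by rewrite lt_min; apply/andP; split; lra.
have be1 : be <= 1 by rewrite ge_min lexx.
have beg : be <= g / 4 by rewrite ge_min lexx orbT.
have [s0 _ rr] := hr.
have a1 : rng (m + 1) s q1 by split; move: g0; rewrite /q1 /g; lra.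
have a2 : rng n q1 r by split; move: g0; rewrite /q1 /g; lra.
have a3 : rng (m + be) s q2 by split; move: beg g0; rewrite /q2 /g; lra.
have a4 : rng (n + 1) q2 r by split; move: g0; rewrite /q2 /g; lra.
have a1m : rng m s q1 by apply: rng_le a1; lra.
have a3m : rng m s q2 by apply: rng_le a3; lra.
have a4n : rng n q2 r by apply: rng_le a4; lra.
have [C1 [C10 hC1]] := b_bound b1 a2.
have [D [D0 hD]] := b_bound b a3m.
have be01 : 0 < be <= 1 by rewrite be0.
have one01 : 0 < (1 : R) <= 1 by rewrite ltr01 lexx.
have [Cb [Cb0 hCb]] := b_hold b a3 be01.
have [C1l [C1l0 hC1l]] := b_hold b1 a4 one01.
have ee1 : 0 < e / 3 / (C1 + 1) by rewrite !divr_gt0 // ltr_wpDl.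
have ee2 : 0 < e / 3 / (D + 1) by rewrite !divr_gt0 // ltr_wpDl.
have ee3 : 0 < e / 3 / (Cb * C1l + 1) by rewrite !divr_gt0 // ltr_wpDl // mulr_ge0.
have [d1 [d10 hd1]] := dA s q1 a1 u hu _ ee1.
have [d2 [d20 hd2]] := dA1 q2 r a4 u hu _ ee2.
have [d3 [d30 hd3]] := powR_small ee3 be0.
exists (Num.min d1 (Num.min d2 d3)); split; first by rewrite !lt_min d10 d20.
move=> h; rewrite !lt_min => /and3P[hh1 hh2 hh3] huh k phi c hp hb w.
have L1u : inLinf (A1 q1 r (f2 k) u phi) by exact: (b_linf b1).
have L2u : inLinf (A1 q2 r (f2 k) u phi) by exact: (b_linf b1).
have L2w : inLinf (A1 q2 r (f2 k) (u + h) phi) by exact: (b_linf b1).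
have L2d : inLinf (A1' q2 r (f2 k, h) u phi) by exact: (b_linf b1').
rewrite (opcompE f1 f2 b b1 _ a3m a4n huh hp) (opcompE f1 f2 b b1 _ a3m a4n hu hp).
rewrite (opcompE _ _ b' b1 _ a1 a2 hu hp) (opcompE _ _ b b1' _ a3m a4 hu hp) /=.
have E1 := comp_levels b b1 (f1 k) (f2 k) a1m a2 a3m a4n hu huh hp.
have E2 := comp_levels b b1 (f1 k) (f2 k) a1m a2 a3m a4n hu hu hp.
have LB := inLinfB L2w L2u.
have E3 := b_linB (f1 k) b a3m hu LB L2d.
have E4 := b_linB (f1 k) b a3m hu L2w L2u.
have E5 := b_linB (f1 k) b a3m huh L2w L2u.
set x1 := A s q2 (f1 k) (u + h) (A1 q2 r (f2 k) (u + h) phi) w.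
have -> : x1 - A s q2 (f1 k) u (A1 q2 r (f2 k) u phi) w -
    (1 *: A' s q1 (f1 k, h) u (A1 q1 r (f2 k) u phi) w + A s q2 (f1 k) u (A1' q2 r (f2 k, h) u phi) w) =
  (A s q1 (f1 k) (u + h) (A1 q1 r (f2 k) u phi) w - A s q1 (f1 k) u (A1 q1 r (f2 k) u phi) w -
     A' s q1 (f1 k, h) u (A1 q1 r (f2 k) u phi) w) +
  A s q2 (f1 k) u (fun w => (A1 q2 r (f2 k) (u + h) phi w - A1 q2 r (f2 k) u phi w) -
     A1' q2 r (f2 k, h) u phi w) w +
  (A s q2 (f1 k) (u + h) (fun w => A1 q2 r (f2 k) (u + h) phi w - A1 q2 r (f2 k) u phi w) w -
   A s q2 (f1 k) u (fun w => A1 q2 r (f2 k) (u + h) phi w - A1 q2 r (f2 k) u phi w) w).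
  by rewrite E3 E4 E5 E1 E2 -/x1; lmod_over R.
apply: le_trans (ler_normD _ _) _.
apply: le_trans (lerD (ler_normD _ _) (lexx _)) _.
have n1 := hd1 h hh1 huh (f1 k) _ _ L1u (hC1 (f2 k) u phi c hu hp hb) w.
have n2 := hD (f1 k) u _ _ hu (inLinfB LB L2d) (hd2 h hh2 huh (f2 k) phi c hp hb) w.
have n3 := hCb (f1 k) (u + h) u _ _ huh hu LB (hC1l (f2 k) (u + h) u phi c huh hu hp hb) w.
apply: le_trans (lerD (lerD n1 n2) n3) _.
have -> : u + h - u = h by lmod_over R.
rewrite powRr1 //.
have hbe := hd3 `|h| (normr_ge0 h) hh3.
set N1 := nu (f1 k); set N2 := nu1 (f2 k).
pose X := `|h| * (N1 * N2) * c.
have X0 : 0 <= X.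
  by rewrite !mulr_ge0 // ?(b_nu b) ?(b_nu b1) // (bnd_ge0 w hb).
have small (z t : R) : 0 <= z -> t <= e / 3 / (z + 1) -> 0 <= t -> t * z * X <= e / 3 * X.
  by move=> z0 tz t0; rewrite ler_wpM2r //; apply: ler_mul_small; rewrite // divr_ge0 // ltW.
have m1 := small C1 _ C10 (lexx _) (ltW ee1).
have m2 := small D _ D0 (lexx _) (ltW ee2).
have m3 := small (Cb * C1l) (`|h| `^ be) (mulr_ge0 Cb0 C1l0) hbe (powR_ge0 _ _).
have XX : X <= `|h| * nuK k * c.
  by rewrite /X ler_wpM2r // ?(bnd_ge0 w hb) // ler_wpM2l //; exact: hn.
have : e * X <= e * (`|h| * nuK k * c) by rewrite ler_wpM2l // ltW.
have -> : e / 3 / (C1 + 1) * `|h| * N1 * (C1 * N2 * c) = e / 3 / (C1 + 1) * C1 * X.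
  by rewrite /X; ring.
have -> : D * N1 * (e / 3 / (D + 1) * `|h| * N2 * c) = e / 3 / (D + 1) * D * X.
  by rewrite /X; ring.
have -> : Cb * `|h| `^ be * N1 * (C1l * `|h| * N2 * c) = `|h| `^ be * (Cb * C1l) * X.
  by rewrite /X; ring.
rewrite !mulrA; move: m1 m2 m3; rewrite !mulrA; lra.
Qed.

(** Each half of the product rule differentiates one factor and keeps the other, so both are
    compositions with one derivative less. The order enters through an equation, since [m + 1 + n]
    and [m + (n + 1)] must both be read as [m + n + 1]. *)
Lemma GR_comp k I J K (nu : I -> R) (nu1 : J -> R) (nuK : K -> R) m n mn
    (f1 : K -> I) (f2 : K -> J) (A : opfam G H I) (A1 : opfam F G J) :
  mn = m + n -> (forall k, nu (f1 k) * nu1 (f2 k) <= nuK k) ->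
  GR k nu m A -> GR k nu1 n A1 -> GR k nuK mn (opcomp m n f1 f2 A A1).
Proof.
elim: k I J K nu nu1 nuK m n mn f1 f2 A A1
  => [|k IHk] I J K nu nu1 nuK m n mn f1 f2 A A1 -> hn gA gA1.
  by split=> //; apply: base_comp hn (GR_base gA) (GR_base gA1).
have b := GR_base gA; have b1 := GR_base gA1.
split; first exact: base_comp hn b b1.
have pA := GR_pred gA; have pA1 := GR_pred gA1.
have [A' [dA lA gA']] := GR_der gA; have [A1' [dA1 lA1 gA1']] := GR_der gA1.
have b' := GR_base gA'; have b1' := GR_base gA1'.
eexists; split; first exact: (isder_comp hn b b1 b' b1' dA dA1).
  move=> s r kk u a h h' phi hr hu hp.
  have [g1 g2] : rng (m + 1) s ((s + (m + 1) + (r - n)) / 2) /\ rng n ((s + (m + 1) + (r - n)) / 2) r.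
    apply: mid_rng; [exact: b_m b'|exact: b_m b1|].
    by case: hr => *; split=> //; lra.
  have [g3 g4] : rng m s ((s + m + (r - (n + 1))) / 2) /\ rng (n + 1) ((s + m + (r - (n + 1))) / 2) r.
    apply: mid_rng; [exact: b_m b|exact: b_m b1'|].
    by case: hr => *; split=> //; lra.
  rewrite /opcomp /= lA // ?lA1 //; last exact: (b_linf b1).
  rewrite (b_lin b) //; [|exact: (b_linf b1')|exact: (b_linf b1')].
  by apply/funext => w /=; lmod_over R.
apply: (GR_lin 1 Hok) => //.
  apply: IHk gA' pA1; first by ring.
  move=> [kk h] /=; rewrite /dweight /= mulrAC ler_wpM2r //.
apply: IHk pA gA1'; first by ring.
by move=> [kk h] /=; rewrite /dweight /= mulrA ler_wpM2r.
Qed.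

End Comp.
End GradedComposition.
Arguments opcomp {R B d Om F G H I J K} m n f1 f2 A A1 s r k u phi _.

(** * Constant families, multiplication operators and inverses *)

Section GradedOperations.
Variables (R : realType) (B : normedModType R) (U : set B).
Variables (d : measure_display) (Om : measurableType d) (r0 : R).
Local Notation opfam := (opfam B Om).
Local Notation rng := (rng r0).
Local Notation scale_ok := (scale_ok r0).
Local Notation base := (base U r0).
Local Notation GR := (GR U r0).

Lemma GR_zero k (F G : scale R) I (nu : I -> R) m : scale_ok G -> 0 <= m -> (forall i, 0 <= nu i) ->
  GR k nu m ((fun s r i u phi w => 0) : opfam F G I).
Proof.
move=> Gok; elim: k I nu m => [|k IHk] I nu m m0 hn.
- split=> //; split=> //.
  + by move=> *; exact: inLinf_cst.
  + by move=> *; apply/funext => w; rewrite scaler0 addr0.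
  + move=> s' s r i u phi h1 [? ? ?] _ _; apply/funext => w.
    by apply: is_linear0; apply: (sj_lin Gok) => //; lra.
  + move=> s r _; exists 0; split=> // *; move=> w; rewrite normr0 !mul0r //.
  + by move=> s r al _ _; exists 0; split=> // *; move=> w; rewrite subrr normr0 !mul0r.
- split; first exact: (GR_base (IHk I nu m m0 hn)).
  exists (fun _ _ _ _ _ _ => 0); split.
  + move=> s r _ u _ e e0; exists 1; split=> // h _ _ i phi c _ hb w.
    rewrite !subrr normr0 !mulr_ge0 // ?(ltW e0) //; exact: bnd_ge0 hb.
  + by move=> *; apply/funext => w; rewrite scaler0 addr0.
  + by apply: IHk => [|[i h]]; [lra|rewrite mulr_ge0].
Qed.

Lemma GR_const k (F G : scale R) I (nu : I -> R) m (A : opfam F G I) : scale_ok G ->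
  (forall s r i u v phi, A s r i u phi = A s r i v phi) -> base nu m A -> GR k nu m A.
Proof.
move=> Gok e b; case: k => [|k]; split=> //.
exists (fun _ _ _ _ _ _ => 0); split.
- move=> s r _ u _ eps e0; exists 1; split=> // h _ _ i phi c _ hb w.
  rewrite (e s r i (u + h) u) !subrr normr0 !mulr_ge0 // ?(b_nu b) // ?(ltW e0) //.
  exact: bnd_ge0 hb.
- by move=> *; apply/funext => w; rewrite scaler0 addr0.
- apply: GR_zero => //; first by have := b_m b; lra.
  by move=> [i h]; rewrite mulr_ge0 // (b_nu b).
Qed.

Definition real_scale : scale R :=
  @Scale R (fun _ => R^o : normedModType R) (fun s r x => x).

Lemma real_scale_ok : scale_ok real_scale.
Proof.
split=> // s r _ _; split=> //; exists 1 => x; by rewrite mul1r.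
Qed.

Lemma one_Linf r : inLinf ((fun _ => 1) : Om -> sp real_scale r).
Proof. exact: inLinf_cst. Qed.

Lemma one_bnd r : bnd ((fun _ => 1) : Om -> sp real_scale r) 1.
Proof. by move=> w; rewrite normr1. Qed.

Section Mult.
Variables (F1 F2 F3 : scale R) (bl : forall s, sp F2 s -> sp F1 s -> sp F3 s).
Hypothesis F1ok : scale_ok F1.
Hypothesis bl_linl : forall s a x x' y, bl (s := s) (a *: x + x') y = a *: bl x y + bl x' y.
Hypothesis bl_linr : forall s a x y y', bl (s := s) x (a *: y + y') = a *: bl x y + bl x y'.
Hypothesis bl_bound : forall s x y, `|bl (s := s) x y| <= `|x| * `|y|.
Hypothesis bl_sj : forall (s r : R) x y, 0 < s < r -> r <= r0 ->
  sj F3 s r (bl x y) = bl (sj F2 s r x) (sj F1 s r y).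
Hypothesis bl_Linf : forall s (f : Om -> sp F2 s) (g : Om -> sp F1 s),
  inLinf f -> inLinf g -> inLinf (fun w => bl (f w) (g w)).

(** Evaluating [a] at the constant function 1, from the top level [r0], gives a section depending on
    [u]; the product [bl] turns this section into a multiplication operator. *)
Definition opmult I (a : opfam real_scale F2 I) : opfam F1 F3 I :=
  fun s r i u phi w => bl (a s r0 i u (fun _ => 1) w) (sj F1 s r (phi w)).

Let blBl s x x' (y : sp F1 s) : bl (x - x') y = bl x y - bl x' y.
Proof. by rewrite -[- x']scaleN1r addrC bl_linl scaleN1r addrC. Qed.

Let rng_r0 m s r : 0 <= m -> rng m s r -> rng m s r0 /\ 0 < s < r.
Proof. by move=> m0 [? ? ?]; split; [split=> //|]; lra. Qed.

Let base_mult I (nu : I -> R) m (a : opfam real_scale F2 I) :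
  base nu m a -> base nu m (opmult a).
Proof.
move=> b; have m0 := b_m b.
have L1 := @one_Linf; have B1 := @one_bnd.
split=> //.
- exact: b_nu b.
- move=> s r i u phi hr hu hp; have [h1 h2] := rng_r0 m0 hr.
  apply: bl_Linf; first exact: (b_linf b).
  by apply: (sj_Linf F1ok) => //; case: hr.
- move=> s r i u c phi psi hr hu hp hp'; have [h1 h2] := rng_r0 m0 hr.
  have lj : is_linear (sj F1 s r) by apply: (sj_lin F1ok) => //; case: hr.
  by apply/funext => w; rewrite /opmult lj bl_linr.
- move=> s' s r i u phi hs hr hu hp; have [h1 h2] := rng_r0 m0 hr; case: (hr) => _ _ rr.
  apply/funext => w; rewrite /opmult bl_sj //; last lra.
  by rewrite (sj_comp F1ok) //; [rewrite -(b_left b i hs h1 hu (L1 r0))|lra].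
- move=> s q r i u phi hq qr rr hu hp; have [h1 h2] := rng_r0 m0 hq.
  by apply/funext => w; rewrite /opmult (sj_comp F1ok).
- move=> s r hr; have [h1 h2] := rng_r0 m0 hr; case: (hr) => _ _ rr.
  have [C [C0 hC]] := b_bound b h1; have [M [M0 hM]] := sj_bound Om F1ok h2 rr.
  exists (C * M); split=> [|i u phi c hu hp hb w]; first exact: mulr_ge0.
  apply: le_trans (bl_bound _ _) _.
  have := hC i u _ 1 hu (L1 r0) (@B1 r0) w; rewrite mulr1 => n1.
  apply: le_trans (ler_pM _ _ n1 (hM _ _ hb w)) _ => //.
  by rewrite -!mulrA ler_wpM2l // mulrCA.
- move=> s r al hr hal; have h0 : 0 <= m + al by lra.
  have [h1 h2] := rng_r0 h0 hr; case: (hr) => _ _ rr.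
  have [C [C0 hC]] := b_hold b h1 hal; have [M [M0 hM]] := sj_bound Om F1ok h2 rr.
  exists (C * M); split=> [|i u v phi c hu hv hp hb w]; first exact: mulr_ge0.
  rewrite /opmult -blBl; apply: le_trans (bl_bound _ _) _.
  have := hC i u v _ 1 hu hv (L1 r0) (@B1 r0) w; rewrite mulr1 => n1.
  apply: le_trans (ler_pM _ _ n1 (hM _ _ hb w)) _ => //.
  by apply: eq_ler; ring.
Qed.

Lemma GR_mult k I (nu : I -> R) m (a : opfam real_scale F2 I) :
  GR k nu m a -> GR k nu m (opmult a).
Proof.
elim: k I nu m a => [|k IHk] I nu m a ga.
  by split=> //; exact: base_mult (GR_base ga).
have b := GR_base ga; split; first exact: base_mult.
have [a' [da la ga']] := GR_der ga; have b' := GR_base ga'.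
exists (opmult a'); split; last exact: IHk.
- move=> s r hr u hu e e0.
  have m0 : 0 <= m + 1 by exact: b_m b'.
  have [h1 h2] := rng_r0 m0 hr; case: (hr) => _ _ rr.
  have [M [M0 hM]] := sj_bound Om F1ok h2 rr.
  have e1 : 0 < e / (M + 1) by rewrite divr_gt0 // ltr_wpDl.
  have [dl [dl0 hd]] := da s r0 h1 u hu _ e1.
  exists dl; split=> // h hh huh i phi c hp hb w.
  rewrite /opmult -!blBl; apply: le_trans (bl_bound _ _) _.
  have := hd h hh huh i _ 1 (@one_Linf r0) (@one_bnd r0) w; rewrite mulr1 => n1.
  apply: le_trans (ler_pM _ _ n1 (hM _ _ hb w)) _ => //.
  have -> : e / (M + 1) * `|h| * nu i * (M * c) = e / (M + 1) * M * (`|h| * nu i * c) by ring.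
  have -> : e * `|h| * nu i * c = e * (`|h| * nu i * c) by rewrite !mulrA.
  rewrite ler_wpM2r //; first by rewrite !mulr_ge0 ?(b_nu b) // (bnd_ge0 w hb).
  by apply: ler_mul_small => //; exact: ltW.
- move=> s r i u c h h' phi hr hu hp.
  have m0 : 0 <= m + 1 by exact: b_m b'.
  have [h1 h2] := rng_r0 m0 hr.
  apply/funext => w; rewrite /opmult la //; exact: one_Linf.
Qed.

End Mult.

(* [S' = - S T' S]: the inverse of a family of order 0 is of order 0. *)
Section Inverse.
Variables (F : scale R) (T : opfam F F unit).
Arguments T : clear implicits.
Variables (TL S : forall s, B -> (Om -> sp F s) -> (Om -> sp F s)) (CS : R -> R).
Hypothesis Fok : scale_ok F.
Hypothesis TL_lin : forall (s : R) u a x y, 0 < s <= r0 -> U u -> inLinf x -> inLinf y ->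
  TL u (fun w => a *: x w + y w) = (fun w => a *: TL (s := s) u x w + TL u y w).
Hypothesis TL_bound : forall s u (x : Om -> sp F s) b, 0 < s <= r0 -> U u -> inLinf x ->
  bnd (TL u x) b -> bnd x (CS s * b).
Hypothesis CS0 : forall s : R, 0 < s <= r0 -> 0 <= CS s.
Hypothesis S_Linf : forall s u (x : Om -> sp F s), 0 < s <= r0 -> U u -> inLinf x -> inLinf (S u x).
Hypothesis TLS : forall s u (x : Om -> sp F s), 0 < s <= r0 -> U u -> inLinf x -> TL u (S u x) = x.
Hypothesis TL_sj : forall (s r : R) u x, 0 < s < r -> r <= r0 -> U u -> inLinf x ->
  TL u (fun w => sj F s r (x w)) = (fun w => sj F s r (TL u x w)).
Hypothesis TE : forall (s r : R) i u x, 0 < s < r -> r <= r0 -> U u -> inLinf x ->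
  T s r i u x = TL u (fun w => sj F s r (x w)).

Let TLB s u (x y : Om -> sp F s) : 0 < s <= r0 -> U u -> inLinf x -> inLinf y ->
  TL u (fun w => x w - y w) = (fun w => TL u x w - TL u y w).
Proof.
move=> hs hu hx hy; have := TL_lin (-1) hs hu hy hx.
have -> : (fun w => -1 *: y w + x w) = (fun w => x w - y w).
  by apply/funext => w; rewrite scaleN1r addrC.
by move=> ->; apply/funext => w; rewrite scaleN1r addrC.
Qed.

Let TL_inj s u (x y : Om -> sp F s) : 0 < s <= r0 -> U u -> inLinf x -> inLinf y ->
  TL u x = TL u y -> x = y.
Proof.
move=> hs hu hx hy e.
have h : bnd (TL u (fun w => x w - y w)) 0.
  by rewrite TLB // e => w; rewrite subrr normr0.
have := TL_bound hs hu (inLinfB hx hy) h; rewrite mulr0 => h0.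
by apply/funext => w; apply/eqP; rewrite -subr_eq0 -normr_le0; exact: h0.
Qed.

Let S_bound s u (x : Om -> sp F s) b : 0 < s <= r0 -> U u -> inLinf x ->
  bnd x b -> bnd (S u x) (CS s * b).
Proof.
move=> hs hu hx hb; apply: (TL_bound hs hu); first exact: S_Linf.
by rewrite TLS.
Qed.

Let S_lin s u a (x y : Om -> sp F s) : 0 < s <= r0 -> U u -> inLinf x -> inLinf y ->
  S u (fun w => a *: x w + y w) = (fun w => a *: S u x w + S u y w).
Proof.
move=> hs hu hx hy; apply: (TL_inj hs hu).
- by apply: S_Linf => //; exact: inLinf_lincomb.
- by apply: inLinf_lincomb; exact: S_Linf.
rewrite TL_lin //; [|exact: S_Linf|exact: S_Linf].
by rewrite !TLS //; exact: inLinf_lincomb.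
Qed.

Let S_sj s r u (x : Om -> sp F r) : 0 < s < r -> r <= r0 -> U u -> inLinf x ->
  S u (fun w => sj F s r (x w)) = (fun w => sj F s r (S u x w)).
Proof.
move=> hs hr hu hx; have hs' : 0 < s <= r0 by lra.
have hr' : 0 < r <= r0 by lra.
apply: (TL_inj hs' hu).
- by apply: S_Linf => //; exact: (sj_Linf Fok).
- by apply: (sj_Linf Fok) => //; exact: S_Linf.
rewrite TLS //; last exact: (sj_Linf Fok).
by rewrite TL_sj //; [rewrite TLS|exact: S_Linf].
Qed.

Definition opinv : opfam F F unit := fun s r _ u x => S u (fun w => sj F s r (x w)).
Arguments opinv : clear implicits.

Let rng0 m s r : 0 <= m -> rng m s r -> [/\ 0 < s < r, r <= r0, 0 < s <= r0 & 0 < r <= r0].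
Proof. by move=> m0 [? ? ?]; split; lra. Qed.

Let opinvE s r i u x : 0 < s < r -> r <= r0 -> U u -> inLinf x ->
  opinv s r i u x = (fun w => sj F s r (S u x w)).
Proof. exact: S_sj. Qed.

(** Resolvent identity: the variation of the inverse is carried by [T], which drops from [r] to [s],
    while [S_v] acts at level [r] and [T_u] is inverted at level [s]. *)
Let inv_diff s r u v (x : Om -> sp F r) : 0 < s < r -> r <= r0 -> U u -> U v -> inLinf x ->
  TL u (fun w => opinv s r tt u x w - opinv s r tt v x w) =
  (fun w => T s r tt v (S v x) w - T s r tt u (S v x) w).
Proof.
move=> hs hr hu hv hx; have hs' : 0 < s <= r0 by lra.
have hr' : 0 < r <= r0 by lra.
have jx := sj_Linf Fok hs hr hx.
rewrite TLB //; [|exact: S_Linf|exact: S_Linf].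
rewrite [TL u (opinv s r tt u x)]TLS // !TE //; [|exact: S_Linf|exact: S_Linf].
by rewrite -!S_sj // [TL v _]TLS.
Qed.

Let base_inv : base (fun=> 1) 0 T -> base (fun=> 1) 0 opinv.
Proof.
move=> b; split=> //.
- move=> s r i u x /(rng0 (lexx 0))[hs hr hs' hr'] hu hx.
  by apply: S_Linf => //; exact: (sj_Linf Fok).
- move=> s r i u a x y /(rng0 (lexx 0))[hs hr hs' hr'] hu hx hy.
  rewrite /opinv -S_lin //; [|exact: (sj_Linf Fok)|exact: (sj_Linf Fok)].
  by congr S; apply/funext => w; exact: (sj_lin Fok hs hr).
- move=> s' s r i u x hs1 /(rng0 (lexx 0))[hs hr hs' hr'] hu hx.
  have sr : s <= r0 by lra.
  rewrite /opinv -S_sj //; last exact: (sj_Linf Fok).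
  by congr S; apply/funext => w; apply: (sj_comp Fok) => //; lra.
- move=> s q r i u x /(rng0 (lexx 0))[hs hr hs' hr'] qr hr1 hu hx.
  by rewrite /opinv; congr S; apply/funext => w; apply: (sj_comp Fok).
- move=> s r /(rng0 (lexx 0))[hs hr hs' hr'].
  have [M [M0 hM]] := sj_bound Om Fok hs hr.
  exists (CS s * M); split=> [|i u x c hu hx hb]; first by rewrite mulr_ge0 // CS0.
  rewrite mulr1 -mulrA; apply: S_bound => //; first exact: (sj_Linf Fok).
  exact: hM.
- move=> s r al hrn hal; have al0 : 0 <= 0 + al by lra.
  have [hs hr hs' hr'] := rng0 al0 hrn.
  have [C [C0 hC]] := b_hold b hrn hal.
  exists (CS s * C * CS r); split=> [|[] u v x c hu hv hx hb w].
    by rewrite !mulr_ge0 // CS0.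
  have jx := sj_Linf Fok hs hr hx.
  have h : bnd (TL u (fun w => opinv s r tt u x w - opinv s r tt v x w))
      (C * `|u - v| `^ al * 1 * (CS r * c)).
    rewrite inv_diff // distrC => w'.
    by apply: hC => //; [exact: S_Linf|exact: S_bound].
  have := TL_bound hs' hu (inLinfB (S_Linf hs' hu jx) (S_Linf hs' hv jx)) h w.
  by move=> /le_trans; apply; apply: eq_ler; ring.
Qed.

(** The remainder [eta] is estimated through [T_u eta], which consists of the remainder of [T] on
    [S_u x] and of [(T_(u+h) - T_u)(S_(u+h) - S_u) x]. In the latter the inverse is Lipschitz from
    [r] to [q], and [T] is Hoelder from [q] to [s]. *)
Lemma GR_inv k : GR k (fun=> 1) 0 T -> GR k (fun=> 1) 0 opinv.
Proof.
elim: k => [|k IHk] gT.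
  by split=> //; exact: base_inv (GR_base gT).
have b := GR_base gT; have bS := base_inv b; split=> //.
have [T' [dT lT gT']] := GR_der gT; have b' := GR_base gT'.
have gS := IHk (GR_pred gT).
(* The summand 0 puts [S'] in the shape [a *: _ + _] produced by [GR_lin]. *)
pose S' : opfam F F (unit * B) :=
  fun s r ih u x w => (-1) *: S u (T' s r ih u (S u x)) w + 0.
have rngS s r : rng (0 + 1) s r -> [/\ 0 < s < r, r <= r0, 0 < s <= r0 & 0 < r <= r0].
  by apply: rng0; lra.
exists S'; split.
- move=> s r hrn u hu e e0; have [hs hr hs' hr'] := rngS _ _ hrn.
  pose g := r - s - 1; have g0 : 0 < g by case: hrn => *; rewrite /g; lra.
  pose q := s + g / 2.
  pose be := Num.min 1 (g / 4).
  have be0 : 0 < be by rewrite lt_min; apply/andP; split; lra.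
  have be1 : be <= 1 by rewrite ge_min lexx.
  have beg : be <= g / 4 by rewrite ge_min lexx orbT.
  have [s0 _ rr] := hrn.
  have a1 : rng (0 + be) s q by split; move: beg g0; rewrite /q /g; lra.
  have a2 : rng (0 + 1) q r by split; move: g0; rewrite /q /g; lra.
  have a1m : rng 0 s q by apply: rng_le a1; lra.
  have be01 : 0 < be <= 1 by rewrite be0.
  have one01 : 0 < (1 : R) <= 1 by rewrite ltr01 lexx.
  have [C [C0 hC]] := b_hold b a1 be01.
  have [D [D0 hD]] := b_hold bS a2 one01.
  have Cs := CS0 hs'; have Cr := CS0 hr'.
  have ee1 : 0 < e / 2 / (CS s * CS r + 1) by rewrite !divr_gt0 // ltr_wpDl // mulr_ge0.
  have ee2 : 0 < e / 2 / (CS s * C * D + 1) by rewrite !divr_gt0 // ltr_wpDl // !mulr_ge0.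
  have [d1 [d10 hd1]] := dT s r hrn u hu _ ee1.
  have [d2 [d20 hd2]] := powR_small ee2 be0.
  exists (Num.min d1 d2); split; first by rewrite lt_min d10.
  move=> h; rewrite lt_min => /andP[hh1 hh2] huh [] x c hx hb w.
  have jx := sj_Linf Fok hs hr hx.
  have [hsq hq hsq' hqq] : [/\ 0 < q < r, q <= r0, 0 < q <= r0 & 0 < s < q].
    by split; move: g0; rewrite /q /g; lra.
  have LSu : inLinf (S u x) by exact: S_Linf.
  have LSw : inLinf (S (u + h) x) by exact: S_Linf.
  have LT' : inLinf (T' s r (tt, h) u (S u x)) by exact: (b_linf b').
  pose dS := fun w => S (u + h) x w - S u x w.
  have LdS : inLinf dS by exact: inLinfB.
  pose dSq := fun w => opinv q r tt (u + h) x w - opinv q r tt u x w.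
  have dSE : dSq = (fun w => sj F q r (dS w)).
    rewrite /dSq !opinvE //; apply/funext => w'.
    by rewrite /dS (is_linearB (sj_lin Fok hsq hr)).
  have LdSq : inLinf dSq by rewrite dSE; exact: (sj_Linf Fok).
  pose eta := fun w => opinv s r tt (u + h) x w - opinv s r tt u x w - S' s r (tt, h) u x w.
  have Lo1 : inLinf (opinv s r tt (u + h) x) by exact: S_Linf.
  have Lo2 : inLinf (opinv s r tt u x) by exact: S_Linf.
  have LST : inLinf (S u (T' s r (tt, h) u (S u x))) by exact: S_Linf.
  have etaE : eta = (fun w => (-1) *: (opinv s r tt u x w - opinv s r tt (u + h) x w) +
      S u (T' s r (tt, h) u (S u x)) w).
    by apply/funext => w'; rewrite /eta /S'; lmod_over R.
  have Leta : inLinf eta.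
    by rewrite etaE; apply: inLinf_lincomb => //; exact: inLinfB.
  have TLeta : TL u eta = (fun w =>
     - (T s r tt (u + h) (S u x) w - T s r tt u (S u x) w - T' s r (tt, h) u (S u x) w) -
     (T s q tt (u + h) dSq w - T s q tt u dSq w)).
    rewrite etaE TL_lin //; last exact: inLinfB.
    rewrite inv_diff // TLS // dSE.
    have qr : q < r by lra.
    have rT v : U v -> T s q tt v (fun w => sj F q r (dS w)) =
        (fun w => T s r tt v (S (u + h) x) w - T s r tt v (S u x) w).
      move=> hv; rewrite (b_right b tt a1m qr hr hv LdS) /dS.
      have rs : rng 0 s r by apply: rng_le hrn; lra.
      by rewrite (b_linB tt b rs hv LSw LSu).
    rewrite !rT //; apply/funext => w'; lmod_over R.
  pose X := `|h| * c.
  have X0 : 0 <= X by rewrite mulr_ge0 // (bnd_ge0 w hb).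
  have bT : bnd (TL u eta) (e / 2 / (CS s * CS r + 1) * CS r * X + C * `|h| `^ be * D * X).
    rewrite TLeta => w'; apply: le_trans (ler_normB _ _) _; rewrite normrN; apply: lerD.
      have := hd1 h hh1 huh tt _ _ LSu (S_bound hr' hu hx hb) w'.
      by move=> /le_trans; apply; apply: eq_ler; rewrite /X; ring.
    have := hC tt (u + h) u _ _ huh hu LdSq (hD tt (u + h) u x c huh hu hx hb) w'.
    have -> : u + h - u = h by lmod_over R.
    rewrite powRr1 //.
    by move=> /le_trans; apply; apply: eq_ler; rewrite /X; ring.
  have := TL_bound hs' hu Leta bT w; rewrite -/(eta w) => /le_trans; apply.
  have hbe := hd2 `|h| (normr_ge0 h) hh2.
  have small (z t : R) : 0 <= z -> t <= e / 2 / (z + 1) -> t * z * X <= e / 2 * X.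
    by move=> z0 tz; rewrite ler_wpM2r //; apply: ler_mul_small; rewrite // divr_ge0 // ltW.
  have m1 := small (CS s * CS r) _ (mulr_ge0 Cs Cr) (lexx _).
  have m2 := small (CS s * C * D) _ (mulr_ge0 (mulr_ge0 Cs C0) D0) hbe.
  have -> : CS s * (e / 2 / (CS s * CS r + 1) * CS r * X + C * `|h| `^ be * D * X) =
    e / 2 / (CS s * CS r + 1) * (CS s * CS r) * X + `|h| `^ be * (CS s * C * D) * X by ring.
  have -> : e * `|h| * 1 * c = e / 2 * X + e / 2 * X by rewrite /X; field.
  exact: lerD.
- move=> s r [] u a h h' x hrn hu hx; have [hs hr hs' hr'] := rngS _ _ hrn.
  have LSu : inLinf (S u x) by exact: S_Linf.
  rewrite /S' lT // S_lin //; [|exact: (b_linf b')|exact: (b_linf b')].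
  by apply/funext => w; lmod_over R.
- have g1 : GR k (dweight (fun=> 1)) (0 + 1) (opcomp (0 + 1) 0 id (fun=> tt) T' opinv).
    by apply: (GR_comp Fok _ _ gT' gS) => [|ih]; [ring|rewrite mulr1].
  have g2 : GR k (dweight (fun=> 1)) (0 + 1)
      (opcomp 0 (0 + 1) (fun=> tt) id opinv (opcomp (0 + 1) 0 id (fun=> tt) T' opinv)).
    by apply: (GR_comp Fok _ _ gS g1) => [|ih]; [ring|rewrite mul1r].
  have g3 := GR_lin (-1) Fok g2
    (@GR_zero k F F (unit * B) (dweight (fun=> 1)) (0 + 1) Fok (b_m b') (b_nu b')).
  (* The composition passes through levels [q1] and [q2]; moving the inner inverse up to [r] and the
     outer one down to [s] identifies it with [S']. *)
  apply: (GR_ext Fok) g3 => s r ih u x hrn hu hx; rewrite /S'; apply/funext => w; congr (_ *: _ + _).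
  have [hs hr hs' hr'] := rngS _ _ hrn.
  pose q1 := (s + r - 1) / 2.
  have m1 : rng 0 s q1 by case: hrn => *; split; rewrite /q1; lra.
  have m2 : rng (0 + 1) q1 r by case: hrn => *; split; rewrite /q1; lra.
  have bc := GR_base g1.
  rewrite (opcompE _ _ bS bc _ m1 m2 hu hx) /=.
  pose q2 := (q1 + r + 1) / 2.
  have m3 : rng (0 + 1) q1 q2 by case: (m2) => *; split; rewrite /q2; lra.
  have m4 : rng 0 q2 r by case: (m2) => *; split; rewrite /q2; lra.
  rewrite (opcompE _ _ b' bS _ m3 m4 hu hx) /=.
  have [hq2 _ _ _] := rng0 (lexx 0) m4.
  have LSu : inLinf (S u x) by exact: S_Linf.
  rewrite [opinv q2 r _ u x]opinvE // (b_right b' ih m3) //; last by case: m4 => *; lra.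
  have [hq1 _ hq1' _] := rng0 (lexx 0) m1.
  rewrite /opinv (b_left b') //.
Qed.

End Inverse.
End GradedOperations.

(** * Regularity of the transfer operators *)

Section ConsArg.
Variables (R : realType) (B : normedModType R).

Lemma cons_arg0 j (h : B) (v : 'I_j -> B) : cons_arg h v ord0 = h.
Proof. by rewrite /cons_arg unlift_none. Qed.

Lemma cons_arg_lift j (h : B) (v : 'I_j -> B) i : cons_arg h v (lift ord0 i) = v i.
Proof. by rewrite /cons_arg liftK. Qed.

Lemma cons_arg_eta j (v : 'I_j.+1 -> B) :
  cons_arg (v ord0) (fun i => v (lift ord0 i)) = v.
Proof. by apply/funext => k; rewrite /cons_arg; case: unliftP => [k' ->|->]. Qed.

Lemma cons_arg_upd j (h x : B) (v : 'I_j -> B) i :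
  cons_arg h (fun k => if k == i then x else v k) =
  (fun k => if k == lift ord0 i then x else cons_arg h v k).
Proof.
apply/funext => k; rewrite /cons_arg; case: unliftP => [k' ->|->].
  by rewrite (inj_eq lift_inj).
by rewrite (negbTE (neq_lift _ _)).
Qed.

Lemma cons_arg_upd0 j (x : B) (v : 'I_j.+1 -> B) :
  (fun k => if k == ord0 then x else v k) = cons_arg x (fun i => v (lift ord0 i)).
Proof.
apply/funext => k; rewrite /cons_arg; case: unliftP => [k' ->|->].
  by rewrite eq_sym (negbTE (neq_lift _ _)).
by rewrite eqxx.
Qed.

Definition vweight j (v : 'I_j -> B) : R := \prod_(i < j) `|v i|.

Lemma vweight_ge0 j (v : 'I_j -> B) : 0 <= vweight v.
Proof. by apply: prodr_ge0. Qed.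

Lemma vweight_cons j (h : B) (v : 'I_j -> B) : vweight (cons_arg h v) = `|h| * vweight v.
Proof.
rewrite /vweight big_ord_recl cons_arg0; congr (_ * _).
by apply: eq_bigr => i _; rewrite cons_arg_lift.
Qed.

Section Multilinear.
Variables (Y : lmodType R) (j : nat) (M : ('I_j -> B) -> Y).
Hypothesis hM : multilinear M.

Lemma multilinearZ i v a x : M (fun k => if k == i then a *: x else v k) =
  a *: M (fun k => if k == i then x else v k).
Proof.
have z : M (fun k => if k == i then 0 else v k) = 0.
  by have := hM i v (-1) 0 0; rewrite scaler0 addr0 scaleN1r addNr.
by have := hM i v a x 0; rewrite addr0 z addr0.
Qed.

Lemma multilinear_scale (a : 'I_j -> R) v :
  M (fun i => a i *: v i) = (\prod_(i < j) a i) *: M v.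
Proof.
have H (s : seq 'I_j) : uniq s ->
    M (fun i => if i \in s then a i *: v i else v i) = (\prod_(i <- s) a i) *: M v.
  elim: s => [_|x s IHs /= /andP[xs us]].
    by rewrite big_nil scale1r.
  rewrite big_cons -scalerA -(IHs us).
  pose v' := fun i => if i \in s then a i *: v i else v i.
  have -> : (fun i => if i \in x :: s then a i *: v i else v i) =
      (fun k => if k == x then a x *: v x else v' k).
    by apply/funext => k; rewrite inE; have [->|] := eqVneq k x.
  rewrite multilinearZ; congr (_ *: M _); apply/funext => k.
  by have [->|//] := eqVneq k x; rewrite /v' (negbTE xs).
have := H (index_enum 'I_j) (index_enum_uniq _).
have -> : (fun i => if i \in index_enum 'I_j then a i *: v i else v i) = (fun i => a i *: v i).
  by apply/funext => i; rewrite mem_index_enum.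
by [].
Qed.

End Multilinear.

Lemma multilinear_cons (Y : lmodType R) j (M : ('I_j.+1 -> B) -> Y) h :
  multilinear M -> multilinear (fun v => M (cons_arg h v)).
Proof. by move=> hM i v a x y; rewrite !cons_arg_upd hM. Qed.

Variables (d : measure_display) (Om : measurableType d).

Lemma Linf_opnorm_pt (V W : normedModType R) (T : (Om -> V) -> Om -> W) (c : R) :
  (Linf_opnorm T <= c%:E)%E -> forall phi, inLinf phi -> bnd phi 1 -> bnd (T phi) c.
Proof.
move=> hT phi hp hb w; rewrite -lee_fin; apply: le_trans hT.
apply: (@le_trans _ _ (supnorm (T phi))); first by apply: ereal_sup_ubound; exists w.
apply: ereal_sup_ubound; exists phi => //; split=> //.
by apply: ge_ereal_sup => _ [w' _ <-]; rewrite lee_fin.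
Qed.

Lemma mlnorm_Linf_pt (V W : normedModType R) j (M : ('I_j -> B) -> (Om -> V) -> Om -> W) (c : R) :
  multilinear M -> (mlnorm (@Linf_opnorm R d Om V W) M <= c%:E)%E ->
  forall v phi, inLinf phi -> bnd phi 1 -> bnd (M v phi) (c * vweight v).
Proof.
move=> hM hc v phi hp hb w.
(* For [v i = 0] the inverse is 0 by convention, so [e i = 0]; the vector is still in the unit ball
   and [v i = |v i| e i] still holds. *)
pose e i := `|v i|^-1 *: v i.
have ve : v = (fun i => `|v i| *: e i).
  apply/funext => i; rewrite /e scalerA; have [->|vi] := eqVneq (v i) 0.
    by rewrite scaler0.
  by rewrite divff ?scale1r // normr_eq0.
have -> : M v phi w = vweight v *: M e phi w.
  by rewrite {1}ve (multilinear_scale hM).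
rewrite normrZ ger0_norm ?vweight_ge0 // mulrC ler_wpM2r ?vweight_ge0 //.
have he : (Linf_opnorm (M e) <= c%:E)%E.
  apply: le_trans hc; apply: ereal_sup_ubound; exists e => // i.
  rewrite /e normrZ normfV normr_id; have [->|vi] := eqVneq (v i) 0.
    by rewrite normr0 mulr0.
  by rewrite mulVf // normr_eq0.
exact: (Linf_opnorm_pt he).
Qed.

Lemma linear_sectionsZ (V W : normedModType R) (T : (Om -> V) -> Om -> W) (c : R) phi :
  (forall a phi psi, inLinf phi -> inLinf psi ->
     T (fun w => a *: phi w + psi w) = (fun w => a *: T phi w + T psi w)) ->
  inLinf phi -> T (fun w => c *: phi w) = (fun w => c *: T phi w).
Proof.
move=> hT hp.
have z : T (fun _ => 0) = (fun _ => 0).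
  have := hT (-1) phi phi hp hp.
  have -> : (fun w => -1 *: phi w + phi w) = (fun _ => 0).
    by apply/funext => w; rewrite scaleN1r addNr.
  by move=> ->; apply/funext => w; rewrite scaleN1r addNr.
have := hT c phi (fun _ => 0) hp (inLinf_cst _ _); rewrite z.
have -> : (fun w => c *: phi w + 0) = (fun w => c *: phi w).
  by apply/funext => w; rewrite addr0.
by move=> ->; apply/funext => w; rewrite addr0.
Qed.

Lemma unit_to_all (V W : normedModType R) (T : (Om -> V) -> Om -> W) (K : R) :
  (forall a phi psi, inLinf phi -> inLinf psi ->
     T (fun w => a *: phi w + psi w) = (fun w => a *: T phi w + T psi w)) ->
  (forall phi, inLinf phi -> bnd phi 1 -> bnd (T phi) K) ->
  forall phi c, inLinf phi -> bnd phi c -> bnd (T phi) (K * c).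
Proof.
move=> hT h1 phi c hp hb w.
have c0 : 0 <= c := bnd_ge0 w hb.
have [cz|cz] := eqVneq c 0.
  have -> : phi = (fun _ => 0).
    by apply/funext => w'; apply/eqP; rewrite -normr_le0 -cz.
  have := linear_sectionsZ 0 hT (inLinf_cst Om (0 : V)).
  have -> : (fun w : Om => 0 *: (0 : V)) = (fun _ => 0) by apply/funext => w'; rewrite scaler0.
  by move=> ->; rewrite scale0r normr0 cz mulr0.
have cp : 0 < c by rewrite lt_neqAle eq_sym cz.
pose psi := fun w => c^-1 *: phi w.
have hpsi : inLinf psi by exact: inLinfZ.
have bpsi : bnd psi 1.
  by move=> w'; rewrite normrZ ger0_norm ?invr_ge0 // ler_pdivrMl // mulr1.
have -> : T phi = (fun w => c *: T psi w).
  rewrite -(linear_sectionsZ c hT hpsi); congr T.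
  by apply/funext => w'; rewrite /psi scalerA divff // scale1r.
by rewrite normrZ ger0_norm // mulrC ler_wpM2r //; exact: h1.
Qed.

End ConsArg.

(** With [al] in [(0, 1]] the exponent is nonzero and splits in only one way, so the decomposition
    hidden in [Ct] is the given one. *)
Lemma Ct_unpack (R : realType) (B : normedModType R) (Y : lmodType R) (N : Y -> \bar R)
    (U : set B) (k : nat) (al : R) (g : B -> Y) :
  0 < al <= 1 -> Ct N U (k%:R + al) g -> Ck_alpha N U k al g.
Proof.
move=> hal [[e _]|[k' [al' [e hal' h]]]].
  by have : 0 <= (k%:R : R) by []; lra.
have ek : k = k'.
  apply/eqP; rewrite eqn_leq; apply/andP; split.
    have : (k%:R : R) < k'.+1%:R by rewrite -natr1; lra.
    by rewrite ltr_nat ltnS.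
  have : (k'%:R : R) < k.+1%:R by rewrite -natr1; lra.
  by rewrite ltr_nat ltnS.
by move: e; rewrite ek => /addrI ->.
Qed.

Lemma open_segment_start (R : realType) (B : normedModType R) (U : set B) (u h : B) (dl : R) :
  open U -> U u -> 0 < dl ->
  exists N : nat, forall n, (N <= n)%N -> U (u + n.+1%:R^-1 *: h) /\ `|n.+1%:R^-1 *: h| < dl.
Proof.
move=> Uopen hu dl0.
have /nbhs_ballP[e /= e0 he] : nbhs u U by apply: open_nbhs_nbhs.
pose k := (`|h| + 1) / Num.min e dl.
have m0 : 0 < Num.min e dl by rewrite lt_min e0.
exists (Num.trunc k) => n hn.
have hk : k < n.+1%:R by apply: lt_le_trans (truncnS_gt k) _; rewrite ler_nat ltnS.
have hh : `|n.+1%:R^-1 *: h| < Num.min e dl.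
  rewrite normrZ ger0_norm ?invr_ge0 // ltr_pdivrMl // mulrC -ltr_pdivrMl //.
  by apply: le_lt_trans hk; rewrite /k mulrC ler_wpM2r ?invr_ge0 ?(ltW m0) // lerDl.
move: hh; rewrite lt_min => /andP[h1 h2]; split=> //.
apply: he; rewrite -ball_normE /ball_ /=.
have -> : u - (u + n.+1%:R^-1 *: h) = - (n.+1%:R^-1 *: h) by lmod_over R.
by rewrite normrN.
Qed.

(* The derivatives provided by the hypothesis depend on the pair of levels and
   on the order of regularity; limits of difference quotients make them
   coherent.  They are also only controlled on the unit ball of sections. *)
Section DerivativesOfOperators.
Variables (R : realType) (B : normedModType R) (U : set B).
Variables (d : measure_display) (Om : measurableType d) (r0 : R).
Local Notation opfam := (opfam B Om).
Local Notation rng := (rng r0).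
Local Notation scale_ok := (scale_ok r0).
Local Notation base := (base U r0).
Local Notation GR := (GR U r0).

Variables (F G : scale R) (A : opfam F G unit).
Arguments A : clear implicits.
Hypotheses (Fok : scale_ok F) (Gok : scale_ok G) (Uopen : open U).
Hypothesis A_linf : forall s r u phi, rng 0 s r -> U u -> inLinf phi -> inLinf (A s r tt u phi).
Hypothesis A_lin : forall s r u (a : R) phi psi, rng 0 s r -> U u -> inLinf phi -> inLinf psi ->
    A s r tt u (fun w => a *: phi w + psi w) =
    (fun w => a *: A s r tt u phi w + A s r tt u psi w).
Hypothesis A_left : forall (s' s r : R) u phi, 0 < s' < s -> rng 0 s r -> U u -> inLinf phi ->
    (fun w => sj G s' s (A s r tt u phi w)) = A s' r tt u phi.
Hypothesis A_right : forall s q r u phi, rng 0 s q -> q < r -> r <= r0 -> U u -> inLinf phi ->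
    A s q tt u (fun w => sj F q r (phi w)) = A s r tt u phi.
Hypothesis A_reg : forall s r (t : R), rng 0 s r -> 0 <= t < r - s ->
  Ct (@Linf_opnorm R d Om (sp F r) (sp G s)) U t (A s r tt).

Definition quot (s : R) (D : B -> Om -> sp G s) (h u : B) (w : Om) (n : nat) : sp G s :=
  n.+1%:R *: (D (u + n.+1%:R^-1 *: h) w - D u w).

(** Iterated directional derivative at a fixed section, the direction [v ord0] being taken last. It
    is built from [A] alone, hence common to all exponents [t] of the hypothesis. [limn] is total,
    so convergence is proved separately, from the jets. *)
Fixpoint dlim (m : nat) (s r : R) : ('I_m -> B) -> B -> (Om -> sp F r) -> Om -> sp G s :=
  match m with
  | 0 => fun v u phi => A s r tt u phi
  | m.+1 => fun v u phi w =>
     limn (quot (fun u => @dlim m s r (fun i => v (lift ord0 i)) u phi) (v ord0) u w)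
  end.
Arguments dlim : clear implicits.

Let dlimS m s r v u phi w : dlim m.+1 s r v u phi w =
  limn (quot (fun u => dlim m s r (fun i => v (lift ord0 i)) u phi) (v ord0) u w).
Proof. by []. Qed.

Let lim_eq (V : normedModType R) (x : nat -> V) (l : V) : x @ \oo --> l -> limn x = l.
Proof. by move=> /cvg_lim; apply; exact: norm_hausdorff. Qed.

(** [Ck_alpha] with pointwise bounds: sections range over the unit ball, and [vweight] replaces the
    supremum over unit directions. *)
Record jet (k : nat) (al s r : R)
  (D : forall j : nat, B -> ('I_j -> B) -> (Om -> sp F r) -> Om -> sp G s) : Prop := Jet {
  jet0 : forall u v, U u -> D 0%N u v = A s r tt u;
  jet_ml : forall j u, (j <= k)%N -> U u -> multilinear (D j u);
  jet_bd : exists M : R, forall j u v phi, (j <= k)%N -> U u -> inLinf phi -> bnd phi 1 ->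
    bnd (D j u v phi) (M * vweight v);
  jet_der : forall j u, (j < k)%N -> U u -> forall e : R, 0 < e -> exists dl : R, 0 < dl /\
    forall h, `|h| < dl -> U (u + h) -> forall v phi, inLinf phi -> bnd phi 1 ->
      bnd (fun w => D j (u + h) v phi w - D j u v phi w - D j.+1 u (cons_arg h v) phi w)
        (e * `|h| * vweight v);
  jet_hold : exists C : R, forall u w v phi, U u -> U w -> inLinf phi -> bnd phi 1 ->
    bnd (fun x => D k u v phi x - D k w v phi x) (C * `|u - w| `^ al * vweight v) }.

Let jetP k al s r : 0 < al <= 1 -> rng (k%:R + al) s r -> exists D, @jet k al s r D.
Proof.
move=> hal hr; have k0 : 0 <= (k%:R : R) by [].
have hr0 : rng 0 s r by apply: rng_le hr; lra.
have ht : 0 <= k%:R + al < r - s by case: hr => *; lra.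
have [D [D0 Dml [M hM] Dder [C hC]]] := Ct_unpack hal (A_reg hr0 ht).
exists D; split=> //.
- exists M => j u v phi hj hu hp hb; apply: mlnorm_Linf_pt => //; [exact: Dml|exact: hM].
- move=> j u hj hu e e0; have [dl [dl0 hd]] := Dder j u hj hu e e0.
  exists dl; split=> // h hh huh v phi hp hb.
  have ml : multilinear (fun v => (D j (u + h) v - D j u v - D j.+1 u (cons_arg h v))%R).
    move=> i v' a x y; have hj' := ltnW hj.
    rewrite (Dml j _ hj' huh) (Dml j _ hj' hu) (multilinear_cons h (Dml j.+1 u hj hu)).
    by lmod_over R.
  exact: (mlnorm_Linf_pt ml (hd h hh huh) v hp hb).
- exists C => u w v phi hu hw hp hb.
  have ml : multilinear (fun v => (D k u v - D k w v)%R).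
    move=> i v' a x y.
    rewrite (Dml k u (leqnn k) hu) (Dml k w (leqnn k) hw).
    by lmod_over R.
  exact: (mlnorm_Linf_pt ml (hC u w hu hw) v hp hb).
Qed.

(** By linearity in the first slot, [D j.+1] at the step [h / (n + 1)] is [1 / (n + 1)] times its
    value at [h]; the Frechet estimate thus becomes convergence of quotients, uniform over the
    points. *)
Let jet_quotD k al s r D : @jet k al s r D -> forall j u v phi, (j < k)%N -> U u ->
  inLinf phi -> bnd phi 1 -> forall e : R, 0 < e -> exists N : nat, forall n, (N <= n)%N ->
  U (u + n.+1%:R^-1 *: v ord0) /\
  forall w, `|quot (fun u => D j u (fun i => v (lift ord0 i)) phi) (v ord0) u w n -
     D j.+1 u v phi w| <= e.
Proof.
move=> jD j u v phi hj hu hp hb e e0.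
set h := v ord0; set v' := fun i => v (lift ord0 i).
have X0 : 0 < `|h| * vweight v' + 1 by rewrite ltr_wpDl // mulr_ge0 // vweight_ge0.
have [dl [dl0 hd]] := jet_der jD hj hu (divr_gt0 e0 X0).
have [N hN] := open_segment_start h Uopen hu dl0.
exists N => n hn; have [hun hdn] := hN n hn; split=> // w.
have := hd _ hdn hun v' phi hp hb w.
have ev : v = cons_arg h v' by rewrite cons_arg_eta.
have -> : D j.+1 u (cons_arg (n.+1%:R^-1 *: h) v') phi w = n.+1%:R^-1 *: D j.+1 u v phi w.
  rewrite ev; have ml := jet_ml jD hj hu.
  have := multilinearZ ml ord0 (cons_arg h v') n.+1%:R^-1 h.
  rewrite !cons_arg_upd0.
  have -> : (fun i => cons_arg h v' (lift ord0 i)) = v'.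
    by apply/funext => i; rewrite cons_arg_lift.
  by move=> ->.
rewrite /quot; set y := D j.+1 u v phi w; set z := _ - D j u v' phi w => hz.
have n0 : (n.+1%:R : R) != 0 by [].
clearbody z y.
have -> : n.+1%:R *: z - y = n.+1%:R *: (z - n.+1%:R^-1 *: y).
  by rewrite scalerBr scalerA divff // scale1r.
rewrite normrZ ger0_norm //; apply: le_trans (ler_wpM2l (ler0n _ _) hz) _.
rewrite normrZ ger0_norm ?invr_ge0 //.
have alg (c a p q : R) : c != 0 -> c * (a * (c^-1 * p) * q) = a * (p * q) by move=> c0; field.
by rewrite alg //; apply: ler_mul_small; rewrite ?(ltW e0) ?mulr_ge0 ?vweight_ge0.
Qed.

Let dlim_jet k al s r D : @jet k al s r D -> forall j u v phi, (j <= k)%N -> U u ->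
  inLinf phi -> bnd phi 1 -> dlim j s r v u phi = D j u v phi.
Proof.
move=> jD; elim=> [|j IHj] u v phi hj hu hp hb; first by rewrite /= (jet0 jD).
apply/funext => w; rewrite dlimS; apply: lim_eq; apply/cvgrPdist_le => e e0.
have [N hN] := jet_quotD jD v hj hu hp hb e0.
exists N => // n /= hn; have [hun /(_ w)] := hN n hn.
by rewrite distrC /quot !IHj //; exact: ltnW.
Qed.

Let dlim_cvg1 j s r u v phi : rng j.+1%:R s r -> U u -> inLinf phi -> bnd phi 1 ->
  forall e : R, 0 < e -> exists N : nat, forall n, (N <= n)%N ->
  U (u + n.+1%:R^-1 *: v ord0) /\
  forall w, `|quot (fun u => dlim j s r (fun i => v (lift ord0 i)) u phi) (v ord0) u w n -
     dlim j.+1 s r v u phi w| <= e.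
Proof.
move=> hr hu hp hb e e0; pose al := Num.min 1 ((r - s - j.+1%:R) / 2).
have al0 : 0 < al by rewrite lt_min; apply/andP; split; case: hr => *; lra.
have al1 : al <= 1 by rewrite ge_min lexx.
have alr : al <= (r - s - j.+1%:R) / 2 by rewrite ge_min lexx orbT.
have hal : 0 < al <= 1 by rewrite al0.
have hr1 : rng (j.+1%:R + al) s r by case: hr => *; split=> //; lra.
have [D jD] := jetP hal hr1.
have [N hN] := jet_quotD jD v (leqnn _) hu hp hb e0.
exists N => n hn; have [hun hw] := hN n hn; split=> // w.
by rewrite (dlim_jet jD) // /quot !(dlim_jet jD) //; exact: hw.
Qed.

Let scaled (V : normedModType R) (phi : Om -> V) : inLinf phi -> exists c psi,
  [/\ 0 < c, inLinf psi, bnd psi 1 & phi = (fun w => c *: psi w)].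
Proof.
move=> hp; have [_ [c hc]] := hp; exists (`|c| + 1), (fun w => (`|c| + 1)^-1 *: phi w).
have c1 : 0 < `|c| + 1 by rewrite ltr_wpDl.
split=> //; first exact: inLinfZ.
  move=> w; rewrite normrZ ger0_norm ?invr_ge0 ?(ltW c1) // ler_pdivrMl // mulr1.
  apply: le_trans (hc w) _; have := ler_norm c; lra.
by apply/funext => w; rewrite scalerA divff ?gt_eqF // scale1r.
Qed.

(** Jets control only the unit ball of sections. Other sections are rescaled into it, which requires
    linearity at order [j]; hence linearity is an assumption here, discharged by induction in
    [dlim_lin]. *)
Let dlim_cvg_of_lin j s r u v phi : rng j.+1%:R s r -> U u -> inLinf phi ->
  (forall v u a phi psi, U u -> inLinf phi -> inLinf psi ->
    dlim j s r v u (fun w => a *: phi w + psi w) =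
    (fun w => a *: dlim j s r v u phi w + dlim j s r v u psi w)) ->
  exists l : Om -> sp G s, forall e : R, 0 < e -> exists N : nat, forall n, (N <= n)%N ->
  U (u + n.+1%:R^-1 *: v ord0) /\
  forall w, `|quot (fun u => dlim j s r (fun i => v (lift ord0 i)) u phi) (v ord0) u w n -
     l w| <= e.
Proof.
move=> hr hu hp hl; have [c [psi [c0 hpsi bpsi ->]]] := scaled hp.
have hZ v1 u1 : U u1 -> dlim j s r v1 u1 (fun w => c *: psi w) =
    (fun w => c *: dlim j s r v1 u1 psi w).
  by move=> hu1; apply: linear_sectionsZ => // a f g hf hg; exact: hl.
exists (fun w => c *: dlim j.+1 s r v u psi w) => e e0.
have [N hN] := dlim_cvg1 v hr hu hpsi bpsi (divr_gt0 e0 c0).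
exists N => n hn; have [hun hw] := hN n hn; split=> // w.
rewrite /quot !hZ // [X in `|X|](_ : _ = c *: (quot (fun u =>
  dlim j s r (fun i => v (lift ord0 i)) u psi) (v ord0) u w n - dlim j.+1 s r v u psi w)).
  by rewrite normrZ (gtr0_norm c0) mulrC -ler_pdivlMr.
by rewrite /quot; lmod_over R.
Qed.

Let qcvg (V : normedModType R) (u h : B) (x : Om -> nat -> V) (l : Om -> V) : Prop :=
  forall e : R, 0 < e -> exists N : nat, forall n, (N <= n)%N ->
  U (u + n.+1%:R^-1 *: h) /\ forall w, `|x w n - l w| <= e.

(** Uniqueness of limits for quotients that agree at base points of [U]: linearity and compatibility
    with the injections pass in this way from [dlim j] to [dlim j.+1]. *)
Let qcvg_eq (V : normedModType R) u h (x y : Om -> nat -> V) l l' :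
  (forall w n, U (u + n.+1%:R^-1 *: h) -> x w n = y w n) ->
  qcvg u h x l -> qcvg u h y l' -> l = l'.
Proof.
move=> e hx hy; apply/funext => w; apply/eqP; rewrite -subr_eq0 -normr_le0.
apply/ler_addgt0Pr => eps e0; rewrite add0r.
have e2 : 0 < eps / 2 by rewrite divr_gt0.
have [N hN] := hx _ e2; have [N' hN'] := hy _ e2.
have [hU h1] := hN _ (leq_maxl N N'); have [_ h2] := hN' _ (leq_maxr N N').
have -> : l w - l' w = (y w (maxn N N') - l' w) - (x w (maxn N N') - l w).
  by rewrite e //; lmod_over R.
apply: le_trans (ler_normB _ _) _; have := h1 w; have := h2 w; lra.
Qed.

Let qcvg_lincomb (V : normedModType R) u h a (x y : Om -> nat -> V) l l' :
  qcvg u h x l -> qcvg u h y l' ->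
  qcvg u h (fun w n => a *: x w n + y w n) (fun w => a *: l w + l' w).
Proof.
move=> hx hy e e0; have a1 : 0 < `|a| + 1 by rewrite ltr_wpDl.
have e1 : 0 < e / 2 / (`|a| + 1) by rewrite !divr_gt0.
have e2 : 0 < e / 2 by rewrite divr_gt0.
have [N hN] := hx _ e1; have [N' hN'] := hy _ e2.
exists (maxn N N') => n; rewrite geq_max => /andP[n1 n2].
have [hU h1] := hN _ n1; have [_ h2] := hN' _ n2; split=> // w.
have -> : a *: x w n + y w n - (a *: l w + l' w) = a *: (x w n - l w) + (y w n - l' w).
  by lmod_over R.
apply: le_trans (ler_normD _ _) _; rewrite normrZ [e in _ <= e]splitr.
apply: lerD => //; have := h1 w; rewrite ler_pdivlMr // => h3.
have := normr_ge0 a; have := normr_ge0 (x w n - l w); nra.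
Qed.

Let dlimS_qcvg j s r u v phi : rng j.+1%:R s r -> U u -> inLinf phi ->
  (forall v u a phi psi, U u -> inLinf phi -> inLinf psi ->
    dlim j s r v u (fun w => a *: phi w + psi w) =
    (fun w => a *: dlim j s r v u phi w + dlim j s r v u psi w)) ->
  qcvg u (v ord0) (quot (fun u => dlim j s r (fun i => v (lift ord0 i)) u phi) (v ord0) u)
    (dlim j.+1 s r v u phi).
Proof.
move=> hr hu hp hl; have [l hcl] := dlim_cvg_of_lin v hr hu hp hl.
suff -> : dlim j.+1 s r v u phi = l by [].
apply/funext => w; rewrite dlimS; apply: lim_eq; apply/cvgrPdist_le => e e0.
have [N hN] := hcl e e0; exists N => // n /= hn; have [_ /(_ w)] := hN n hn.
by rewrite distrC.
Qed.

Let dlim_lin j s r : rng j%:R s r -> forall v u a phi psi, U u -> inLinf phi -> inLinf psi ->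
  dlim j s r v u (fun w => a *: phi w + psi w) =
  (fun w => a *: dlim j s r v u phi w + dlim j s r v u psi w).
Proof.
elim: j => [|j IHj] hr v u a phi psi hu hp hp'; first exact: A_lin.
have hr' : rng j%:R s r by apply: rng_le hr; rewrite -natr1; lra.
have IH := IHj hr'.
apply: (qcvg_eq _ (dlimS_qcvg v hr hu (inLinf_lincomb a hp hp') IH)
  (qcvg_lincomb a (dlimS_qcvg v hr hu hp IH) (dlimS_qcvg v hr hu hp' IH))) => w n hun.
by rewrite /quot !IH //; lmod_over R.
Qed.

Let dlim_qcvg j s r u v phi : rng j.+1%:R s r -> U u -> inLinf phi ->
  qcvg u (v ord0) (quot (fun u => dlim j s r (fun i => v (lift ord0 i)) u phi) (v ord0) u)
    (dlim j.+1 s r v u phi).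
Proof.
move=> hr hu hp; apply: dlimS_qcvg => //; apply: dlim_lin.
by apply: rng_le hr; rewrite -natr1; lra.
Qed.

Let dlim_linf j s r v u phi : rng j%:R s r -> U u -> inLinf phi -> inLinf (dlim j s r v u phi).
Proof.
elim: j v u => [|j IHj] v u hr hu hp; first exact: A_linf.
have hr' : rng j%:R s r by apply: rng_le hr; rewrite -natr1; lra.
have hq := dlim_qcvg v hr hu hp.
have [N0 hN0] := hq 1 ltr01.
(* The shift by [N0] keeps every base point inside [U], where the induction hypothesis applies. *)
pose x n w := quot (fun u => dlim j s r (fun i => v (lift ord0 i)) u phi) (v ord0) u w (n + N0).
apply: (@inLinf_uniform_limit _ _ _ _ x).
  move=> n; have [hun _] := hN0 _ (leq_addl n N0).
  by rewrite /x /quot; apply: inLinfZ; apply: inLinfB; apply: IHj.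
move=> e e0; have [N hN] := hq e e0; exists N => w.
by have [_ /(_ w)] := hN _ (leq_addr N0 N).
Qed.

Let qcvg_map (V W : normedModType R) (T : V -> W) M u h (x : Om -> nat -> V) l :
  (forall y z, T (y - z) = T y - T z) -> (forall y, `|T y| <= M * `|y|) ->
  qcvg u h x l -> qcvg u h (fun w n => T (x w n)) (fun w => T (l w)).
Proof.
move=> TB TM hx e e0; have M1 : 0 < `|M| + 1 by rewrite ltr_wpDl.
have [N hN] := hx _ (divr_gt0 e0 M1); exists N => n hn; have [hU h1] := hN n hn.
split=> // w; rewrite -TB; apply: le_trans (TM _) _.
have := h1 w; rewrite ler_pdivlMr // => h2.
have := ler_norm M; have := normr_ge0 (x w n - l w); nra.
Qed.

Let dlim_left j s' s r v u phi : 0 < s' < s -> rng j%:R s r -> U u -> inLinf phi ->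
  (fun w => sj G s' s (dlim j s r v u phi w)) = dlim j s' r v u phi.
Proof.
move=> hs; elim: j v u => [|j IHj] v u hr hu hp; first exact: A_left.
have hr' : rng j%:R s r by apply: rng_le hr; rewrite -natr1; lra.
have hr2 : rng j.+1%:R s' r by case: hr => *; split=> //; lra.
have sr : s <= r0 by case: hr' => *; have : 0 <= (j%:R : R) by []; lra.
have [lj [M hM]] := Gok.1 s' s hs sr.
have lB := is_linearB lj.
apply: (qcvg_eq _ (qcvg_map lB hM (dlim_qcvg v hr hu hp)) (dlim_qcvg v hr2 hu hp)) => w n hun.
rewrite /quot (is_linearZ lj) lB.
by have e u1 (hu1 : U u1) := congr1 (fun f => f w) (IHj (fun i => v (lift ord0 i)) u1 hr' hu1 hp); rewrite !e.
Qed.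

Let dlim_right j s q r v u phi : rng j%:R s q -> q < r -> r <= r0 -> U u -> inLinf phi ->
  dlim j s q v u (fun w => sj F q r (phi w)) = dlim j s r v u phi.
Proof.
elim: j v u => [|j IHj] v u hr qr rr hu hp; first exact: A_right.
have hr' : rng j%:R s q by apply: rng_le hr; rewrite -natr1; lra.
have hr2 : rng j.+1%:R s r by case: hr => *; split=> //; lra.
have hq : 0 < q < r by case: hr' => *; have : 0 <= (j%:R : R) by []; lra.
have hjp := sj_Linf Fok hq rr hp.
apply: (qcvg_eq _ (dlim_qcvg v hr hu hjp) (dlim_qcvg v hr2 hu hp)) => w n hun.
by rewrite /quot !IHj.
Qed.

Let small_al m s r : rng m s r -> exists al, (0 < al <= 1) /\ rng (m + al) s r.
Proof.
move=> hr; exists (Num.min 1 ((r - s - m) / 2)).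
have h1 : 0 < Num.min 1 ((r - s - m) / 2).
  by rewrite lt_min; apply/andP; split; case: hr => *; lra.
have h2 : Num.min 1 ((r - s - m) / 2) <= 1 by rewrite ge_min lexx.
have h3 : Num.min 1 ((r - s - m) / 2) <= (r - s - m) / 2 by rewrite ge_min lexx orbT.
by split; [rewrite h1|case: hr => *; split=> //; lra].
Qed.

Let dlim_base j : base (@vweight R B j) j%:R (fun s r v u phi => dlim j s r v u phi).
Proof.
split.
- by [].
- exact: vweight_ge0.
- by move=> s r v u phi hr hu hp; exact: dlim_linf.
- by move=> s r v u a phi psi hr hu hp hp'; exact: dlim_lin.
- by move=> s' s r v u phi hs hr hu hp; exact: dlim_left.
- by move=> s q r v u phi hq qr rr hu hp; exact: dlim_right.
- move=> s r hr; have [al [hal hr1]] := small_al hr; have [D jD] := jetP hal hr1.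
  have [M hM] := jet_bd jD; exists `|M|; split=> // v u phi c hu hp hb.
  apply: (unit_to_all _ _ hp hb) => [a f g hf hg|psi hpsi bpsi w].
    exact: dlim_lin.
  rewrite (dlim_jet jD) //; apply: le_trans (hM j u v psi (leqnn j) hu hpsi bpsi w) _.
  by rewrite ler_wpM2r ?vweight_ge0 // ler_norm.
- move=> s r al hr hal; have [D jD] := jetP hal hr; have [C hC] := jet_hold jD.
  have hr' : rng j%:R s r by apply: rng_le hr; lra.
  exists `|C|; split=> // v u w phi c hu hw hp hb.
  apply: (@unit_to_all _ _ _ _ _ (fun phi x => dlim j s r v u phi x - dlim j s r v w phi x)) hp hb.
    by move=> a f g hf hg; rewrite !dlim_lin //; apply/funext => x; lmod_over R.
  move=> psi hpsi bpsi x; rewrite !(dlim_jet jD) //.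
  apply: le_trans (hC u w v psi hu hw hpsi bpsi x) _.
  by rewrite ler_wpM2r ?vweight_ge0 // ler_wpM2r ?powR_ge0 // ler_norm.
Qed.

(** The derivative of [dlim j] in direction [h] is [dlim j.+1] with [h] in front; [cons_arg] folds
    the pair index of [GR] into a tuple and respects the weights. *)
Let dlim_GR k j : GR k (@vweight R B j) j%:R (fun s r v u phi => dlim j s r v u phi).
Proof.
elim: k j => [|k IHk] j; first by split=> //; exact: dlim_base.
split; first exact: dlim_base.
exists (fun s r (vh : ('I_j -> B) * B) u phi => dlim j.+1 s r (cons_arg vh.2 vh.1) u phi).
have jS : j%:R + 1 = j.+1%:R :> R by rewrite natr1.
split.
- move=> s r; rewrite jS => hr u hu e e0.
  have hr' : rng j%:R s r by apply: rng_le hr; rewrite -natr1; lra.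
  have [al [hal hr1]] := small_al hr; have [D jD] := jetP hal hr1.
  have [dl [dl0 hd]] := jet_der jD (leqnn _) hu e0.
  exists dl; split=> // h hh huh v phi c hp hb.
  apply: (@unit_to_all _ _ _ _ _ (fun phi x => dlim j s r v (u + h) phi x - dlim j s r v u phi x -
    dlim j.+1 s r (cons_arg h v) u phi x)) hp hb.
    by move=> a f g hf hg; rewrite !dlim_lin //; apply/funext => x; lmod_over R.
  by move=> psi hpsi bpsi x; rewrite !(dlim_jet jD) //; exact: hd.
- move=> s r v u a h h' phi; rewrite jS => hr hu hp.
  have [al [hal hr1]] := small_al hr; have [D jD] := jetP hal hr1.
  have [c [psi [c0 hpsi bpsi ->]]] := scaled hp.
  have hZ v1 : dlim j.+1 s r v1 u (fun w => c *: psi w) = (fun w => c *: dlim j.+1 s r v1 u psi w).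
    by apply: linear_sectionsZ => // c' g g' hg hg'; exact: dlim_lin.
  rewrite !hZ !(dlim_jet jD) //=; apply/funext => w.
  have := jet_ml jD (leqnn _) hu ord0 (cons_arg h v) a h h'.
  rewrite !cons_arg_upd0.
  have -> : (fun i => cons_arg h v (lift ord0 i)) = v.
    by apply/funext => i; rewrite cons_arg_lift.
  move=> ->; rewrite -[(_ + _) psi w]/(a *: D j.+1 u (cons_arg h v) psi w + D j.+1 u (cons_arg h' v) psi w).
  by lmod_over R.
- rewrite jS; apply: (GR_reindex (sg := fun vh : ('I_j -> B) * B => cons_arg vh.2 vh.1)) (IHk j.+1).
  by move=> [v h] /=; rewrite vweight_cons /dweight /= mulrC.
Qed.

Lemma GR_of_Ct k : GR k (fun=> 1) 0 A.
Proof.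
have hw (i : unit) : vweight (fun _ : 'I_0 => 0 : B) <= 1 by rewrite /vweight big_ord0.
have := GR_reindex (sg := fun _ : unit => (fun _ : 'I_0 => 0 : B)) hw (dlim_GR k 0).
by apply: (GR_ext Fok) => s r [] u phi.
Qed.

End DerivativesOfOperators.

(** * From graded families to [Ct] *)

Section Tower.
Variables (R : realType) (B : normedModType R) (U : set B).
Variables (d : measure_display) (Om : measurableType d) (r0 : R).
Local Notation opfam := (opfam B Om).
Local Notation rng := (rng r0).
Local Notation GR := (GR U r0).
Hypothesis Uopen : open U.

(** The data of [Ck_alpha] with an index and weights, as the induction on [k] requires: the
    derivative of a family indexed by [I] is indexed by [I * B]. *)
Record tower (W : normedModType R) (I : Type) (nu : I -> R) (k : nat) (al : R)
    (D : forall j, I -> B -> ('I_j -> B) -> Om -> W) : Prop := Tower {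
  tw_bd : exists M : R, 0 <= M /\ forall j i u v, (j <= k)%N -> U u ->
    bnd (D j i u v) (M * nu i * vweight v);
  tw_der : forall j u, (j < k)%N -> U u -> forall e : R, 0 < e -> exists dl : R, 0 < dl /\
    forall h, `|h| < dl -> U (u + h) -> forall i v,
      bnd (fun w => D j i (u + h) v w - D j i u v w - D j.+1 i u (cons_arg h v) w)
        (e * `|h| * nu i * vweight v);
  tw_lin : forall j i u v (a : R) h h', (j < k)%N -> U u ->
    D j.+1 i u (cons_arg (a *: h + h') v) =
    (fun w => a *: D j.+1 i u (cons_arg h v) w + D j.+1 i u (cons_arg h' v) w);
  tw_hold : exists C : R, 0 <= C /\ forall i u u' v, U u -> U u' ->
    bnd (fun w => D k i u v w - D k i u' v w) (C * `|u - u'| `^ al * nu i * vweight v) }.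

Lemma cons_arg_max j (h : B) (v : 'I_j.+1 -> B) : cons_arg h v ord_max = v ord_max.
Proof.
have -> : ord_max = lift ord0 ord_max :> 'I_j.+2 by apply: val_inj.
by rewrite cons_arg_lift.
Qed.

Lemma cons_arg_widen j (h : B) (v : 'I_j.+1 -> B) :
  (fun l => cons_arg h v (widen_ord (leqnSn j.+1) l)) =
  cons_arg h (fun l => v (widen_ord (leqnSn j) l)).
Proof.
apply/funext => l; rewrite [in RHS]/cons_arg; case: unliftP => [l' ->|->].
  have -> : widen_ord (leqnSn j.+1) (lift ord0 l') = lift ord0 (widen_ord (leqnSn j) l').
    exact: val_inj.
  by rewrite cons_arg_lift.
have -> : widen_ord (leqnSn j.+1) ord0 = ord0 by apply: val_inj.
by rewrite cons_arg0.
Qed.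

Lemma vweight_recr j (v : 'I_j.+1 -> B) :
  vweight v = `|v ord_max| * vweight (fun l => v (widen_ord (leqnSn j) l)).
Proof. by rewrite /vweight big_ord_recr mulrC. Qed.

(** The recursion peels off the first derivative and builds a tower over it. The direction taken
    first therefore becomes the last argument [v ord_max], while later ones are put in front by
    [cons_arg]. *)
Lemma GR_tower (F G : scale R) k I (nu : I -> R) m (A : opfam F G I) s r phi al :
  0 < al <= 1 -> rng (m + k%:R + al) s r -> inLinf phi -> bnd phi 1 -> GR k nu m A ->
  exists2 D, tower nu k al D & forall i u v, D 0%N i u v = A s r i u phi.
Proof.
move=> hal hr hp hb; elim: k I nu m A hr => [|k IHk] I nu m A hr gA.
  have b := GR_base gA.
  exists (fun j i u v => A s r i u phi) => //.
  have hr1 : rng (m + al) s r by move: hr; rewrite addr0.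
  have hr2 : rng m s r by apply: rng_le hr1; lra.
  have [M [M0 hM]] := b_bound b hr2; have [C [C0 hC]] := b_hold b hr1 hal.
  have w0 (v : 'I_0 -> B) : vweight v = 1 by rewrite /vweight big_ord0.
  split=> //.
    exists M; split=> // j i u v; rewrite leqn0 => /eqP ej; subst j => hu w.
    by rewrite w0; exact: hM.
  by exists C; split=> // i u u' v hu hu' w; rewrite w0; exact: hC.
have b := GR_base gA; have [A' [dA lA gA']] := GR_der gA; have b' := GR_base gA'.
have k0 : 0 <= (k%:R : R) by [].
have hr1 : rng (m + 1 + k%:R + al) s r by apply: rng_le hr; rewrite -natr1; lra.
have hr2 : rng (m + 1) s r by apply: rng_le hr1; lra.
have hr3 : rng m s r by apply: rng_le hr2; lra.
have [D' tD' D'0] := IHk _ _ _ _ hr1 gA'.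
pose D j : I -> B -> ('I_j -> B) -> Om -> sp G s :=
  match j with
  | 0 => fun i u v => A s r i u phi
  | j.+1 => fun i u v => D' j (i, v ord_max) u (fun l => v (widen_ord (leqnSn j) l))
  end.
have wD j i (v : 'I_j.+1 -> B) : dweight nu (i, v ord_max) *
    vweight (fun l => v (widen_ord (leqnSn j) l)) = nu i * vweight v.
  by rewrite /dweight /= vweight_recr mulrA.
have w0 (v : 'I_0 -> B) : vweight v = 1 by rewrite /vweight big_ord0.
have D1 i u h (v : 'I_0 -> B) : D 1%N i u (cons_arg h v) = A' s r (i, h) u phi.
  rewrite /D D'0; have -> : ord_max = ord0 :> 'I_1 by apply: val_inj.
  by rewrite cons_arg0.
have DS j i u h v : D j.+2 i u (cons_arg h v) =
    D' j.+1 (i, v ord_max) u (cons_arg h (fun l => v (widen_ord (leqnSn j) l))).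
  by rewrite /D cons_arg_max cons_arg_widen.
exists D => //; split.
- have [M [M0 hM]] := b_bound b hr3; have [M' [M'0 hM']] := tw_bd tD'.
  exists (M + M'); split=> [|[|j] i u v hj hu w]; first exact: addr_ge0.
    rewrite w0 mulr1; have := hM i u phi 1 hu hp hb w; rewrite mulr1 => /le_trans; apply.
    by rewrite ler_wpM2r ?(b_nu b) // lerDl.
  rewrite -mulrA -wD mulrA; apply: le_trans (hM' j _ u _ hj hu w) _.
  by rewrite ler_wpM2r ?vweight_ge0 // ler_wpM2r ?(b_nu b') // lerDr.
- move=> [|j] u hj hu e e0.
    have [dl [dl0 hd]] := dA s r hr2 u hu e e0.
    exists dl; split=> // h hh huh i v w; rewrite D1 w0.
    exact: hd.
  have [dl [dl0 hd]] := tw_der tD' hj hu e0.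
  exists dl; split=> // h hh huh i v w; rewrite DS.
  by rewrite -[leRHS]mulrA -wD mulrA; exact: hd.
- move=> [|j] i u v a h h' hj hu; first by rewrite !D1 lA.
  by rewrite !DS (tw_lin tD').
- have [C [C0 hC]] := tw_hold tD'; exists C; split=> // i u u' v hu hu' w.
  by rewrite -[leRHS]mulrA -wD mulrA; exact: hC.
Qed.

Lemma tower_linZ (W : normedModType R) (I : Type) (nu : I -> R) k al
    (D : forall j, I -> B -> ('I_j -> B) -> Om -> W) j i u v a h :
  tower nu k al D -> (j < k)%N -> U u ->
  D j.+1 i u (cons_arg (a *: h) v) = (fun w => a *: D j.+1 i u (cons_arg h v) w).
Proof.
move=> tD hj hu.
have z : D j.+1 i u (cons_arg 0 v) = (fun _ => 0).
  have := tw_lin tD i v (-1) 0 0 hj hu; rewrite scaler0 addr0 => ->.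
  by apply/funext => w; rewrite scaleN1r addNr.
have := tw_lin tD i v a h 0 hj hu; rewrite addr0 z => ->.
by apply/funext => w; rewrite addr0.
Qed.

(** Linearity in the slot [ord0] is part of the tower. In the other slots it is inherited from
    [D j]: the defect of linearity of [D j.+1], times a small step [t], is a combination of three
    Frechet remainders. *)
Lemma tower_multilinear (W : normedModType R) (I : Type) (nu : I -> R) k al
    (D : forall j, I -> B -> ('I_j -> B) -> Om -> W) : tower nu k al D ->
  forall j i u, (j <= k)%N -> U u -> 0 <= nu i ->
  multilinear (Y := Om -> W) (D j i u).
Proof.
move=> tD; elim=> [|j IHj] i u hj hu hi; first by move=> [].
move=> l v a x y; case: (unliftP ord0 l) => [l' ->|->]; last first.
  by rewrite !cons_arg_upd0 (tw_lin tD).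
rewrite -[v]cons_arg_eta -!cons_arg_upd; pose h := v ord0; pose v' i0 := v (lift ord0 i0).
pose z1 k0 := if k0 == l' then a *: x + y else v' k0.
pose z2 k0 := if k0 == l' then x else v' k0.
pose z3 k0 := if k0 == l' then y else v' k0.
suff H w : D j.+1 i u (cons_arg h z1) w =
    a *: D j.+1 i u (cons_arg h z2) w + D j.+1 i u (cons_arg h z3) w.
  by apply/funext => w; exact: H.
apply/eqP; rewrite -subr_eq0 -normr_le0; apply/ler_addgt0Pr => e e0; rewrite add0r.
(* The total weight of the three remainders, increased by 1 to be positive. *)
pose Kc := `|h| * nu i * (vweight z1 + `|a| * vweight z2 + vweight z3) + 1.
have Kc0 : 0 < Kc.
  by rewrite ltr_wpDl // !mulr_ge0 // !addr_ge0 ?mulr_ge0 ?vweight_ge0.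
have [dl [dl0 hd]] := tw_der tD hj hu (divr_gt0 e0 Kc0).
have [N /(_ N (leqnn N))[hun hdn]] := open_segment_start h Uopen hu dl0.
move: hun hdn; set t := N.+1%:R^-1 => hun hdn.
have t0 : 0 < t by rewrite invr_gt0.
have E z := hd _ hdn hun i z w.
have jk := ltnW hj.
have m1 := congr1 (fun f => f w) (IHj i (u + t *: h) jk hun hi l' v' a x y).
have m2 := congr1 (fun f => f w) (IHj i u jk hu hi l' v' a x y).
have {}m1 : D j i (u + t *: h) z1 w = a *: D j i (u + t *: h) z2 w + D j i (u + t *: h) z3 w := m1.
have {}m2 : D j i u z1 w = a *: D j i u z2 w + D j i u z3 w := m2.
have E1 := E z1; have E2 := E z2; have E3 := E z3.
rewrite !(tower_linZ i _ t h tD hj hu) in E1 E2 E3.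
set y1 := D j.+1 i u (cons_arg h z1) w in E1 *.
set y2 := D j.+1 i u (cons_arg h z2) w in E2 *.
set y3 := D j.+1 i u (cons_arg h z3) w in E3 *.
have key : t * `|y1 - (a *: y2 + y3)| <= t * e.
  rewrite -{1}(gtr0_norm t0) -normrZ.
  set F1 := D j i (u + t *: h) z1 w - D j i u z1 w - t *: y1 in E1.
  set F2 := D j i (u + t *: h) z2 w - D j i u z2 w - t *: y2 in E2.
  set F3 := D j i (u + t *: h) z3 w - D j i u z3 w - t *: y3 in E3.
  have -> : t *: (y1 - (a *: y2 + y3)) = a *: F2 + F3 - F1.
    by rewrite /F1 /F2 /F3 m1 m2; lmod_over R.
  apply: le_trans (ler_normB _ _) _; apply: le_trans (lerD (ler_normD _ _) (lexx _)) _.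
  rewrite normrZ.
  apply: le_trans (lerD (lerD (ler_wpM2l (normr_ge0 a) E2) E3) E1) _.
  rewrite normrZ (gtr0_norm t0).
  have -> : `|a| * (e / Kc * (t * `|h|) * nu i * vweight z2) + e / Kc * (t * `|h|) * nu i * vweight z3 +
     e / Kc * (t * `|h|) * nu i * vweight z1 = t * e * ((Kc - 1) / Kc).
    by rewrite /Kc; ring.
  rewrite -[leRHS]mulr1 ler_wpM2l //; first by rewrite ltW // mulr_gt0.
  by rewrite ler_pdivrMr //; lra.
by rewrite ler_pM2l in key.
Qed.

Lemma GR_Ck_alpha (F G : scale R) k m (A : opfam F G unit) s r phi al :
  0 < al <= 1 -> rng (m + k%:R + al) s r -> inLinf phi -> bnd phi 1 -> GR k (fun=> 1) m A ->
  Ck_alpha (@supnorm R d Om (sp G s)) U k al (fun u => A s r tt u phi).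
Proof.
move=> hal hr hp hb gA; have [D tD D0] := GR_tower hal hr hp hb gA.
have w1 j (v : 'I_j -> B) : (forall i, `|v i| <= 1) -> vweight v <= 1.
  move=> hv; rewrite /vweight; apply: prodr_ile1 => i _.
  by rewrite normr_ge0 hv.
have ml j (M : ('I_j -> B) -> Om -> sp G s) (c : R) : 0 <= c ->
    (forall v, bnd (M v) (c * vweight v)) -> (mlnorm (@supnorm R d Om (sp G s)) M <= c%:E)%E.
  move=> c0 hM; apply: ge_ereal_sup => _ [v hv <-].
  apply: ge_ereal_sup => _ [w _ <-]; rewrite lee_fin; apply: le_trans (hM v w) _.
  by rewrite ler_piMr // w1.
exists (fun j => D j tt); split.
- by move=> u v _; rewrite D0.
- by move=> j u hj hu; exact: (tower_multilinear tD).
- have [M [M0 hM]] := tw_bd tD; exists M => j u hj hu; apply: ml => // v w.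
  by have := hM j tt u v hj hu w; rewrite mulr1.
- move=> j u hj hu e e0; have [dl [dl0 hd]] := tw_der tD hj hu e0.
  exists dl; split=> // h hh huh; apply: ml; first by rewrite mulr_ge0 // ltW.
  by move=> v w; have := hd h hh huh tt v w; rewrite mulr1.
- have [C [C0 hC]] := tw_hold tD; exists C => u u' hu hu'.
  apply: ml; first by rewrite mulr_ge0 // powR_ge0.
  by move=> v w; have := hC tt u u' v hu hu' w; rewrite mulr1.
Qed.

(** The exponent must lie in [(0, 1]], so a positive integer takes the exponent 1 and one derivative
    less than its value. *)
Lemma regularity_split (t : R) : 0 < t ->
  exists (k : nat) (al : R), t = k%:R + al /\ 0 < al <= 1.
Proof.
move=> t0; have := @truncn_itv R t; rewrite (ltW t0) => /(_ isT)/andP[h1 h2].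
move: h1 h2; case: (Num.trunc t) => [|n] h1 h2.
  by exists 0%N, t; split; [rewrite add0r|rewrite t0 ltW].
have e1 : n.+1%:R = n%:R + 1 :> R by rewrite natr1.
have e2 : n.+2%:R = n%:R + 1 + 1 :> R by rewrite !natr1.
have [e|e] := eqVneq t (n%:R + 1); first by exists n, 1; split=> //; rewrite ltr01 lexx.
exists n.+1, (t - n.+1%:R); split; first by rewrite addrC subrK.
have h3 : n%:R + 1 < t by rewrite lt_neqAle eq_sym e -e1.
by move: h2; rewrite e1 e2 => h2; apply/andP; split; lra.
Qed.

Lemma GR_Ct (F G : scale R) (A : opfam F G unit) s r phi t :
  0 < t -> rng t s r -> inLinf phi -> bnd phi 1 -> (forall k, GR k (fun=> 1) 0 A) ->
  Ct (@supnorm R d Om (sp G s)) U t (fun u => A s r tt u phi).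
Proof.
move=> t0 hr hp hb gA; have [k [al [et hal]]] := regularity_split t0.
right; exists k, al; split=> //; apply: GR_Ck_alpha (gA k) => //.
by rewrite add0r -et.
Qed.

End Tower.

(** * Regularity of the fixed point *)

Lemma cone_rhoZ (R : realType) (V : normedModType R) (C : set V) (rho a : R) x :
  closed_convex_cone C -> 0 < a -> cone_rho C rho x -> cone_rho C rho (a *: x).
Proof.
move=> [_ _ hZ _ _] a0 [Cx hb]; split; first exact: hZ (ltW a0) Cx.
move=> y; rewrite -ball_normE /ball_ /= => hy.
have -> : y = a *: (a^-1 *: y) by rewrite scalerA divff ?gt_eqF // scale1r.
apply: hZ; first exact: ltW.
apply: hb; rewrite -ball_normE /ball_ /=.
have -> : x - a^-1 *: y = a^-1 *: (a *: x - y).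
  by rewrite scalerBr scalerA mulVf ?gt_eqF // scale1r.
rewrite normrZ ger0_norm ?invr_ge0 ?(ltW a0) // ltr_pdivrMl //.
by move: hy; rewrite normrZ (gtr0_norm a0) mulrCA.
Qed.

(** * Linearity of composed derivatives in the new direction *)

Section LinearInDirection.
Variables (R : realType) (B : normedModType R) (U : set B).
Variables (d : measure_display) (Om : measurableType d) (r0 : R).
Variables (F G H : scale R).
Local Notation opfam := (opfam B Om).

Lemma linh_comp_inner I I1 (nu : I -> R) (nu1 : I1 * B -> R) m n mn (i0 : I)
    (A : opfam G H I) (A1 : opfam F G (I1 * B)) :
  mn = m + n -> base U r0 nu m A -> base U r0 nu1 n A1 -> linh U r0 n A1 ->
  linh U r0 mn (opcomp m n (fun=> i0) id A A1).
Proof.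
move=> -> b b1 l1 s r i u a h h' phi hr hu hp.
have [g1 g2] := mid_rng (b_m b) (b_m b1) hr.
by rewrite /opcomp l1 // (b_lin b) //; exact: (b_linf b1).
Qed.

Lemma linh_comp_outer I I1 (nu : I * B -> R) (nu1 : I1 -> R) m n mn (i1 : I1)
    (A : opfam G H (I * B)) (A1 : opfam F G I1) :
  mn = m + n -> base U r0 nu m A -> base U r0 nu1 n A1 -> linh U r0 m A ->
  linh U r0 mn (opcomp m n id (fun=> i1) A A1).
Proof.
move=> -> b b1 l1 s r i u a h h' phi hr hu hp.
have [g1 g2] := mid_rng (b_m b) (b_m b1) hr.
by rewrite /opcomp l1 //; exact: (b_linf b1).
Qed.

Lemma linh_lincomb I m (c : R) (A A1 : opfam F G (I * B)) :
  linh U r0 m A -> linh U r0 m A1 ->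
  linh U r0 m (fun s r i u phi w => c *: A s r i u phi w + A1 s r i u phi w).
Proof.
move=> l l1 s r i u a h h' phi hr hu hp; rewrite l // l1 //.
by apply/funext => w; lmod_over R.
Qed.

End LinearInDirection.

Section FixedPoint.
Variables (R : realType) (B : completeNormedModType R) (U : set B) (r0 : R).
Variables (d : measure_display) (Om : measurableType d) (tauinv : Om -> Om).
Variables (E : R -> completeNormedModType R) (C : forall r : R, set (E r)).
Variables (ell : forall r : R, E r -> R) (K rho vth : R -> R).
Variables (j : forall s r : R, E r -> E s).
Variables (L : forall r : R, B -> Om -> E r -> E r) (f : forall r : R, B -> Om -> E r).
Arguments C : clear implicits.
Arguments ell : clear implicits.
Arguments j : clear implicits.
Arguments L : clear implicits.
Arguments f : clear implicits.
Hypothesis hUopen : open U.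
Hypothesis hr0 : 0 < r0.
Hypothesis hC : forall r, 0 < r <= r0 -> closed_convex_cone (C r).
Hypothesis hell_lin : forall r, 0 < r <= r0 -> is_linear (ell r : E r -> R^o).
Hypothesis hell_norm : forall r, 0 < r <= r0 -> opnorm (ell r : E r -> R^o) = 1%E.
Hypothesis hK : forall r, 0 < r <= r0 -> 1 <= K r.
Hypothesis hrho : forall r, 0 < r <= r0 -> 0 < rho r <= 1.
Hypothesis hvth : forall r, 0 < r <= r0 -> 1 <= vth r.
Hypothesis hell_cone : forall r, 0 < r <= r0 -> forall phi, C r phi -> `|phi| / K r <= ell r phi.
Hypothesis hj_lin : forall s r, 0 < s < r -> r <= r0 -> is_linear (j s r).
Hypothesis hj_bd : exists M : R, forall s r, 0 < s < r -> r <= r0 -> (opnorm (j s r) <= M%:E)%E.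
Hypothesis hj_comp : forall t s r, 0 < t < s -> s < r -> r <= r0 ->
      forall x, j t s (j s r x) = j t r x.
Hypothesis hj_cone : forall s r, 0 < s < r -> r <= r0 -> forall x, C r x -> C s (j s r x).
Hypothesis hj_ell : forall s r, 0 < s < r -> r <= r0 -> forall x, ell r x = ell s (j s r x).
Hypothesis hL_lin : forall r u w, 0 < r <= r0 -> U u -> is_linear (L r u w).
Hypothesis hL_cone : forall r u w, 0 < r <= r0 -> U u -> forall phi, C r phi -> phi <> 0 ->
      cone_rho (C r) (rho r) (L r u w phi) /\ L r u w phi <> 0.
Hypothesis hL_norm : forall r u w, 0 < r <= r0 -> U u ->
      (((vth r)^-1)%:E <= opnorm (L r u w))%E /\ (opnorm (L r u w) <= (vth r)%:E)%E.
Hypothesis hL_meas : forall r u, 0 < r <= r0 -> U u -> forall phi : Om -> E r, inLinf phi ->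
      bochner_measurable (fun w => L r u (tauinv w) (phi (tauinv w))).
Hypothesis hL_j : forall s r u w, 0 < s < r -> r <= r0 -> U u ->
      forall x, j s r (L r u w x) = L s u w (j s r x).
Hypothesis hf : forall r u, 0 < r <= r0 -> U u ->
      [/\ inLinf (f r u),
          (forall w, cone_rho (C r) (rho r) (f r u w) /\ ell r (f r u w) = 1)
        & (forall w, f r u w =
             (ell r (L r u (tauinv w) (f r u (tauinv w))))^-1
               *: L r u (tauinv w) (f r u (tauinv w)))].
Hypothesis hreg : forall s r (t : R), 0 < s < r -> r <= r0 -> 0 <= t < r - s ->
      Ct (@Linf_opnorm R d Om (E r) (E s)) U t
        (fun u (phi : Om -> E r) => fun w => L s u (tauinv w) (j s r (phi (tauinv w)))).

Local Notation opfam := (opfam B Om).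
Local Notation rng := (rng r0).
Local Notation scale_ok := (scale_ok r0).
Local Notation base := (base U r0).
Local Notation GR := (GR U r0).
Local Notation isder := (isder U r0).
Local Notation linh := (linh U r0).
Local Notation RS := (real_scale R).

Definition cone_scale : scale R := @Scale R (fun r => E r : normedModType R) j.
Local Notation ES := cone_scale.

Let ESok : scale_ok ES.
Proof.
have [M hM] := hj_bd; split=> [s r hs hr|]; last exact: hj_comp.
split; first exact: hj_lin.
by exists M; apply: opnorm_le; [exact: hj_lin|exact: hM].
Qed.

Let RSok : scale_ok RS := real_scale_ok r0.

Section OneLevel.
Variables (r : R) (hr : 0 < r <= r0).

Lemma ell_le x : `|ell r x| <= `|x|.
Proof.
have h : (opnorm (ell r : E r -> R^o) <= 1%:E)%E by rewrite hell_norm.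
by have := opnorm_le (hell_lin hr) h x; rewrite mul1r.
Qed.

Variables (u : B) (hu : U u).

Let Lcone w x : C r x -> x <> 0 -> cone_rho (C r) (rho r) (L r u w x).
Proof. by move=> Cx x0; have [] := hL_cone w hr hu Cx x0. Qed.

Lemma L_up w x : `|L r u w x| <= vth r * `|x|.
Proof. by apply: opnorm_le; [exact: hL_lin|have [] := hL_norm w hr hu]. Qed.

Let Llow w : (((vth r)^-1)%:E <= opnorm (L r u w))%E.
Proof. by have [] := hL_norm w hr hu. Qed.

Lemma f_Linf : inLinf (f r u).
Proof. by have [] := hf hr hu. Qed.

Lemma f_normalized w : cone_rho (C r) (rho r) (f r u w) /\ ell r (f r u w) = 1.
Proof. by have [] := hf hr hu. Qed.

Let ffix w : f r u w = (ell r (L r u (tauinv w) (f r u (tauinv w))))^-1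
               *: L r u (tauinv w) (f r u (tauinv w)).
Proof. by have [] := hf hr hu. Qed.

Let Llin w : is_linear (L r u w) := hL_lin w hr hu.

Definition TR (x : Om -> E r) : Om -> E r := transfer tauinv (L r u) x.

Lemma TR_Linf x : inLinf x -> inLinf (TR x).
Proof. exact: (transfer_Linf (hvth hr) L_up (hL_meas hr hu)). Qed.

Lemma TR_fix w : TR (f r u) w = ell r (TR (f r u) w) *: f r u w.
Proof.
exact: (transfer_fix (hC hr) (hell_lin hr) ell_le (hK hr) (hrho hr) (hvth hr)
  (hell_cone hr) Llin Lcone Llow f_normalized ffix).
Qed.

Lemma lam_level_ge w : lam_min (K r) (rho r) (vth r) <= ell r (TR (f r u) w).
Proof.
exact: (lam_ge tauinv (hC hr) (hell_lin hr) ell_le (hK hr) (hrho hr) (hvth hr)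
  (hell_cone hr) Llin Lcone Llow f_normalized).
Qed.

Lemma lam_level_gt0 : 0 < lam_min (K r) (rho r) (vth r).
Proof. exact: (lam_min_gt0 (hK hr) (hrho hr) (hvth hr)). Qed.

Lemma f_norm w : 1 <= `|f r u w| <= K r.
Proof. exact: (normalized_norm ell_le (hK hr) (hell_cone hr) (f_normalized w)). Qed.

Definition TLlev (x : Om -> E r) : Om -> E r := linearized (ell r) tauinv (L r u) (f r u) x.

Lemma TLlev_solve g : inLinf g -> exists2 x, inLinf x & forall w, TLlev x w = g w.
Proof.
exact: (linearized_solve (hC hr) (hell_lin hr) ell_le (hK hr) (hrho hr) (hvth hr)
  (hell_cone hr) Llin Lcone L_up Llow (hL_meas hr hu) f_Linf f_normalized ffix).
Qed.

Lemma TLlev_bound x b : inLinf x -> bnd (TLlev x) b ->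
  bnd x (inv_bound (K r) (rho r) (vth r) * b).
Proof.
exact: (linearized_bound (hC hr) (hell_lin hr) ell_le (hK hr) (hrho hr) (hvth hr)
  (hell_cone hr) Llin Lcone Llow f_normalized ffix).
Qed.

Lemma f_compare (q : Om -> E r) (kap : Om -> R) (k0 e : R) :
  (forall w, normalized_rho (C r) (ell r) (rho r) (q w)) -> 0 < k0 ->
  (forall w, k0 <= kap w) -> 0 < e -> bnd (fun w => TR q w - kap w *: q w) e ->
  bnd (fun w => f r u w - q w) (compare_const (K r) (rho r) k0 * e).
Proof.
exact: (compare_fixed (hC hr) (hell_lin hr) ell_le (hK hr) (hrho hr) (hvth hr)
  (hell_cone hr) Llin Lcone Llow f_normalized ffix).
Qed.

Lemma TR_lin a x y : TR (fun w => a *: x w + y w) = (fun w => a *: TR x w + TR y w).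
Proof. by apply/funext => w; exact: Llin. Qed.

Lemma inv_bound_ge0 : 0 <= inv_bound (K r) (rho r) (vth r).
Proof.
have /andP[r1 _] := hrho hr; have k1 := hK hr.
have /andP[c1 _] := doeblin_const_bounds k1 (hrho hr).
rewrite /inv_bound mulr_ge0 ?invr_ge0 ?(ltW lam_level_gt0) //.
by rewrite divr_ge0 ?(ltW c1) // divr_ge0 ?(ltW r1) // mulr_ge0 //; lra.
Qed.

End OneLevel.

Let lev (s r : R) : 0 < s < r -> r <= r0 -> 0 < s <= r0 /\ 0 < r <= r0.
Proof. by move=> *; split; lra. Qed.

Let TR_j s r u x : 0 < s < r -> r <= r0 -> U u ->
  TR u (fun w => j s r (x w)) = (fun w => j s r (TR u x w)).
Proof. by move=> hs hr hu; apply/funext => w; rewrite /TR /transfer hL_j. Qed.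

(** [q = j f_r] satisfies [L_s q = kap q] exactly, with [kap] the multiplier of level [r]. The maps
    [j] are only known to preserve the full cones; [q] lies in the inner cone of level [s] because
    it is a positive multiple of an image under [L_s]. Its defect is 0, so [f_compare] applies with
    arbitrarily small [e]. *)
Lemma f_compat s r u : 0 < s < r -> r <= r0 -> U u -> (fun w => j s r (f r u w)) = f s u.
Proof.
move=> hs hr hu; have [hs' hr'] := lev hs hr.
pose q w := j s r (f r u w); pose kap w := ell r (TR u (f r u) w).
have jl := hj_lin hs hr.
have kap0 w : 0 < kap w := lt_le_trans (lam_level_gt0 hr') (lam_level_ge hr' hu w).
have qfix w : TR u q w = kap w *: q w.
  by rewrite /q TR_j // (TR_fix hr' hu) (is_linearZ jl).
have ellq w : ell s (q w) = 1 by rewrite /q -hj_ell // (f_normalized hr' hu w).2.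
have qC w : C s (q w) by apply: hj_cone => //; exact: (f_normalized hr' hu w).1.1.
have qn w : normalized_rho (C s) (ell s) (rho s) (q w).
  split=> //; have -> : q w = (kap w)^-1 *: TR u q w.
    by rewrite qfix scalerA mulVf ?gt_eqF // scale1r.
  apply: cone_rhoZ; [exact: hC|by rewrite invr_gt0|].
  have q0 : q (tauinv w) <> 0.
    move=> e; have := ellq (tauinv w); rewrite e (is_linear0 (hell_lin hs')) => /eqP.
    by rewrite eq_sym oner_eq0.
  by have [] := hL_cone (tauinv w) hs' hu (qC (tauinv w)) q0.
apply/funext => w; apply/eqP; rewrite eq_sym -subr_eq0 -normr_le0; apply/ler_addgt0Pr => e e0.
rewrite add0r.
pose k0 := lam_min (K r) (rho r) (vth r); have k00 : 0 < k0 := lam_level_gt0 hr'.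
pose M := `|compare_const (K s) (rho s) k0| + 1.
have M0 : 0 < M by rewrite ltr_wpDl.
have bq : bnd (fun w => TR u q w - kap w *: q w) (e / M).
  by move=> w'; rewrite qfix subrr normr0 ltW // divr_gt0.
have := f_compare hs' hu qn k00 (lam_level_ge hr' hu) (divr_gt0 e0 M0) bq w.
move=> /le_trans; apply; rewrite mulrCA -[leRHS]mulr1 ler_wpM2l ?(ltW e0) //.
rewrite ler_pdivrMr // mul1r /M; apply: le_trans (ler_norm _) _; by rewrite lerDl.
Qed.

Definition Lop : opfam ES ES unit :=
  fun s r _ u phi w => L s u (tauinv w) (j s r (phi (tauinv w))).
Arguments Lop : clear implicits.

Let LopE s r i u (phi : Om -> E r) :
  Lop s r i u phi = TR (r := s) u (fun w => j s r (phi w)).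
Proof. by []. Qed.

Let rngE m s r : 0 <= m -> rng m s r -> [/\ 0 < s < r, r <= r0, 0 < s <= r0 & 0 < r <= r0].
Proof. by move=> m0 [? ? ?]; split; lra. Qed.

Let rng0 s r (h : rng 0 s r) := rngE (lexx 0) h.

Lemma Lop_GR k : GR k (fun=> 1) 0 Lop.
Proof.
apply: GR_of_Ct => //.
- move=> s r u phi /rng0[h1 h2 h3 h4] hu hp; rewrite LopE; apply: TR_Linf => //.
  exact: (sj_Linf ESok).
- move=> s r u a phi psi /rng0[h1 h2 h3 h4] hu hp hp'; rewrite !LopE -TR_lin //.
  by congr TR; apply/funext => w; exact: hj_lin.
- move=> s' s r u phi hs /rng0[h1 h2 h3 h4] hu hp; have sr : s <= r0 by lra.
  rewrite !LopE -TR_j //; congr TR; apply/funext => w; apply: hj_comp => //; lra.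
- move=> s q r u phi /rng0[h1 h2 h3 h4] qr rr hu hp.
  by rewrite !LopE; congr TR; apply/funext => w; apply: hj_comp.
- by move=> s r t /rng0[h1 h2 h3 h4] ht; exact: hreg.
Qed.

Definition ellop : opfam ES RS unit := fun s r _ u phi w => ell r (phi w).
Arguments ellop : clear implicits.

Lemma ellop_GR k : GR k (fun=> 1) 0 ellop.
Proof.
apply: GR_const => //; split=> //.
- move=> s r i u phi /rng0[h1 h2 h3 h4] hu hp.
  apply: (@inLinf_lin _ _ _ (E r) R^o (ell r : E r -> R^o) 1) hp.
    exact: (is_linearB (hell_lin h4)).
  by move=> x; rewrite mul1r; exact: ell_le.
- move=> s r i u a phi psi /rng0[h1 h2 h3 h4] hu hp hp'.
  by apply/funext => w; exact: hell_lin.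
- move=> s q r i u phi /rng0[h1 h2 h3 h4] qr rr hu hp.
  by apply/funext => w; rewrite /ellop -hj_ell //; lra.
- move=> s r /rng0[h1 h2 h3 h4]; exists 1; split=> // i u phi c hu hp hb w.
  by rewrite !mul1r; apply: le_trans (ell_le h4 _) _; exact: hb.
- move=> s r al hr hal; exists 0; split=> // i u v phi c hu hv hp hb w.
  by rewrite subrr normr0 !mul0r.
Qed.

(** The section [f] as an operator family, so that products with [f] become compositions; evaluation
    at 1 gives back [f]. *)
Definition fop : opfam RS ES unit := fun s r _ u c w => c w *: f s u w.
Arguments fop : clear implicits.

(** [f(v)] is an approximate fixed section for the parameter [u], with defect [(L_u - L_v) f(v)].
    This defect is Hoelder at level [s] because [f_s(v)] comes from level [r0] with uniform bound
    [K r0]; no regularity of [f] is presupposed. *)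
Lemma f_holder s al : 0 < al <= 1 -> 0 < s -> s + al < r0 -> exists M : R, 0 <= M /\
  forall u v, U u -> U v -> bnd (fun w => f s u w - f s v w) (M * `|u - v| `^ al).
Proof.
move=> hal s0 sr; have hs : 0 < s < r0 by lra.
have [hs' hr'] := lev hs (lexx r0).
have hrn : rng (0 + al) s r0 by split; lra.
have [M [M0 hM]] := b_hold (GR_base (Lop_GR 0)) hrn hal.
pose k0 := lam_min (K s) (rho s) (vth s); have k00 : 0 < k0 := lam_level_gt0 hs'.
have K1 := hK hr'.
have MK : 0 < M * K r0 + 1 by rewrite ltr_wpDl // mulr_ge0 //; lra.
exists (`|compare_const (K s) (rho s) k0| * (M * K r0 + 1)); split.
  by rewrite mulr_ge0 // ltW.
move=> u v hu hv w.
(* [f_compare] wants a positive bound on the defect: hence this case, and the [+ 1] in the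
   constant. *)
have [->|uv] := eqVneq u v.
  by rewrite subrr normr0 !mulr_ge0 // ?(ltW MK) // powR_ge0.
have P0 : 0 < `|u - v| `^ al by apply: powR_gt0; rewrite normr_gt0 subr_eq0.
have bq : bnd (fun w => TR u (f s v) w - ell s (TR v (f s v) w) *: f s v w)
    ((M * K r0 + 1) * `|u - v| `^ al).
  move=> w'; rewrite -TR_fix //.
  have := hM tt u v (f r0 v) (K r0) hu hv (f_Linf hr' hv).
  move=> /(_ (fun w => proj2 (andP (f_norm hr' hv w))) w').
  rewrite !LopE (f_compat hs (lexx r0) hv) => /le_trans; apply.
  have -> : M * `|u - v| `^ al * 1 * K r0 = M * K r0 * `|u - v| `^ al by ring.
  by apply: ler_wpM2r; rewrite ?(ltW P0) // lerDl.
have := f_compare hs' hu (f_normalized hs' hv) k00 (lam_level_ge hs' hv) (mulr_gt0 MK P0) bq w.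
move=> /le_trans; apply; rewrite -[leRHS]mulrA ler_wpM2r ?ler_norm //.
by rewrite ltW // mulr_gt0.
Qed.

Let fop_base : base (fun=> 1) 0 fop.
Proof.
split=> //.
- move=> s r i u c /rng0[h1 h2 h3 h4] hu hc.
  by apply: (@inLinf_scale _ _ _ (E s) c) => //; exact: f_Linf.
- by move=> s r i u a c c' _ _ _ _; apply/funext => w; rewrite /fop scalerDl scalerA.
- move=> s' s r i u c hs /rng0[h1 h2 h3 h4] hu hc; have sr : s <= r0 by lra.
  apply/funext => w; rewrite /fop -(f_compat hs sr hu).
  exact: (is_linearZ (hj_lin hs sr)).
- move=> s r /rng0[h1 h2 h3 h4]; exists (K s); have K1 := hK h3; split=> [|i u c m hu hc hb w].
    by lra.
  rewrite mulr1 normrZ mulrC; have /andP[_ fK] := f_norm h3 hu w.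
  by apply: ler_pM => //; exact: hb.
- move=> s r al hr hal; have al0 : 0 <= 0 + al by lra.
  have [h1 h2 h3 h4] := rngE al0 hr; have [s0 sr _] := hr.
  have sr0 : s + al < r0 by lra.
  have [M [M0 hM]] := f_holder hal s0 sr0.
  exists M; split=> // i u v c m hu hv hc hb w.
  rewrite /fop -scalerBr normrZ mulr1 mulrC.
  by apply: ler_pM => //; exact: hM.
Qed.

Definition Lam (u : B) (w : Om) : R := ell r0 (L r0 u (tauinv w) (f r0 u (tauinv w))).

Lemma LamE s u w : 0 < s <= r0 -> U u -> ell s (TR u (f s u) w) = Lam u w.
Proof.
move=> /andP[s0 sr] hu; move: sr; rewrite le_eqVlt => /orP[/eqP ->|sr] //.
have hs : 0 < s < r0 by rewrite s0.
by rewrite -(f_compat hs (lexx r0) hu) TR_j // -hj_ell.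
Qed.

Lemma Lam_ge u w : U u -> lam_min (K r0) (rho r0) (vth r0) <= Lam u w.
Proof. by move=> hu; apply: lam_level_ge => //; rewrite hr0 lexx. Qed.

Lemma Lam_min_gt0 : 0 < lam_min (K r0) (rho r0) (vth r0).
Proof. by apply: lam_level_gt0; rewrite hr0 lexx. Qed.

(** The multiplier [ell L f] as a composition, which inherits the regularity of [f]. Its value at 1
    is [Lam] whatever the levels, since [ell] is compatible with the injections. *)
Definition Lam_comp : opfam RS RS unit :=
  opcomp 0 0 id id ellop (opcomp 0 0 id id Lop fop).
Arguments Lam_comp : clear implicits.

Lemma Lam_comp_GR k : GR k (fun=> 1) 0 fop -> GR k (fun=> 1) 0 Lam_comp.
Proof.
move=> gf; have g1 : GR k (fun=> 1) 0 (opcomp 0 0 id id Lop fop).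
  by apply: (GR_comp ESok _ _ (Lop_GR k) gf) => *; rewrite ?addr0 ?mulr1.
by apply: (GR_comp RSok _ _ (ellop_GR k) g1) => *; rewrite ?addr0 ?mulr1.
Qed.

Let Lam_compE s u w : 0 < s < r0 -> U u -> Lam_comp s r0 tt u (fun=> 1) w = Lam u w.
Proof.
move=> hs hu; rewrite /Lam_comp /opcomp; set q := _ / 2; set q' := _ / 2.
have q0 : s < q < r0 by rewrite /q; lra.
have q1 : q < q' < r0 by rewrite /q'; lra.
rewrite /ellop LopE.
have -> : (fun w => j q q' (fop q' r0 tt u (fun=> 1) w)) = f q u.
  have hq : 0 < q < q' by lra.
  have q'r : q' <= r0 by lra.
  by rewrite -(f_compat hq q'r hu); apply/funext => v; rewrite /fop scale1r.
by apply: LamE => //; lra.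
Qed.

Definition Mop : opfam ES ES unit := fun s r _ u phi w => Lam u w *: j s r (phi w).

Lemma Mop_GR k : GR k (fun=> 1) 0 fop -> GR k (fun=> 1) 0 Mop.
Proof.
move=> gf.
have := @GR_mult R B U d Om r0 ES RS ES (fun s (x : R^o) (y : E s) => x *: y) ESok
  _ _ _ _ _ k unit (fun=> 1) 0 Lam_comp (Lam_comp_GR gf).
move=> h; apply: (GR_ext ESok) (h _ _ _ _ _).
- move=> s r [] u phi hrn hu hp; have [h1 h2 h3 h4] := rng0 hrn.
  by apply/funext => w; rewrite /opmult Lam_compE //; lra.
- by move=> s a x x' y; rewrite scalerDl scalerA.
- by move=> s a x y y'; rewrite scalerDr !scalerA mulrC.
- by move=> s x y; rewrite normrZ.
- by move=> s r x y hs hr; rewrite /= (is_linearZ (hj_lin hs hr)).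
- by move=> s g h' hg hh; exact: (@inLinf_scale _ _ _ (E s) g).
Qed.

Let TLE s u x w : 0 < s <= r0 -> U u ->
  TLlev (r := s) u x w = Lam u w *: x w - TR u x w + ell s (TR u x w) *: f s u w.
Proof. by move=> hs hu; rewrite -(LamE w hs hu). Qed.

Definition Top : opfam ES ES unit := fun s r _ u phi => TLlev (r := s) u (fun w => j s r (phi w)).

Lemma Top_GR k : GR k (fun=> 1) 0 fop -> GR k (fun=> 1) 0 Top.
Proof.
move=> gf; have gM := Mop_GR gf; have gL := Lop_GR k; have ge := ellop_GR k.
have g1 : GR k (fun=> 1) 0 (opcomp 0 0 id id ellop Lop).
  by apply: (GR_comp RSok _ _ ge gL) => *; rewrite ?addr0 ?mulr1.
have g2 : GR k (fun=> 1) 0 (opcomp 0 0 id id fop (opcomp 0 0 id id ellop Lop)).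
  by apply: (GR_comp ESok _ _ gf g1) => *; rewrite ?addr0 ?mulr1.
apply: (GR_ext ESok) (GR_lin 1 ESok (GR_lin (-1) ESok gL gM) g2).
move=> s r [] u phi hrn hu hp; have [h1 h2 h3 h4] := rng0 hrn.
apply/funext => w; rewrite /Top TLE // -[TR u _]/(Lop s r tt u phi) /opcomp.
set q := _ / 2; set q' := _ / 2.
have q0 : s < q < r by rewrite /q; lra.
have q1 : q < q' < r by rewrite /q'; lra.
rewrite /fop /ellop /Mop.
(* In the composition the functional acts at an intermediate level; its compatibility with the
   injections brings it back to level [s]. *)
have -> : ell s (Lop s r tt u phi w) = ell q' (Lop q' r tt u phi w).
  have hs : 0 < s < q' by lra.
  have hq : rng 0 q' r by split; lra.
  rewrite -(b_left (GR_base gL) tt hs hq hu hp) [RHS](hj_ell hs) //; lra.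
by lmod_over R.
Qed.

(** The hypotheses stand inside the existential, with 0 as default, so that a solution can be chosen
    for all arguments at once. *)
Let S_ex s u (g : Om -> E s) : exists x, 0 < s <= r0 -> U u -> inLinf g ->
  inLinf x /\ forall w, TLlev u x w = g w.
Proof.
have [[hs hu hg]|h] := pselect [/\ 0 < s <= r0, U u & inLinf g].
  by have [x hx ex] := TLlev_solve hs hu hg; exists x.
by exists (fun _ => 0) => hs hu hg; exfalso; apply: h.
Qed.

Definition Slev s (u : B) (g : Om -> E s) : Om -> E s := projT1 (cid (S_ex u g)).

Let SlevP s u (g : Om -> E s) : 0 < s <= r0 -> U u -> inLinf g ->
  inLinf (Slev u g) /\ forall w, TLlev u (Slev u g) w = g w.
Proof. exact: (projT2 (cid (S_ex u g))). Qed.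

Let TLlev_lin s u a (x y : Om -> E s) : 0 < s <= r0 -> U u ->
  TLlev u (fun w => a *: x w + y w) = (fun w => a *: TLlev u x w + TLlev u y w).
Proof.
move=> hs hu; apply/funext => w; rewrite !TLE // TR_lin //.
have -> : ell s (a *: TR u x w + TR u y w) = a * ell s (TR u x w) + ell s (TR u y w).
  exact: hell_lin.
by lmod_over R.
Qed.

Lemma Sop_GR k : GR k (fun=> 1) 0 fop -> GR k (fun=> 1) 0 (opinv (F := ES) Slev).
Proof.
move=> gf; apply: (@GR_inv R B U d Om r0 ES Top (fun s => @TLlev s) Slev
  (fun s => inv_bound (K s) (rho s) (vth s)) ESok) (Top_GR gf).
- by move=> s u a x y hs hu _ _; exact: TLlev_lin.
- by move=> s u x b hs hu hx hb; exact: (TLlev_bound hs hu hx hb).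
- by move=> s hs; exact: inv_bound_ge0.
- by move=> s u x hs hu hx; have [] := SlevP hs hu hx.
- by move=> s u x hs hu hx; apply/funext => w; have [_] := SlevP hs hu hx.
- move=> s r u x hs hr hu hx; have [hs' hr'] := lev hs hr; have jl := hj_lin hs hr.
  apply/funext => w; rewrite /= !TLE // TR_j // (is_linearD jl) (is_linearB jl) !(is_linearZ jl).
  by rewrite -(f_compat hs hr hu) -hj_ell.
- by [].
Qed.

Let one_L := @one_Linf R d Om.
Let one_b := @one_bnd R d Om.

(** * Differentiation of the fixed point equation *)

Section FDerivative.
Variables (k : nat) (L' : opfam ES ES (unit * B)).
Arguments L' : clear implicits.
Hypothesis gf : GR k (fun=> 1) 0 fop.
Hypothesis dL : isder (fun=> 1) 0 Lop L'.
Hypothesis lL : linh (0 + 1) L'.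
Hypothesis gL' : GR k (dweight (fun=> 1)) (0 + 1) L'.

Definition Lf : opfam RS ES (unit * B) := opcomp (0 + 1) 0 id (fun=> tt) L' fop.
Arguments Lf : clear implicits.
Definition ellLf : opfam RS RS (unit * B) := opcomp 0 (0 + 1) (fun=> tt) id ellop Lf.
Arguments ellLf : clear implicits.
Definition source : opfam RS ES (unit * B) := fun s r i u c w =>
  -1 *: opcomp 0 (0 + 1) (fun=> tt) id fop ellLf s r i u c w + Lf s r i u c w.
Definition fder : opfam RS ES (unit * B) :=
  opcomp 0 (0 + 1) (fun=> tt) id (opinv (F := ES) Slev) source.
Arguments source : clear implicits.
Arguments fder : clear implicits.

Let Lf_GR : GR k (dweight (fun=> 1)) (0 + 1) Lf.
Proof. by apply: (GR_comp ESok _ _ gL' gf) => *; rewrite ?addr0 ?mulr1. Qed.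

Let ellLf_GR : GR k (dweight (fun=> 1)) (0 + 1) ellLf.
Proof. by apply: (GR_comp RSok _ _ (ellop_GR k) Lf_GR) => *; rewrite ?add0r ?mul1r. Qed.

Let fellLf_GR : GR k (dweight (fun=> 1)) (0 + 1) (opcomp 0 (0 + 1) (fun=> tt) id fop ellLf).
Proof. by apply: (GR_comp ESok _ _ gf ellLf_GR) => *; rewrite ?add0r ?mul1r. Qed.

Let source_GR : GR k (dweight (fun=> 1)) (0 + 1) source.
Proof. exact: (GR_lin (-1) ESok fellLf_GR Lf_GR). Qed.

Lemma fder_GR : GR k (dweight (fun=> 1)) (0 + 1) fder.
Proof. by apply: (GR_comp ESok _ _ (Sop_GR gf) source_GR) => *; rewrite ?add0r ?mul1r. Qed.

Lemma fder_linh : linh (0 + 1) fder.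
Proof.
have z1 : 0 + 1 = 0 + (0 + 1) :> R by rewrite !add0r.
have z2 : 0 + 1 = 0 + 1 + 0 :> R by rewrite addr0.
have l1 : linh (0 + 1) Lf.
  exact: (linh_comp_outer (nu1 := fun _ : unit => 1) tt z2 (GR_base gL') fop_base lL).
have l2 : linh (0 + 1) ellLf.
  exact: (linh_comp_inner (nu := fun _ : unit => 1) tt z1 (GR_base (ellop_GR 0)) (GR_base Lf_GR) l1).
have l3 : linh (0 + 1) (opcomp 0 (0 + 1) (fun=> tt) id fop ellLf).
  exact: (linh_comp_inner (nu := fun _ : unit => 1) tt z1 fop_base (GR_base ellLf_GR) l2).
have l4 : linh (0 + 1) source := linh_lincomb (-1) l3 l1.
exact: (linh_comp_inner (nu := fun _ : unit => 1) tt z1 (GR_base (Sop_GR gf)) (GR_base source_GR) l4).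
Qed.

Let fop1 s u : fop s r0 tt u (fun=> 1) = f s u.
Proof. by apply/funext => w; rewrite /fop scale1r. Qed.

Let TL_fder s u h : 0 < s -> s + 1 < r0 -> U u ->
  TLlev (r := s) u (fder s r0 (tt, h) u (fun=> 1)) = (fun w =>
    Lf s r0 (tt, h) u (fun=> 1) w - ell s (Lf s r0 (tt, h) u (fun=> 1) w) *: f s u w).
Proof.
move=> s0 sr hu; have bs := GR_base source_GR; have bL := GR_base Lf_GR.
have hs' : 0 < s <= r0 by lra.
pose q := (s + (r0 - 1)) / 2.
have a1 : rng 0 s q by split; rewrite /q; lra.
have a2 : rng (0 + 1) q r0 by split; rewrite /q; lra.
have sq : 0 < s < q by rewrite /q; lra.
rewrite /fder (opcompE _ _ (GR_base (Sop_GR gf)) bs (tt, h) a1 a2 hu (one_L r0)) /opinv.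
rewrite (b_left bs (tt, h) sq a2 hu (one_L r0)).
have hsr : rng (0 + 1) s r0 by split; lra.
have [_ hT] := SlevP hs' hu (b_linf bs (tt, h) hsr hu (one_L r0)).
apply/funext => w; rewrite hT /source.
have -> : opcomp 0 (0 + 1) (fun=> tt) id fop ellLf s r0 (tt, h) u (fun=> 1) w =
    ell s (Lf s r0 (tt, h) u (fun=> 1) w) *: f s u w.
  rewrite /ellLf /opcomp; set q1 := _ / 2; set q2 := _ / 2.
  have h1 : s < q1 < r0 - 1 by rewrite /q1; lra.
  have h2 : q1 < q2 < r0 - 1 by rewrite /q2; lra.
  have hq : 0 < s < q2 by lra.
  have hr : rng (0 + 1) q2 r0 by split; lra.
  rewrite /fop /ellop -(b_left bL (tt, h) hq hr hu (one_L r0)).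
  by rewrite (hj_ell hq) //; lra.
by lmod_over R.
Qed.

(** Put [delta = f(u+h) - f(u)] and [y = (L_(u+h) - L_u) f(u+h)], and let [X1] be the section
    [L' f]. Subtracting the equations [L f = Lam f] at the two parameters and using [ell f = 1]
    yields [TLeta]: apart from terms in [y - X1], only products of two small factors remain.
    [TLlev_bound] then inverts [T] at level [s] without loss. *)
Lemma fder_isder s u : 0 < s -> s + 1 < r0 -> U u -> forall e : R, 0 < e ->
  exists dl : R, 0 < dl /\ forall h, `|h| < dl -> U (u + h) ->
    bnd (fun w => f s (u + h) w - f s u w - fder s r0 (tt, h) u (fun=> 1) w) (e * `|h|).
Proof.
move=> s0 sr hu e e0.
have hs' : 0 < s <= r0 by lra.
have hsr : rng (0 + 1) s r0 by split; lra.
have alg (a b x : R) : 0 < a -> 0 < b -> a * (x / (a * b) * b) = x.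
  by move=> a0 b0; field; rewrite !gt_eqF.
pose g := r0 - s - 1; have g0 : 0 < g by rewrite /g; lra.
(* From [q] the operator [L] is differentiated at [f(u)]. The cross term passes through [q2]: there
   [f] is Lipschitz, since [q2 + 1 < r0], and [L] keeps a small exponent [be]. *)
pose q := s + 1 + g / 2; pose q2 := s + g / 2.
pose be := Num.min 1 (g / 4).
have be0 : 0 < be by rewrite lt_min; apply/andP; split; lra.
have be1 : be <= 1 by rewrite ge_min lexx.
have beg : be <= g / 4 by rewrite ge_min lexx orbT.
have be01 : 0 < be <= 1 by rewrite be0.
have one01 : 0 < (1 : R) <= 1 by rewrite ltr01 lexx.
have a1 : rng (0 + 1) s q by split; move: g0; rewrite /q /g; lra.
have a2 : rng 0 q r0 by split; move: g0; rewrite /q /g; lra.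
have a3 : rng (0 + be) s q2 by split; move: g0 beg; rewrite /q2 /g; lra.
have [sq qr hsq hq] : [/\ 0 < s < q, q <= r0, q < r0 & 0 < q <= r0].
  by split; move: g0; rewrite /q /g; lra.
have [sq2 q2r q20 hq2] : [/\ 0 < s < q2, q2 <= r0, 0 < q2 & q2 + 1 < r0].
  by split; move: g0; rewrite /q2 /g; lra.
have hq2' : 0 < q2 <= r0 by lra.
have [Cb [Cb0 hCb]] := b_hold (GR_base (Lop_GR 0)) a3 be01.
have [Cl2 [Cl20 hCl2]] := f_holder one01 q20 hq2.
have [Cl [Cl0 hCl]] := f_holder one01 s0 sr.
have [CL [CL0 hCL]] := b_bound (GR_base gL') a1.
pose CS := inv_bound (K s) (rho s) (vth s).
have CS0 : 0 <= CS := inv_bound_ge0 hs'.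
have K1 := hK hs'; have Kq1 := hK hq; have v1 := hvth hs'.
(* Three small contributions, each multiplied by the bound [CS] of the inverse. *)
pose e' := e / (3 * (CS + 1)).
have e'0 : 0 < e' by rewrite divr_gt0 // mulr_gt0 // ltr_wpDl.
have K10 : 0 < 1 + K s by rewrite ltr_pwDl // (le_trans ler01 K1).
have Kq0 : 0 < K q := lt_le_trans ltr01 Kq1.
have v0 : 0 <= vth s := le_trans ler01 v1.
have KK : 0 < (1 + K s) * K q := mulr_gt0 K10 Kq0.
pose M2 := (1 + K s) * (Cb * Cl2).
have M20 : 0 <= M2 by rewrite !mulr_ge0 // ltW.
pose W := CL * K q * Cl + vth s * Cl * Cl.
have W0 : 0 <= W by rewrite addr_ge0 // !mulr_ge0 // ltW.
have [d1 [d10 hd1]] := dL a1 hu (divr_gt0 e'0 KK).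
have ee2 : 0 < e' / (M2 + 1) by rewrite divr_gt0 // ltr_wpDl.
have [d2 [d20 hd2]] := powR_small ee2 be0.
have ee3 : 0 < e' / (W + 1) by rewrite divr_gt0 // ltr_wpDl.
exists (Num.min d1 (Num.min d2 (e' / (W + 1)))); split; first by rewrite !lt_min d10 d20.
move=> h; rewrite !lt_min => /and3P[hh1 hh2 hh3] huh.
have uh : u + h - u = h by lmod_over R.
pose X1 := Lf s r0 (tt, h) u (fun=> 1).
have X1E : X1 = L' s q (tt, h) u (f q u).
  by rewrite /X1 /Lf (opcompE _ _ (GR_base gL') fop_base (tt, h) a1 a2 hu (one_L r0)) fop1.
have fqL : inLinf (f q u) := f_Linf hq hu.
have fqb : bnd (f q u) (K q) by move=> w; have /andP[] := f_norm hq hu w.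
have bX1 : bnd X1 (CL * K q * `|h|).
  move=> w; rewrite X1E; have := hCL (tt, h) u _ _ hu fqL fqb w.
  by rewrite /dweight /= mul1r mulrAC.
pose delta w := f s (u + h) w - f s u w.
have bd : bnd delta (Cl * `|h|).
  by move=> w; have := hCl (u + h) u huh hu w; rewrite uh powRr1.
pose psi w := f q2 (u + h) w - f q2 u w.
have psiL : inLinf psi by apply: inLinfB; apply: f_Linf.
have bpsi : bnd psi (Cl2 * `|h|).
  by move=> w; have := hCl2 (u + h) u huh hu w; rewrite uh powRr1.
have Lf_lev v v' qq : U v -> U v' -> 0 < s < qq -> qq <= r0 ->
    Lop s qq tt v (f qq v') = TR v (f s v').
  by move=> hv hv' h1 h2; rewrite LopE (f_compat h1 h2 hv').
pose y w := TR (u + h) (f s (u + h)) w - TR u (f s (u + h)) w.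
have TRB v x x' : U v -> TR (r := s) v (fun w => x w - x' w) = (fun w => TR v x w - TR v x' w).
  by move=> hv; apply/funext => w; exact: (is_linearB (hL_lin _ hs' hv)).
have jB := is_linearB (hj_lin sq2 q2r).
have E2 v : U v -> Lop s q2 tt v psi = (fun w => TR v (f s (u + h)) w - TR v (f s u) w).
  move=> hv; rewrite LopE -TRB //; congr TR; apply/funext => w.
  by rewrite /psi jB -(f_compat sq2 q2r huh) -(f_compat sq2 q2r hu).
have bE1 w : `|TR (u + h) (f s u) w - TR u (f s u) w - X1 w| <= e' / ((1 + K s) * K q) * `|h| * K q.
  rewrite X1E -!(Lf_lev _ _ q) //.
  by have := hd1 h hh1 huh tt _ _ fqL fqb w; rewrite mulr1.
have bE2 w : `|Lop s q2 tt (u + h) psi w - Lop s q2 tt u psi w| <= Cb * `|h| `^ be * (Cl2 * `|h|).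
  by have := hCb tt (u + h) u _ _ huh hu psiL bpsi w; rewrite uh mulr1.
pose tt1 := e' / ((1 + K s) * K q) * K q + Cb * Cl2 * `|h| `^ be.
have by1 w : `|y w - X1 w| <= tt1 * `|h|.
  have -> : y w - X1 w = (TR (u + h) (f s u) w - TR u (f s u) w - X1 w) +
      (Lop s q2 tt (u + h) psi w - Lop s q2 tt u psi w).
    by rewrite !E2 // /y; lmod_over R.
  apply: le_trans (ler_normD _ _) _; apply: le_trans (lerD (bE1 w) (bE2 w)) _.
  by apply: eq_ler; rewrite /tt1; ring.
pose fd := fder s r0 (tt, h) u (fun=> 1).
have fdL : inLinf fd := b_linf (GR_base fder_GR) (tt, h) hsr hu (one_L r0).
have dL' : inLinf delta by apply: inLinfB; apply: f_Linf.
pose eta w := delta w - fd w.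
have etaL : inLinf eta by exact: inLinfB.
have el x x' : ell s (x - x') = ell s x - ell s x' by exact: (is_linearB (hell_lin hs')).
have eZ a x : ell s (a *: x) = a * ell s x by exact: (is_linearZ (hell_lin hs')).
have TLeta w : TLlev u eta w = (y w - X1 w) - ell s (y w - X1 w) *: f s (u + h) w -
    ell s (X1 w) *: delta w - ell s (TR u delta w) *: delta w.
  have -> : TLlev u eta w = TLlev u delta w - TLlev u fd w.
    have -> : eta = (fun w => -1 *: fd w + delta w).
      by apply/funext => w'; rewrite /eta scaleN1r addrC.
    by rewrite TLlev_lin // scaleN1r addrC.
  rewrite /fd TL_fder // -/X1 TLE //.
  have eu : TR u (f s u) w = Lam u w *: f s u w by rewrite (TR_fix hs' hu) LamE.
  have ew : TR (u + h) (f s (u + h)) w = Lam (u + h) w *: f s (u + h) w.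
    by rewrite (TR_fix hs' huh) LamE.
  have ed : TR u delta w = TR u (f s (u + h)) w - Lam u w *: f s u w.
    by rewrite /delta TRB // eu.
  have n1 := (f_normalized hs' hu w).2; have n2 := (f_normalized hs' huh w).2.
  rewrite ed /y ew !el !eZ n1 n2 /delta; lmod_over R.
have bTL : bnd (TLlev u eta) (((1 + K s) * tt1 + W * `|h|) * `|h|).
  move=> w; rewrite TLeta.
  apply: le_trans (ler_normB _ _) _; apply: le_trans (lerD (ler_normB _ _) (lexx _)) _.
  apply: le_trans (lerD (lerD (ler_normB _ _) (lexx _)) (lexx _)) _.
  rewrite !normrZ.
  have /andP[_ fK] := f_norm hs' huh w.
  have p1 : `|ell s (y w - X1 w)| * `|f s (u + h) w| <= tt1 * `|h| * K s.
    by apply: ler_pM => //; apply: le_trans (ell_le hs' _) (by1 w).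
  have p2 : `|ell s (X1 w)| * `|delta w| <= CL * K q * `|h| * (Cl * `|h|).
    by apply: ler_pM => //; exact: le_trans (ell_le hs' _) (bX1 w).
  have p3 : `|ell s (TR u delta w)| * `|delta w| <= vth s * (Cl * `|h|) * (Cl * `|h|).
    apply: ler_pM => //.
    apply: le_trans (ell_le hs' _) _; apply: le_trans (L_up hs' hu _ _) _.
    by apply: ler_wpM2l => //; exact: bd.
  apply: le_trans (lerD (lerD (lerD (by1 w) p1) p2) p3) _.
  by apply: eq_ler; rewrite /W; ring.
move=> w; rewrite -/(delta w) -/(fd w) -/(eta w).
apply: le_trans (TLlev_bound hs' hu etaL bTL w) _; rewrite -/CS mulrA.
apply: ler_wpM2r => //.
have hbe := hd2 `|h| (normr_ge0 h) hh2.
have smallM z t : 0 <= z -> t <= e' / (z + 1) -> 0 <= t -> z * t <= e'.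
  by move=> z0 tz t0; rewrite mulrC; apply: ler_mul_small => //; exact: ltW.
have m2 := smallM M2 _ M20 hbe (powR_ge0 _ _).
have m3 := smallM W _ W0 (ltW hh3) (normr_ge0 h).
have m1 := alg _ _ e' K10 Kq0.
have tot : (1 + K s) * tt1 + W * `|h| <= 3 * e'.
  have -> : (1 + K s) * tt1 + W * `|h| =
    (1 + K s) * (e' / ((1 + K s) * K q) * K q) + M2 * `|h| `^ be + W * `|h|.
    by rewrite /tt1 /M2; ring.
  have -> : 3 * e' = e' + e' + e' by ring.
  by rewrite m1; apply: lerD m3; rewrite lerD2l.
apply: le_trans (ler_wpM2l CS0 tot) _.
have -> : 3 * e' = e / (CS + 1) by rewrite /e'; field; rewrite gt_eqF // ltr_wpDl.
by rewrite mulrA ler_pdivrMr ?ltr_wpDl // mulrC ler_wpM2l ?(ltW e0) // lerDl.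
Qed.

End FDerivative.

(** [fder] at 1 is the derivative of the section [f]; [opmult] converts it into the derivative of
    the operator [fop], and [bl] is the scalar multiplication with its arguments exchanged for this
    purpose. *)
Lemma fop_GR k : GR k (fun=> 1) 0 fop.
Proof.
elim: k => [|k gf]; first by split=> //; exact: fop_base.
split; first exact: fop_base.
have [L' [dL lL gL']] := GR_der (Lop_GR k.+1).
pose bl s (x : E s) (y : R^o) : E s := y *: x.
pose f1 : opfam RS ES (unit * B)%type := fder L'.
pose f2 : opfam RS ES (unit * B)%type := opmult r0 (F1 := RS) (F2 := ES) (F3 := ES) bl f1.
exists f2; split.
- move=> s r hr u hu e e0.
  have m0 : 0 <= (0 + 1 : R) by lra.
  have [h1 h2 h3 h4] := rngE m0 hr; have [s0 sr _] := hr.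
  have sr0 : s + 1 < r0 by lra.
  have [dl [dl0 hd]] := fder_isder gf dL gL' s0 sr0 hu e0.
  exists dl; split=> // h hh huh [] c m hc hb w.
  have -> : fop s r tt (u + h) c w - fop s r tt u c w - f2 s r (tt, h) u c w =
     c w *: (f s (u + h) w - f s u w - f1 s r0 (tt, h) u (fun=> 1) w).
    by rewrite /fop /f2 /opmult /bl /=; lmod_over R.
  rewrite normrZ mulr1 mulrC; by apply: ler_pM => //; exact: hd.
- move=> s r i u a h h' c hr hu hc.
  have m0 : 0 <= (0 + 1 : R) by lra.
  have hr' : rng (0 + 1) s r0 by case: hr => *; split; lra.
  apply/funext => w; rewrite /f2 /opmult /f1 (fder_linh gf lL gL') //.
  by rewrite /bl; lmod_over R.
- apply: (@GR_mult R B U d Om r0 RS ES ES bl RSok) (fder_GR gf gL').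
  + by move=> s a x x' y; rewrite /bl; lmod_over R.
  + by move=> s a x y y'; rewrite /bl scalerDl scalerA.
  + by move=> s x y; rewrite /bl normrZ mulrC.
  + by move=> s r x y hs hr; rewrite /bl /= (is_linearZ (hj_lin hs hr)).
  + by move=> s g h' hg hh; exact: (@inLinf_scale _ _ _ (E s) h').
Qed.

Lemma Lam_Linf u : U u -> inLinf (Lam u : Om -> R^o).
Proof.
move=> hu; have hr : 0 < r0 <= r0 by rewrite hr0 lexx.
apply: (@inLinf_lin _ _ _ (E r0) R^o (ell r0 : E r0 -> R^o) 1 (TR u (f r0 u))).
- exact: (is_linearB (hell_lin hr)).
- by move=> x; rewrite mul1r; exact: ell_le.
- by apply: TR_Linf => //; exact: f_Linf.
Qed.

Lemma Lamop_GR k : GR k (fun=> 1) 0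
  ((fun s r _ u c w => Lam u w *: c w) : opfam RS RS unit).
Proof.
have := @GR_mult R B U d Om r0 RS RS RS (fun s (x : R^o) (y : R^o) => x *: y) RSok
  _ _ _ _ _ k unit (fun=> 1) 0 Lam_comp (Lam_comp_GR (fop_GR k)).
move=> h; apply: (GR_ext RSok) (h _ _ _ _ _).
- move=> s r [] u phi hrn hu hp; have [h1 h2 h3 h4] := rng0 hrn.
  by apply/funext => w; rewrite /opmult Lam_compE //; lra.
- by move=> s a x x' y; rewrite scalerDl scalerA.
- by move=> s a x y y'; rewrite scalerDr !scalerA mulrC.
- by move=> s x y; rewrite normrZ.
- by [].
- by move=> s g h' hg hh; exact: (@inLinf_scale _ _ _ R^o g).
Qed.

Lemma f_Ct s t : 0 < s -> 0 < t -> s + t < r0 -> Ct (@supnorm R d Om (E s)) U t (f s).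
Proof.
move=> s0 t0 st; have hr : rng t s r0 by split.
have := GR_Ct hUopen t0 hr (@one_L r0) (@one_b r0) fop_GR.
congr (Ct _ U t _); apply/funext => u; apply/funext => w.
by rewrite /fop scale1r.
Qed.

Lemma Lam_Ct s t : 0 < s -> 0 < t -> s + t < r0 ->
  Ct (@supnorm R d Om R^o) U t (Lam : B -> Om -> R^o).
Proof.
move=> s0 t0 st; have hr : rng t s r0 by split.
have := GR_Ct hUopen t0 hr (@one_L r0) (@one_b r0) Lamop_GR.
congr (Ct _ U t _); apply/funext => u; apply/funext => w.
exact: mulr1.
Qed.

End FixedPoint.

(** * The characteristic exponent *)

Section LogIntegral.
Variables (R : realType) (B : normedModType R) (U : set B) (r0 : R).
Variables (d : measure_display) (Om : measurableType d) (P : probability Om R).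
Variables (lam : B -> Om -> R) (k0 : R).
Local Notation opfam := (opfam B Om).
Local Notation rng := (rng r0).
Local Notation base := (base U r0).
Local Notation GR := (GR U r0).
Local Notation RS := (real_scale R).
Hypothesis Uopen : open U.
Hypothesis k0_gt0 : 0 < k0.
Hypothesis lam_ge : forall u w, U u -> k0 <= lam u w.
Hypothesis lam_L : forall u, U u -> inLinf (lam u : Om -> R^o).

Definition multop (a : B -> Om -> R) : opfam RS RS unit := fun s r _ u c w => a u w *: c w.
Arguments multop a s r _ u c _ : clear implicits.

Hypothesis lam_GR : forall k, GR k (fun=> 1) 0 (multop lam).

Let RSok := real_scale_ok r0.
Let one_L := @one_Linf R d Om.
Let one_b := @one_bnd R d Om.

Let lam_gt0 u w : U u -> 0 < lam u w.
Proof. by move=> hu; exact: lt_le_trans k0_gt0 (lam_ge w hu). Qed.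

Definition invmult (s : R) (u : B) (x : Om -> sp RS s) : Om -> sp RS s :=
  fun w => (lam u w)^-1 *: x w.

(** Division by [lam] is the inverse of multiplication by [lam], bounded by [1 / k0] on every level,
    so [GR_inv] applies. *)
Let inv_GR k : GR k (fun=> 1) 0 (opinv (F := RS) invmult).
Proof.
pose TL (s : R) (u : B) (x : Om -> sp RS s) : Om -> sp RS s := fun w => lam u w *: x w.
apply: (@GR_inv R B U d Om r0 RS (multop lam) TL invmult (fun=> k0^-1) RSok) (lam_GR k).
- by move=> s u a x y hs hu hx hy; apply/funext => w; rewrite /TL; lmod_over R.
- move=> s u x b hs hu hx hb w; have l0 := lam_gt0 w hu.
  rewrite mulrC ler_pdivlMr // mulrC; apply: le_trans (hb w).
  by rewrite /TL normrZ (gtr0_norm l0) ler_wpM2r // lam_ge.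
- by move=> s hs; rewrite invr_ge0 ltW.
- move=> s u x hs hu hx; apply: (@inLinf_scale _ _ _ R^o (fun w => (lam u w)^-1)) => //.
  exact: (inLinf_inv k0_gt0 (fun w => lam_ge w hu) (lam_L hu)).
- move=> s u x hs hu hx; apply/funext => w.
  by rewrite /TL /invmult scalerA divff ?scale1r // gt_eqF // lam_gt0.
- by [].
- by [].
Qed.

Let lam_hold al : 0 < al <= 1 -> forall s r, rng (0 + al) s r -> exists M : R, 0 <= M /\
  forall u v w, U u -> U v -> `|lam u w - lam v w| <= M * `|u - v| `^ al.
Proof.
move=> hal s r hr; have [M [M0 hM]] := b_hold (GR_base (lam_GR 0)) hr hal.
exists M; split=> // u v w hu hv; have := hM tt u v _ 1 hu hv (one_L r) (@one_b r) w.
by rewrite /multop -scalerBl [(_ - _) *: _]mulr1 !mulr1.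
Qed.

Let ln_base : base (fun=> 1) 0 (multop (fun u w => ln (lam u w))).
Proof.
split=> //.
- move=> s r i u c hr hu hc; apply: (@inLinf_scale _ _ _ R^o (fun w => ln (lam u w))) => //.
  exact: (inLinf_ln k0_gt0 (fun w => lam_ge w hu) (lam_L hu)).
- by move=> s r i u a c c' _ _ _ _; apply/funext => w; rewrite /multop; lmod_over R.
- move=> s r hr; have [M [M0 hM]] := b_bound (GR_base (lam_GR 0)) hr.
  exists (`|ln k0| + (M + k0) / k0); split.
    by rewrite addr_ge0 // divr_ge0 ?addr_ge0 // ltW.
  move=> i u c m hu hc hb w; rewrite /multop normrZ !mulr1; apply: ler_pM => //.
  have -> : ln (lam u w) = ln k0 + (ln (lam u w) - ln k0) by lra.
  apply: le_trans (ler_normD _ _) _; rewrite lerD2l.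
  apply: le_trans (ln_lipschitz k0_gt0 (lam_ge w hu) (lexx k0)) _.
  rewrite ler_wpM2r ?invr_ge0 ?(ltW k0_gt0) //.
  apply: le_trans (ler_normB _ _) _; rewrite (gtr0_norm k0_gt0) lerD2r.
  by have := hM tt u _ 1 hu (one_L r) (@one_b r) w; rewrite /multop [_ *: _]mulr1 !mulr1.
- move=> s r al hr hal; have [M [M0 hM]] := lam_hold hal hr.
  exists (M / k0); split=> [|i u v c m hu hv hc hb w]; first by rewrite divr_ge0 // ltW.
  rewrite /multop -scalerBl normrZ mulr1; apply: ler_pM => //.
  apply: le_trans (ln_lipschitz k0_gt0 (lam_ge w hu) (lam_ge w hv)) _.
  by rewrite mulrAC ler_wpM2r ?invr_ge0 ?(ltW k0_gt0) // hM.
Qed.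

(** The derivative is [lam^-1 lam'], whose two factors are already known to be regular, so a case
    analysis on [k] replaces induction. The error of [ln_taylor1] is [O(|h|^2)] because [lam] is
    Lipschitz across a gap larger than 1. *)
Lemma ln_GR k : GR k (fun=> 1) 0 (multop (fun u w => ln (lam u w))).
Proof.
case: k => [|k]; first by split=> //; exact: ln_base.
split; first exact: ln_base.
have [lam' [dl ll gl]] := GR_der (lam_GR k.+1).
have bi := GR_base (inv_GR 0); have bl := GR_base gl.
have z1 : 0 + 1 = 0 + (0 + 1) :> R by rewrite !add0r.
exists (opcomp 0 (0 + 1) (fun=> tt) id (opinv (F := RS) invmult) lam'); split.
- move=> s r hr u hu e e0; pose q := (s + r - 1) / 2.
  have a1 : rng 0 s q by case: hr => *; split; rewrite /q; lra.
  have a2 : rng (0 + 1) q r by case: hr => *; split; rewrite /q; lra.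
  have one01 : 0 < (1 : R) <= 1 by rewrite ltr01 lexx.
  have [M [M0 hM]] := lam_hold one01 a2.
  pose N := M ^+ 2 / k0 ^+ 2.
  have N0 : 0 <= N by rewrite divr_ge0 ?exprn_ge0 // ltW.
  have e1 : 0 < e * k0 / 2 by rewrite divr_gt0 // mulr_gt0.
  have e2 : 0 < e / 2 / (N + 1) by rewrite !divr_gt0 // ltr_wpDl.
  have [d1 [d10 hd1]] := dl q r a2 u hu _ e1.
  exists (Num.min d1 (e / 2 / (N + 1))); split; first by rewrite lt_min d10.
  move=> h; rewrite lt_min => /andP[hh1 hh2] huh [] c m hc hb w.
  rewrite (opcompE _ _ bi bl (tt, h) a1 a2 hu hc) /opinv /invmult /multop /=.
  set x := lam (u + h) w; set y := lam u w; set z := lam' q r (tt, h) u c w.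
  have kx : k0 <= x := lam_ge w huh; have ky : k0 <= y := lam_ge w hu.
  have y0 : 0 < y := lam_gt0 w hu.
  have -> : ln x *: c w - ln y *: c w - y^-1 *: z =
     (ln x - ln y - y^-1 * (x - y)) *: c w + y^-1 *: (x *: c w - y *: c w - z) by lmod_over R.
  apply: le_trans (ler_normD _ _) _; rewrite !normrZ.
  have m0 : 0 <= m := bnd_ge0 w hb.
  have xy : `|x - y| <= M * `|h|.
    have := hM (u + h) u w huh hu; have -> : u + h - u = h by lmod_over R.
    by rewrite powRr1.
  have p1 : `|ln x - ln y - y^-1 * (x - y)| * `|c w| <= N * `|h| * `|h| * m.
    apply: ler_pM => //.
    apply: le_trans (ln_taylor1 k0_gt0 kx ky) _.
    have -> : N * `|h| * `|h| = (M * `|h|) ^+ 2 / k0 ^+ 2 by rewrite /N; ring.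
    rewrite ler_wpM2r ?invr_ge0 ?exprn_ge0 ?(ltW k0_gt0) //.
    by rewrite -(real_normK (num_real (x - y))) lerXn2r ?nnegrE // mulr_ge0.
  have p2 : `|y^-1| * `|x *: c w - y *: c w - z| <= k0^-1 * (e * k0 / 2 * `|h| * 1 * m).
    apply: ler_pM => //; last exact: (hd1 h hh1 huh tt c m hc hb w).
    by rewrite ger0_norm ?invr_ge0 ?(ltW y0) // lef_pV2 ?posrE.
  apply: le_trans (lerD p1 p2) _.
  have -> : k0^-1 * (e * k0 / 2 * `|h| * 1 * m) = e / 2 * (`|h| * m).
    by field; rewrite gt_eqF.
  have -> : N * `|h| * `|h| * m = N * `|h| * (`|h| * m) by ring.
  have -> : e * `|h| * 1 * m = e / 2 * (`|h| * m) + e / 2 * (`|h| * m) by field.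
  rewrite lerD2r ler_wpM2r ?mulr_ge0 //.
  have N1 : 0 < N + 1 by lra.
  have := ltW hh2; rewrite ler_pdivlMr // mulrDr mulr1 mulrC => /(le_trans _); apply.
  by rewrite lerDl.
- exact: (linh_comp_inner (nu := fun _ : unit => 1) tt z1 bi bl ll).
- by apply: (GR_comp RSok z1 _ (inv_GR k) gl) => i; rewrite mul1r.
Qed.

Let Linf_integrable (c : Om -> R^o) : inLinf c -> P.-integrable setT (EFin \o (c : Om -> R)).
Proof.
move=> hc; have [_ [m hm]] := hc.
apply: (le_integrable measurableT (g := EFin \o cst `|m|)).
- by apply/measurable_realfun.measurable_EFinP; exact: inLinf_measurable.
- move=> w _ /=; rewrite lee_fin; apply: le_trans (hm w) _.
  by rewrite normr_id ler_norm.
- exact: finite_measure_integrable_cst.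
Qed.

(** The integral is returned as a constant function, which keeps it inside the constant scale;
    [Ct_eval] extracts the number at the end. *)
Definition intop : opfam RS RS unit := fun s r _ u c w => Rintegral P setT (c : Om -> R).

Lemma intop_GR k : GR k (fun=> 1) 0 intop.
Proof.
apply: GR_const => //; split=> //.
- by move=> s r i u c hr hu hc; exact: inLinf_cst.
- move=> s r i u a c c' hr hu hc hc'; apply/funext => w; rewrite /intop.
  have ic := Linf_integrable hc; have ic' := Linf_integrable hc'.
  have iac := Linf_integrable (inLinfZ a hc).
  rewrite (@RintegralD _ _ _ P setT (fun w => a * c w) c' measurableT iac ic').
  by rewrite RintegralZl.
- move=> s r hr; exists 1; split=> // i u c m hu hc hb w; rewrite !mul1r /intop.
  have ic := Linf_integrable hc; have m0 := bnd_ge0 w hb.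
  apply: le_trans (le_normr_Rintegral measurableT ic) _.
  have ia : P.-integrable setT (EFin \o (fun w => `|c w|)).
    apply: (le_integrable measurableT (g := EFin \o (c : Om -> R))) => //.
      apply/measurable_realfun.measurable_EFinP; apply: measurableT_comp => //; exact: inLinf_measurable.
    by move=> x _ /=; rewrite normr_id.
  have im : P.-integrable setT (EFin \o cst m) by exact: finite_measure_integrable_cst.
  apply: le_trans (le_Rintegral measurableT ia im (fun x _ => hb x)) _.
  rewrite [leLHS](Rintegral_cst P measurableT m).
  by have -> : fine (P setT) = 1; [rewrite probability_setT|rewrite mulr1].
- move=> s r al hr hal; exists 0; split=> // i u v c m hu hv hc hb w.
  by rewrite subrr normr0 !mul0r.
Qed.

(** Evaluation at a point is linear and does not increase the norm, so applying it to every
    derivative preserves all the estimates. *)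
Lemma Ct_eval (W : normedModType R) (w0 : Om) (t : R) (g : B -> Om -> W) :
  Ct (@supnorm R d Om W) U t g -> Ct (fun x : W => (`|x|)%:E) U t (fun u => g u w0).
Proof.
have sup (y : Om -> W) : ((`|y w0|)%:E <= supnorm y)%E by apply: ereal_sup_ubound; exists w0.
have ml k (M : ('I_k -> B) -> Om -> W) (c : R) :
    (mlnorm (@supnorm R d Om W) M <= c%:E)%E ->
    (mlnorm (fun x : W => (`|x|)%:E) (fun v => M v w0) <= c%:E)%E.
  move=> h; apply: ge_ereal_sup => _ [v hv <-]; apply: le_trans (sup _) _.
  by apply: le_trans h; apply: ereal_sup_ubound; exists v.
case=> [[t0 h]|[k [al [et hal [D [D0 Dm [M hM] Dd [C hC]]]]]]].
  left; split=> // u hu e e0; have [dl [dl0 hd]] := h u hu e e0.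
  by exists dl; split=> // v hv hvu; apply: le_trans (sup (g v - g u)) (hd v hv hvu).
right; exists k, al; split=> //; exists (fun j u v => D j u v w0); split.
- by move=> u v hu; rewrite D0.
- by move=> j u hj hu i v a x y; rewrite Dm.
- by exists M => j u hj hu; apply: ml; exact: hM.
- move=> j u hj hu e e0; have [dl [dl0 hd]] := Dd j u hj hu e e0.
  exists dl; split=> // h hh huh; have := ml _ _ _ (hd h hh huh).
  by [].
- by exists C => u v hu hv; have := ml _ _ _ (hC u v hu hv).
Qed.

Lemma chi_Ct s t : 0 < s -> 0 < t -> s + t < r0 ->
  Ct (fun x : R^o => (`|x|)%:E) U t
    ((fun u => Rintegral P setT (fun w => ln (lam u w))) : B -> R^o).
Proof.
move=> s0 t0 st; have hr : rng t s r0 by split.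
have g k : GR k (fun=> 1) 0
    (opcomp 0 0 id id intop (multop (fun u w => ln (lam u w)))).
  by apply: (GR_comp RSok _ _ (intop_GR k) (ln_GR k)) => *; rewrite ?addr0 ?mulr1.
have := Ct_eval point (GR_Ct Uopen t0 hr (one_L r0) (@one_b r0) g).
congr (Ct _ U t _); apply/funext => u; rewrite /opcomp /intop /multop.
by congr Rintegral; apply/funext => w; exact: mulr1.
Qed.

End LogIntegral.

Unset Implicit Arguments.

Theorem theorem3p2
  (R : realType) (B : completeNormedModType R) (U : set B) (r0 : R)
  (d : measure_display) (Om : measurableType d) (P : probability Om R)
  (tau tauinv : Om -> Om)
  (E : R -> completeNormedModType R) (C : forall r : R, set (E r))
  (ell : forall r : R, E r -> R) (K rho vth : R -> R)
  (j : forall s r : R, E r -> E s)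
  (L : forall r : R, B -> Om -> E r -> E r)
  (f : forall r : R, B -> Om -> E r)
  (* U non-empty open convex *)
  (hUne : exists u, U u) (hUopen : open U)
  (hUconv : forall x y (t : R), U x -> U y -> 0 <= t <= 1 -> U (t *: x + (1 - t) *: y))
  (hr0 : 0 < r0)
  (* tau invertible, measure-preserving, ergodic *)
  (htau_meas : measurable_fun setT tau) (htauinv_meas : measurable_fun setT tauinv)
  (htau1 : cancel tau tauinv) (htau2 : cancel tauinv tau)
  (htau_pres : forall A, measurable A -> P (tau @^-1` A) = P A)
  (htau_erg : forall A, measurable A -> tau @^-1` A = A -> P A = 0%E \/ P A = 1%E)
  (* cones, functionals, constants *)
  (hC : forall r, 0 < r <= r0 -> closed_convex_cone (C r))
  (hell_lin : forall r, 0 < r <= r0 -> is_linear (ell r : E r -> R^o))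
  (hell_cont : forall r, 0 < r <= r0 -> continuous (ell r))
  (hell_norm : forall r, 0 < r <= r0 -> opnorm (ell r : E r -> R^o) = 1%E)
  (hK : forall r, 0 < r <= r0 -> 1 <= K r)
  (hrho : forall r, 0 < r <= r0 -> 0 < rho r <= 1)
  (hvth : forall r, 0 < r <= r0 -> 1 <= vth r)
  (hell_cone : forall r, 0 < r <= r0 -> forall phi, C r phi -> `|phi| / K r <= ell r phi)
  (hCrho_ne : forall r, 0 < r <= r0 -> exists phi, cone_rho (C r) (rho r) phi /\ phi <> 0)
  (hunif : forall a, 0 < a <= r0 -> exists M : R, forall r, a <= r <= r0 ->
      [/\ K r <= M, vth r <= M & M^-1 <= rho r])
  (* the injections j_{s,r} *)
  (hj_lin : forall s r, 0 < s < r -> r <= r0 -> is_linear (j s r))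
  (hj_cont : forall s r, 0 < s < r -> r <= r0 -> continuous (j s r))
  (hj_inj : forall s r, 0 < s < r -> r <= r0 -> injective (j s r))
  (hj_bd : exists M : R, forall s r, 0 < s < r -> r <= r0 -> (opnorm (j s r) <= M%:E)%E)
  (hj_comp : forall t s r, 0 < t < s -> s < r -> r <= r0 ->
      forall x, j t s (j s r x) = j t r x)
  (hj_cone : forall s r, 0 < s < r -> r <= r0 -> forall x, C r x -> C s (j s r x))
  (hj_ell : forall s r, 0 < s < r -> r <= r0 -> forall x, ell r x = ell s (j s r x))
  (* the transfer operators *)
  (hL_lin : forall r u w, 0 < r <= r0 -> U u -> is_linear (L r u w))
  (hL_cont : forall r u w, 0 < r <= r0 -> U u -> continuous (L r u w))
  (hL_cone : forall r u w, 0 < r <= r0 -> U u -> forall phi, C r phi -> phi <> 0 ->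
      cone_rho (C r) (rho r) (L r u w phi) /\ L r u w phi <> 0)
  (hL_norm : forall r u w, 0 < r <= r0 -> U u ->
      (((vth r)^-1)%:E <= opnorm (L r u w))%E /\ (opnorm (L r u w) <= (vth r)%:E)%E)
  (hL_meas : forall r u, 0 < r <= r0 -> U u -> forall phi : Om -> E r, inLinf phi ->
      bochner_measurable (fun w => L r u (tauinv w) (phi (tauinv w))))
  (hL_j : forall s r u w, 0 < s < r -> r <= r0 -> U u ->
      forall x, j s r (L r u w x) = L s u w (j s r x))
  (* f_r(u): the fixed point of pi_{r,u} with values in {phi in C_r(rho_r) : <ell_r,phi> = 1} *)
  (hf : forall r u, 0 < r <= r0 -> U u ->
      [/\ inLinf (f r u),
          (forall w, cone_rho (C r) (rho r) (f r u w) /\ ell r (f r u w) = 1)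
        & (forall w, f r u w =
             (ell r (L r u (tauinv w) (f r u (tauinv w))))^-1
               *: L r u (tauinv w) (f r u (tauinv w)))])
  (* regularity hypothesis: u |-> L_{s,u} j_{s,r} in L(X_r, X_s) is C^t *)
  (hreg : forall s r (t : R), 0 < s < r -> r <= r0 -> 0 <= t < r - s ->
      Ct (@Linf_opnorm R d Om (E r) (E s)) U t
        (fun u (phi : Om -> E r) => fun w => L s u (tauinv w) (j s r (phi (tauinv w))))) :
  let Lam := fun (u : B) (w : Om) => ell r0 (L r0 u (tauinv w) (f r0 u (tauinv w))) in
  let chi := fun u : B => Rintegral P setT (fun w => ln (Lam u w)) in
  (forall s (t : R), 0 < s < r0 -> 0 < t < r0 - s ->
     [/\ Ct (@supnorm R d Om (E s)) U t (f s),
         Ct (@supnorm R d Om R^o) U t (Lam : B -> Om -> R^o)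
       & Ct (fun x : R^o => (`|x|)%:E) U t (chi : B -> R^o)]) /\
  (forall eps : R, 0 < eps < r0 ->
     Ct (fun x : R^o => (`|x|)%:E) U (r0 - eps) (chi : B -> R^o)).
Proof.
move=> Lam chi.
have kmin : 0 < lam_min (K r0) (rho r0) (vth r0) by exact: Lam_min_gt0 hr0 hK hrho hvth.
have Lge u w : U u -> lam_min (K r0) (rho r0) (vth r0) <= Lam u w.
  exact: (Lam_ge hr0 hC hell_lin hell_norm hK hrho hvth hell_cone hL_lin hL_cone hL_norm hf).
have LL u : U u -> inLinf (Lam u : Om -> R^o).
  exact: (Lam_Linf hr0 hell_lin hell_norm hvth hL_lin hL_norm hL_meas hf).
have gL k : GR U r0 k (fun=> 1) 0 (multop Lam).
  exact: (Lamop_GR hUopen hC hell_lin hell_norm hK hrho hvth hell_cone hj_lin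
    hj_bd hj_comp hj_cone hj_ell hL_lin hL_cone hL_norm hL_meas hL_j hf hreg).
have chi_reg s t : 0 < s -> 0 < t -> s + t < r0 ->
    Ct (fun x : R^o => (`|x|)%:E) U t (chi : B -> R^o).
  by move=> s0 t0 st; exact: (chi_Ct P hUopen kmin Lge LL gL s0 t0 st).
split=> [s t /andP[s0 sr] /andP[t0 tr]|eps /andP[e0 er]].
  have st : s + t < r0 by lra.
  split; last exact: chi_reg st.
    exact: (f_Ct hUopen hC hell_lin hell_norm hK hrho hvth hell_cone hj_lin
      hj_bd hj_comp hj_cone hj_ell hL_lin hL_cone hL_norm hL_meas hL_j hf hreg).
  exact: (Lam_Ct hUopen hC hell_lin hell_norm hK hrho hvth hell_cone hj_lin
    hj_bd hj_comp hj_cone hj_ell hL_lin hL_cone hL_norm hL_meas hL_j hf hreg s0 t0 st).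
(* [chi] does not involve the level [s]: any [s] in [(0, eps)] leaves room for the exponent
   [r0 - eps]. *)
by apply: (chi_reg (eps / 2)); lra.
Qed.
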